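(* Let $p>2$ be a prime and $K$ a complete nonarchimedean field extension of $\mathbb{Q}_p$. Let $$G=\left\{\begin{pmatrix}a&b\\0&a^{-1}\end{pmatrix}: a\in\mathbb{Q}_p^\times,\ b\in\mathbb{Q}_p\right\},\qquad H_0=\left\{\begin{pmatrix}a&b\\0&a^{-1}\end{pmatrix}\in G: a\in 1+p\mathbb{Z}_p,\ b\in p\mathbb{Z}_p\right\},$$ and $H=H_0Z_G$ with $Z_G=\{\pm I_2\}$ the centre of $G$. Let $j\geq 1$, let $\sigma:(p\mathbb{Z}_p,+)\to K^\times$ be a smooth character with $\ker\sigma=p^{j+1}\mathbb{Z}_p$, and let $\chi:(\mathbb{Z}_p,+)\to K^\times$ be a locally analytic character. Let $V_{\chi,\sigma}$ be the associated $p^{j-1}$-dimensional locally analytic $H$-representation, and let $X_{\chi,\sigma}:=\mathrm{c\text{-}Ind}_H^GV_{\chi,\sigma}$. Then the representation $X_{\chi,\sigma}$ is not admissible.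
   Context: Put $\gamma=\exp(p)\in 1+p\mathbb{Z}_p$, $h_1=\begin{pmatrix}\gamma&0\\0&\gamma^{-1}\end{pmatrix}$, $h_2=\begin{pmatrix}1&p\\0&1\end{pmatrix}$; these form a topological basis of the uniform pro-$p$ group $H_0$. Let $H_{j-1}\le H_0$ be the closed subgroup topologically generated by $h_1^{p^{j-1}}$ and $h_2$. Let $W_{\chi,\sigma}$ be the one-dimensional locally analytic representation of $H_{j-1}$ over $K$ determined by $h_1^{p^{j-1}}\mapsto\chi(1)$, $h_2\mapsto\sigma(p)$ (i.e. $h_1^{p^{j-1}x}h_2^{y}\mapsto \chi(x)\sigma(py)$ for $x,y\in\mathbb{Z}_p$). Set $V_{\chi,\sigma}=\mathrm{Ind}_{H_{j-1}}^{H_0}W_{\chi,\sigma}$ (finite index induction), extended to $H=H_0Z_G$ by letting $-I_2$ act trivially. For an open subgroup $H\le G$ and a locally analytic $H$-representation $V$, $\mathrm{c\text{-}Ind}_H^GV$ is the space of functions $f:G\to V$ with $f(gh)=h^{-1}f(g)$ for all $g\in G$, $h\in H$, supported on finitely many cosets $gH$, with action $(g*f)(g')=f(g^{-1}g')$ and the locally convex direct sum topology of $\bigoplus_{g\in G/H}V$. A locally analytic $G$-representation $V$ (of compact type) over $K$ is admissible (Schneider--Teitelbaum) if its strong dual $V'$ is a coadmissible module over the Fréchet--Stein algebra $D(H_0,K)$ of $K$-valued locally $\mathbb{Q}_p$-analytic distributions, for some (equivalently any) compact open subgroup $H_0\le G$. *)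

(* Defs.v *)
From HB Require Import structures.
From mathcomp Require Import all_boot all_order all_algebra.
From mathcomp Require Import boolp classical_sets functions reals.

Set Implicit Arguments.
Unset Strict Implicit.
Unset Printing Implicit Defensive.

Import Order.TTheory GRing.Theory Num.Theory.
Local Open Scope classical_set_scope.
Local Open Scope ring_scope.

Definition na_cvg (R : realType) (F : zmodType) (N : F -> R)
    (u : nat -> F) (l : F) : Prop :=
  forall e : R, 0 < e -> exists n0 : nat, forall n : nat,
    (n0 <= n)%N -> N (u n - l) < e.

Definition na_cauchy (R : realType) (F : zmodType) (N : F -> R)
    (u : nat -> F) : Prop :=
  forall e : R, 0 < e -> exists n0 : nat, forall m n : nat,
    (n0 <= m)%N -> (n0 <= n)%N -> N (u m - u n) < e.

Definition na_complete (R : realType) (F : zmodType) (N : F -> R) : Prop :=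
  forall u, na_cauchy N u -> exists l, na_cvg N u l.

Record naField (R : realType) := NaField {
  na_field :> fieldType;
  na_abs : na_field -> R;
  na_abs_ge0 : forall x, 0 <= na_abs x;
  na_abs_eq0 : forall x, na_abs x = 0 <-> x = 0;
  na_absM : forall x y, na_abs (x * y) = na_abs x * na_abs y;
  na_abs_ultra : forall x y, na_abs (x + y) <= Num.max (na_abs x) (na_abs y);
  na_abs_complete : na_complete na_abs }.

Arguments na_abs {R _} _.

(* Q_p is the completion of Q for the p-adic absolute value; the value on
   positive integers determines the one on Q. *)
Definition is_Qp (R : realType) (p : nat) (F : naField R) : Prop :=
  (forall n : nat, (0 < n)%N -> na_abs (n%:R : F) = p%:R ^- logn p n) /\
  (forall (x : F) (e : R), 0 < e -> exists r : rat, na_abs (x - ratr r) < e).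

Definition padicZ (R : realType) (F : naField R) : set F := [set x | na_abs x <= 1].

Definition padicpZ (R : realType) (F : naField R) (p k : nat) : set F :=
  [set p%:R ^+ k * z | z in @padicZ R F].

Arguments padicZ {R} F.
Arguments padicpZ {R} F p k.

(* A locally convex K-vector space is a subspace of an ambient module together
   with the set of its continuous seminorms, given as functions on the ambient
   module of which only the values on the carrier matter. *)
Record lcs (R : realType) (K : naField R) (E : lmodType K) := Lcs {
  lcs_carrier :> E -> Prop;
  lcs_csn : set (E -> R) }.

Definition is_seminorm (R : realType) (K : naField R) (E : lmodType K)
    (A : set E) (s : E -> R) : Prop :=
  [/\ forall v, A v -> 0 <= s v,
      forall (c : K) v, A v -> s (c *: v) = na_abs c * s v
    & forall v w, A v -> A w -> s (v + w) <= Num.max (s v) (s w)].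

Definition lcs_line (R : realType) (K : naField R) : lcs (K^o : lmodType K) :=
  @Lcs R K K^o setT
    [set s | is_seminorm setT s /\
       exists M : R, forall c : K^o, s c <= M * na_abs (c : K)].

Definition lcs_bounded (R : realType) (K : naField R) (E : lmodType K)
    (V : lcs E) (B : set E) : Prop :=
  B `<=` lcs_carrier V /\
  forall s, lcs_csn V s -> exists M : R, forall v, B v -> s v <= M.

(* The value 0 off the carrier makes equality in E -> K the equality of
   functionals on V. *)
Definition dual_set (R : realType) (K : naField R) (E : lmodType K)
    (V : lcs E) : set (E -> K^o) :=
  [set l : E -> K^o | [/\ forall (c : K) v w, V v -> V w ->
                 l (c *: v + w) = c *: l v + l w,
               lcs_csn V (fun v => na_abs (l v : K))
             & forall v, ~ V v -> l v = 0]].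

(* A seminorm is continuous for the strong topology iff it is dominated by a
   multiple of sup_(v in B) |l v| for some bounded B. *)
Definition strong_dual (R : realType) (K : naField R) (E : lmodType K)
    (V : lcs E) : lcs (E -> K^o) :=
  Lcs (dual_set V)
    [set s | is_seminorm (dual_set V) s /\
       exists (B : set E) (M : R), lcs_bounded V B /\
         forall l (b : R), dual_set V l -> 0 <= b ->
           (forall v, B v -> na_abs (l v : K) <= b) -> s l <= M * b].

Section Analytic.
Variables (R : realType) (p : nat) (Qp K : naField R) (iota : {rmorphism Qp -> K}).

Definition monomial_at (d N : nat) (x : 'rV[Qp]_d) (a : {ffun 'I_d -> 'I_N}) : Qp :=
  \prod_(k < d) x 0 k ^+ a k.

(* On the points of C whose coordinates phi are within p^-n of those of x0, f is
   the sum of a power series in phi - phi(x0) which converges on the closed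
   polydisc of radius p^-n and has Gauss norm <= B there. *)
Definition analytic_near (T : Type) (d : nat) (phi : T -> 'rV[Qp]_d) (C : set T)
    (f : T -> K) (x0 : T) (n : nat) (B : R) : Prop :=
  exists c : {ffun 'I_d -> nat} -> K,
  let size a : R := na_abs (c a) * p%:R ^- (n * \sum_(k < d) a k) in
  [/\ forall a, size a <= B,
      forall e : R, 0 < e -> exists N : nat, forall a : {ffun 'I_d -> nat},
        (N <= \sum_(k < d) a k)%N -> size a < e
    & forall x, C x ->
        (forall k, na_abs (phi x 0 k - phi x0 0 k) <= p%:R ^- n) ->
        na_cvg na_abs
          (fun N => \sum_(a : {ffun 'I_d -> 'I_N})
             c [ffun k => nat_of_ord (a k)] *
             iota (monomial_at (phi x - phi x0) a))
          (f x)].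

Definition locally_analytic (T : Type) (d : nat) (phi : T -> 'rV[Qp]_d)
    (C : set T) (f : T -> K) : Prop :=
  forall x0, C x0 -> exists n B, analytic_near phi C f x0 n B.

(* C^an(C, K) for C compact and open in a manifold with global chart phi: the
   locally convex inductive limit, over n, of the Banach spaces of functions
   which are analytic on every ball of radius p^-n of C. Functions are extended
   by 0 off C. *)
Definition Can (T : Type) (d : nat) (phi : T -> 'rV[Qp]_d) (C : set T) :
    lcs (T -> K^o) :=
  let A : set (T -> K^o) :=
    [set f | locally_analytic phi C f /\ forall x, ~ C x -> f x = 0] in
  Lcs A
    [set s | is_seminorm A s /\
       forall n : nat, exists M : R, forall f (B : R), A f ->
         0 <= B -> (forall x0, C x0 -> analytic_near phi C f x0 n B) ->
         s f <= M * B].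

End Analytic.

Definition left_ideal (A : pzRingType) (I : set A) : Prop :=
  [/\ I 0, forall x y, I x -> I y -> I (x + y) & forall a x, I x -> I (a * x)].

Definition left_noetherian (A : pzRingType) : Prop :=
  forall I : set A, left_ideal I ->
    exists (n : nat) (g : 'I_n -> A),
      I = [set \sum_(k < n) a k * g k | a in [set: 'I_n -> A]].

Definition finitely_generated (A : pzRingType) (M : lmodType A) : Prop :=
  exists (n : nat) (g : 'I_n -> M),
    forall m, exists a : 'I_n -> A, m = \sum_(k < n) a k *: g k.

Section Tensor.
Variables (A B : pzRingType) (t : {rmorphism B -> A}).

Definition balanced (N : lmodType B) (T : zmodType) (beta : A -> N -> T) : Prop :=
  [/\ forall a a' x, beta (a + a') x = beta a x + beta a' x,
      forall a x x', beta a (x + x') = beta a x + beta a x'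
    & forall a b x, beta (a * t b) x = beta a (b *: x)].

(* The formal sum of pure tensors u represents 0 in the tensor product of A
   (a right B-module through t) and N over B: by the universal property, this
   is being killed by all balanced maps. *)
Definition tensor_null (N : lmodType B) (u : seq (A * N)) : Prop :=
  forall (T : zmodType) (beta : A -> N -> T), balanced beta ->
    \sum_(ax <- u) beta ax.1 ax.2 = 0.

Definition right_flat : Prop :=
  forall (N N' : lmodType B) (f : {linear N -> N'}), injective f ->
    forall u : seq (A * N),
      tensor_null [seq (ax.1, f ax.2) | ax <- u] -> tensor_null u.

(* The A-linear map a (x) m |-> a th(m) from the tensor product of A and N over
   B to M is bijective. *)
Definition base_change_iso (N : lmodType B) (M : lmodType A) (th : N -> M) : Prop :=
  [/\ forall x x', th (x + x') = th x + th x',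
      forall b x, th (b *: x) = t b *: th x,
      forall m, exists u : seq (A * N), m = \sum_(ax <- u) ax.1 *: th ax.2
    & forall u : seq (A * N),
        \sum_(ax <- u) ax.1 *: th ax.2 = 0 -> tensor_null u].

End Tensor.

(* A topological K-algebra whose underlying space is a locally convex space; the
   operations are only meaningful on the carrier. *)
Record lcalg (R : realType) (K : naField R) (E : lmodType K) := LcAlg {
  lcalg_lcs :> lcs E;
  lcalg_mul : E -> E -> E;
  lcalg_one : E }.

(* i : D -> A is the Hausdorff completion of D with respect to the algebra
   seminorm q. *)
Record is_completion (R : realType) (K : naField R) (E : lmodType K)
    (D : lcalg E) (q : E -> R) (A : pzRingType) (nrm : A -> R) (i : E -> A) : Prop := {
  compl_ge0 : forall x, 0 <= nrm x;
  compl_eq0 : forall x, nrm x = 0 <-> x = 0;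
  compl_ultra : forall x y, nrm (x - y) <= Num.max (nrm x) (nrm y);
  compl_mul : forall x y, nrm (x * y) <= nrm x * nrm y;
  compl_complete : na_complete nrm;
  compl_iD : forall l m, D l -> D m -> i (l + m) = i l + i m;
  compl_iM : forall l m, D l -> D m -> i (lcalg_mul D l m) = i l * i m;
  compl_i1 : i (lcalg_one D) = 1;
  compl_nrm : forall l, D l -> nrm (i l) = q l;
  compl_dense : forall x (e : R), 0 < e -> exists2 l, D l & nrm (x - i l) < e }.

(* An increasing sequence of continuous algebra seminorms q_n defining the
   topology of D, with left noetherian completions A_n such that A_n is flat as
   a right A_(n+1)-module. *)
Record frechet_stein (R : realType) (K : naField R) (E : lmodType K)
    (D : lcalg E) := FrechetStein {
  fs_q : nat -> E -> R;
  fs_A : nat -> pzRingType;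
  fs_nrm : forall n, fs_A n -> R;
  fs_i : forall n, E -> fs_A n;
  fs_t : forall n, {rmorphism fs_A n.+1 -> fs_A n};
  fs_csn : forall n, lcs_csn D (fs_q n);
  fs_mul : forall n l m, D l -> D m ->
    fs_q n (lcalg_mul D l m) <= fs_q n l * fs_q n m;
  fs_incr : forall n l, D l -> fs_q n l <= fs_q n.+1 l;
  fs_top : forall s, lcs_csn D s ->
    exists n (M : R), forall l, D l -> s l <= M * fs_q n l;
  fs_compl : forall n, is_completion D (fs_q n) (@fs_nrm n) (@fs_i n);
  fs_ti : forall n l, D l -> fs_t n (fs_i n.+1 l) = fs_i n l;
  fs_tcont : forall n x, fs_nrm (fs_t n x) <= fs_nrm x;
  fs_noetherian : forall n, left_noetherian (fs_A n);
  fs_flat : forall n, right_flat (fs_t n) }.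

Record coherent_sheaf (R : realType) (K : naField R) (E : lmodType K)
    (D : lcalg E) (S : frechet_stein D) := CoherentSheaf {
  cs_M : forall n, lmodType (fs_A S n);
  cs_th : forall n, cs_M n.+1 -> cs_M n;
  cs_fg : forall n, finitely_generated (cs_M n);
  cs_iso : forall n, base_change_iso (fs_t S n) (@cs_th n) }.

(* The D-module M (with action act) is isomorphic to the module of global
   sections, i.e. the projective limit, of a coherent sheaf. *)
Definition coadmissible (R : realType) (K : naField R) (E : lmodType K)
    (D : lcalg E) (M : zmodType) (X : set M) (act : E -> M -> M) : Prop :=
  exists (S : frechet_stein D) (F : coherent_sheaf S) (phi : M -> forall n, cs_M F n),
  [/\ forall x y n, X x -> X y -> phi (x + y) n = phi x n + phi y n,
      forall l x n, D l -> X x -> phi (act l x) n = fs_i S n l *: phi x n,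
      forall x n, X x -> cs_th (phi x n.+1) = phi x n,
      forall x y, X x -> X y -> (forall n, phi x n = phi y n) -> x = y
    & forall m : (forall n, cs_M F n), (forall n, cs_th (m n.+1) = m n) ->
        exists2 x, X x & forall n, phi x n = m n].

Section Groups.
Variables (R : realType) (Qp : naField R).
Local Notation Gam := 'M[Qp]_2.

Definition is_subgroup (C : set Gam) : Prop :=
  [/\ C `<=` [set g | g \is a GRing.unit], C 1,
      forall g h, C g -> C h -> C (g * h) & forall g, C g -> C g^-1].

Definition mx_open (U : set Gam) : Prop :=
  forall g, U g -> exists2 e : R, 0 < e &
    forall h : Gam, (forall i k, na_abs (h i k - g i k) < e) -> U h.

Definition mx_closed (C : set Gam) : Prop := mx_open (~` C).

Definition open_in (G C : set Gam) : Prop :=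
  exists2 U, mx_open U & C = G `&` U.

Definition mx_compact (C : set Gam) : Prop :=
  forall (I : choiceType) (U : I -> set Gam), (forall i, mx_open (U i)) ->
    C `<=` \bigcup_i U i ->
    exists s : seq I, C `<=` \bigcup_(i in [set` s]) U i.

(* Closed in GL_2(Q_p), or equivalently in any closed subgroup containing S. *)
Definition top_generated (G S : set Gam) : set Gam :=
  [set g | forall C, is_subgroup C -> C `<=` G ->
     (exists2 D, mx_closed D & C = G `&` D) -> S `<=` C -> C g].

(* k = h^x for x in Z_p: h^n tends to k as the natural number n tends to x. *)
Definition mx_padic_power (h : Gam) (x : Qp) (k : Gam) : Prop :=
  forall e : R, 0 < e -> exists2 d : R, 0 < d &
    forall n : nat, na_abs (n%:R - x) < d ->
      forall i l, na_abs ((h ^+ n) i l - k i l) < e.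

Definition upper_mx (a b : Qp) : Gam :=
  \matrix_(i < 2, k < 2)
    if i == 0 then (if k == 0 then a else b) else (if k == 0 then 0 else a^-1).

Definition borel : set Gam := [set g | exists a b, a != 0 /\ g = upper_mx a b].

Definition H0 (p : nat) : set Gam :=
  [set g | exists a b, [/\ padicpZ Qp p 1 (a - 1), padicpZ Qp p 1 b & g = upper_mx a b]].

Definition H0Z (p : nat) : set Gam :=
  [set g | exists h z, [/\ H0 p h, z = 1 \/ z = -1 & g = h * z]].

Definition padic_exp (x : Qp) : Qp :=
  xget 0 [set l | na_cvg na_abs (fun N => \sum_(n < N) x ^+ n / n`!%:R) l].

Definition h1 (p : nat) : Gam := upper_mx (padic_exp p%:R) 0.
Definition h2 (p : nat) : Gam := upper_mx 1 p%:R.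

(* Shifted index: Hsub p j is the group H_(j-1). *)
Definition Hsub (p j : nat) : set Gam :=
  top_generated borel [set h1 p ^+ (p ^ j.-1)%N; h2 p].

Variable K : naField R.

Record rep (E : lmodType K) := Rep { rep_space :> lcs E; rep_act : Gam -> E -> E }.

Section Induction.
Variables (E : lmodType K) (G H : set Gam) (V : rep E).

(* Elements of c-Ind are extended by 0 off G. *)
Definition cInd_set : set (Gam -> E) :=
  [set f | [/\ forall g, ~ G g -> f g = 0,
               forall g, G g -> V (f g),
               forall g h, G g -> H h -> f (g * h) = rep_act V h^-1 (f g)
             & exists s : seq Gam, forall g, f g != 0 ->
                 exists x h, [/\ x \in s, H h & g = x * h]]].

(* The function in c-Ind supported on gH with value v at g. *)
Definition cInd_bump (g : Gam) (v : E) : Gam -> E :=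
  patch (fun=> 0) [set x | H (g^-1 * x)] (fun x => rep_act V (x^-1 * g) v).

(* Compact induction, with the locally convex direct sum topology: a seminorm is
   continuous iff its restriction to each summand V, embedded by cInd_bump g,
   is. *)
Definition cInd : rep (Gam -> E) :=
  Rep (Lcs cInd_set
         [set s | is_seminorm cInd_set s /\
            forall g, G g -> lcs_csn V (fun v => s (cInd_bump g v))])
      (fun g f x => f (g^-1 * x)).

End Induction.

(* Extension of a representation of H0 to H0 Z_G with -1 acting trivially. *)
Definition extend_center (p : nat) (E : lmodType K) (V : rep E) : rep E :=
  Rep V (fun g v => if g \in H0 p then rep_act V g v else rep_act V (- g) v).

Variables (p : nat) (iota : {rmorphism Qp -> K}).

(* A matrix in the Borel subgroup has global coordinates (a, b), its first
   row. *)
Definition borel_chart (g : Gam) : 'rV[Qp]_2 := row 0 g.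

Definition CanG (C : set Gam) : lcs (Gam -> K^o) := Can p iota borel_chart C.

Definition convolution (C : set Gam) (l m : (Gam -> K^o) -> K^o) :
    (Gam -> K^o) -> K^o :=
  patch (fun=> 0) (lcs_carrier (CanG C)) (fun f =>
    l (patch (fun=> 0) C (fun g => m (patch (fun=> 0) C (fun h => f (g * h)))))).

(* D(C, K): the strong dual of C^an(C, K), with convolution and unit the Dirac
   distribution at 1. *)
Definition distr (C : set Gam) : lcalg ((Gam -> K^o) -> K^o) :=
  LcAlg (strong_dual (CanG C)) (convolution C)
    (patch (fun=> 0) (lcs_carrier (CanG C)) (fun f => f 1)).

(* The action of D(C, K) on V' extending the contragredient action of C:
   (l * x)(v) = l (g |-> x (g^-1 v)). *)
Definition dual_action (E : lmodType K) (V : rep E) (C : set Gam)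
    (l : (Gam -> K^o) -> K^o) (x : E -> K^o) : E -> K^o :=
  patch (fun=> 0) (lcs_carrier V) (fun v =>
    l (patch (fun=> 0) C (fun g => x (rep_act V g^-1 v)))).

(* For V a locally analytic representation of compact type; these standing
   assumptions on V are not repeated as conjuncts, so that ~ admissible G V
   denies coadmissibility of the dual and nothing else. *)
Definition admissible (E : lmodType K) (G : set Gam) (V : rep E) : Prop :=
  exists C : set Gam,
    [/\ is_subgroup C, C `<=` G, open_in G C, mx_compact C
      & coadmissible (distr C) (lcs_carrier (strong_dual V)) (dual_action V C)].

Definition character (A : set Qp) (f : Qp -> K) : Prop :=
  (forall x, A x -> f x != 0) /\
  (forall x y, A x -> A y -> f (x + y) = f x * f y).

Definition smooth_on (A : set Qp) (f : Qp -> K) : Prop :=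
  forall x, A x -> exists2 e : R, 0 < e &
    forall y, A y -> na_abs (y - x) < e -> f y = f x.

Definition locally_analytic_on (A : set Qp) (f : Qp -> K) : Prop :=
  locally_analytic p iota (fun x => \row_(k < 1) x) A f.

Variables (j : nat) (chi sigma : Qp -> K).

(* The scalar chi(x) sigma(p y) by which h = h1^(p^(j-1) x) h2^y acts. *)
Definition W_scalar (h : Gam) : K :=
  xget 0 [set c | exists x y k1 k2,
    [/\ padicZ Qp x /\ padicZ Qp y,
        mx_padic_power (h1 p ^+ (p ^ j.-1)%N) x k1,
        mx_padic_power (h2 p) y k2,
        h = k1 * k2 & c = chi x * sigma (p%:R * y)]].

Definition W_rep : rep K^o := Rep (lcs_line K) (fun h c => W_scalar h *: c).

Definition V_rep : rep (Gam -> K^o) :=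
  extend_center p (cInd (H0 p) (Hsub p j) W_rep).

Definition X_rep : rep (Gam -> Gam -> K^o) := cInd borel (H0Z p) V_rep.

End Groups.

Arguments borel {R} Qp.

(* Main.v *)
Require Import Defs.
From HB Require Import structures.
From mathcomp Require Import all_boot all_order all_algebra.
From mathcomp Require Import boolp classical_sets functions reals.
From mathcomp Require Import ring lra zify.
Import Order.TTheory GRing.Theory Num.Theory.
Local Open Scope classical_set_scope.
Local Open Scope ring_scope.

(** Let C be a compact open subgroup of the group G of upper triangular matrices,
    let D be its algebra of distributions, and let g_k be the diagonal matrix with
    entries p^-(k0+k) and p^(k0+k).  Conjugation by the inverse of g_k fixes the
    diagonal of an element of C and multiplies its other entry by p^(2(k0+k)); for
    k0 large the latter disappears into the kernel of sigma.  So the functions in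
    X supported on the coset C g_k H form a finite-dimensional representation of C
    that does not depend on k, and X contains infinitely many copies of one
    nonzero finite-dimensional representation.  Dually, the functionals x_k that
    evaluate at g_k (deep_eval) have matrix coefficients in one finite-dimensional
    space of functions on C (isotypic, with basis iso_basis), while x_k vanishes
    on the translates under C of the function supported at g_l when k <> l
    (deep_pairing).

    A coadmissible module cannot contain such a family (isotypic_noetherian).
    Suppose that the dual of X is the module of global sections of a coherent sheaf
    (M_n) over the Banach algebras (A_n), and let Z be the submodule of the
    functionals with isotypic coefficients.  The algebra D acts on Z through
    finitely many functionals lam, which extend to A_n for n large.  The left
    ideals of the noetherian Banach algebra A_n are closed
    (noetherian_ideal_closed), so the kernel of the extension kills the image of Z
    in M_n, and A_n acts on this image through a finite-dimensional quotient,
    which is the same for all large n.  By flatness of A_n over A_(n+1) the map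
    from M_(n+1) to M_n is then injective on the image of Z; hence Z embeds into
    one noetherian module M_n.  The chain condition makes some x_n a combination
    over D of the x_k with k < n, and the value at the function supported at g_n
    is 1 on one side and 0 on the other.

    Three facts about X enter.  The scalar W_scalar is a character with the
    expected values, because the p-adic powers of exp(p^j) exhaust 1 + p^j Z_p (pow_dense)
    and conjugation moves the argument of sigma within its kernel (W_scalarM).
    The space X carries the finest locally convex topology (X_rep_finest), so its
    dual is the algebraic dual.  Finally the isotypic functions are locally
    analytic (coadmissible_basis_Can): the Dirac distribution at 1 acts as the
    identity on a coadmissible dual, so that some nonzero isotypic function is
    locally analytic, and its power series can be transported to every isotypic
    function at every point (Can_transfer). *)

Set Implicit Arguments.
Unset Strict Implicit.
Unset Printing Implicit Defensive.

(** * Ultrametric groups and fields *)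

Record ultranorm (R : realType) (V : zmodType) (N : V -> R) : Prop := Ultranorm {
  N_ge0 : forall x, 0 <= N x;
  N_eq0 : forall x, N x = 0 <-> x = 0;
  N_ultra : forall x y, N (x - y) <= Num.max (N x) (N y) }.

Section UltrametricGroup.
Variables (R : realType) (V : zmodType) (N : V -> R) (uN : ultranorm N).
Implicit Types (x y z : V) (e : R).

Lemma um0 : N 0 = 0. Proof. exact/(N_eq0 uN). Qed.

Lemma um_opp x : N (- x) = N x.
Proof.
have h y : N (- y) <= N y.
  by have := N_ultra uN 0 y; rewrite sub0r um0 max_r ?(N_ge0 uN).
by apply: le_anti; rewrite h -{1}(opprK x) h.
Qed.

Lemma um_distC x y : N (x - y) = N (y - x).
Proof. by rewrite -um_opp opprB. Qed.

Lemma um_add_le x y e : N x <= e -> N y <= e -> N (x + y) <= e.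
Proof.
move=> xe ye; rewrite -(opprK y) (le_trans (N_ultra uN _ _))//.
by rewrite ge_max um_opp xe.
Qed.

Lemma um_add_lt x y e : N x < e -> N y < e -> N (x + y) < e.
Proof.
move=> xe ye; rewrite -(opprK y) (le_lt_trans (N_ultra uN _ _))//.
by rewrite gt_max um_opp xe.
Qed.

Lemma um_dist_le y x z e : N (x - y) <= e -> N (y - z) <= e -> N (x - z) <= e.
Proof. by move=> xy yz; rewrite -(subrK y x) -addrA um_add_le. Qed.

Lemma um_dist_lt y x z e : N (x - y) < e -> N (y - z) < e -> N (x - z) < e.
Proof. by move=> xy yz; rewrite -(subrK y x) -addrA um_add_lt. Qed.

Lemma um_domin x y : N y < N x -> N (x + y) = N x.
Proof.
move=> yx; apply/eqP; rewrite eq_le um_add_le ?(ltW yx)//=.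
rewrite leNgt; apply/negP => xyx.
have := um_add_lt xyx (_ : N (- y) < N x).
by rewrite um_opp addrK ltxx => /(_ yx).
Qed.

Lemma um_near x y : N (x - y) < N y -> N x = N y.
Proof. by move=> h; rewrite -{1}(subrK y x) addrC um_domin. Qed.

Lemma um_sum_le (I : Type) (r : seq I) (P : pred I) (f : I -> V) e :
  0 <= e -> (forall i, P i -> N (f i) <= e) -> N (\sum_(i <- r | P i) f i) <= e.
Proof.
move=> e0 fe; elim/big_ind: _ => //; first by rewrite um0.
by move=> x y; apply: um_add_le.
Qed.

Lemma um_sum_lt (I : Type) (r : seq I) (P : pred I) (f : I -> V) e :
  0 < e -> (forall i, P i -> N (f i) < e) -> N (\sum_(i <- r | P i) f i) < e.
Proof.
move=> e0 fe; elim/big_ind: _ => //; first by rewrite um0.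
by move=> x y; apply: um_add_lt.
Qed.

Lemma um_eq0_small x : (forall e, 0 < e -> N x < e) -> x = 0.
Proof.
move=> h; apply/(N_eq0 uN)/eqP; apply: contraT => x0.
by have := h (N x); rewrite lt_def x0 (N_ge0 uN) ltxx => /(_ isT).
Qed.

Lemma um_cvg_unique u l l' : na_cvg N u l -> na_cvg N u l' -> l = l'.
Proof.
move=> ul ul'; apply/subr0_eq/um_eq0_small => e e0.
have [n hn] := ul e e0; have [m hm] := ul' e e0.
apply: (@um_dist_lt (u (maxn n m))).
- by rewrite um_distC hn// leq_maxl.
- by rewrite hm// leq_maxr.
Qed.

(** The ultrametric inequality bounds the diameter of a tail by its consecutive
    differences. *)
Lemma um_tail_lt (u : nat -> V) e n0 : 0 < e ->
  (forall n, (n0 <= n)%N -> N (u n.+1 - u n) < e) ->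
  forall n, (n0 <= n)%N -> N (u n - u n0) < e.
Proof.
move=> e0 hn; elim=> [|n IH]; first by rewrite leqn0 => /eqP ->; rewrite subrr um0.
rewrite leq_eqVlt => /orP[/eqP <-|]; first by rewrite subrr um0.
rewrite ltnS => n0n; apply: (um_dist_lt (hn n n0n)); exact: IH.
Qed.

Lemma um_cauchy_step (u : nat -> V) :
  (forall e : R, 0 < e -> exists n0, forall n, (n0 <= n)%N ->
      N (u n.+1 - u n) < e) -> na_cauchy N u.
Proof.
move=> h e e0; have [n0 hn] := h e e0; exists n0 => m n mn nn.
apply: (um_dist_lt (um_tail_lt e0 hn mn)).
by rewrite um_distC (um_tail_lt e0 hn).
Qed.

Lemma um_cvg_le u l x e n0 : na_cvg N u l -> 0 < e ->
  (forall n, (n0 <= n)%N -> N (u n - x) <= e) -> N (l - x) <= e.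
Proof.
move=> ul e0 h; have [n1 hn] := ul e e0.
apply: (@um_dist_le (u (maxn n0 n1))).
- by rewrite um_distC ltW// hn// leq_maxr.
- by rewrite h// leq_maxl.
Qed.

End UltrametricGroup.

Section NonarchimedeanField.
Variables (R : realType) (F : naField R).
Implicit Types x y : F.

Lemma na_abs0 : na_abs (0 : F) = 0.
Proof. exact/na_abs_eq0. Qed.

Lemma na_abs_neq0 x : x != 0 -> na_abs x != 0.
Proof. by move=> x0; apply/eqP => /na_abs_eq0; apply/eqP. Qed.

Lemma na_abs_gt0 x : x != 0 -> 0 < na_abs x.
Proof. by move=> x0; rewrite lt_def na_abs_neq0//= na_abs_ge0. Qed.

Lemma na_abs1 : na_abs (1 : F) = 1.
Proof.
apply: (mulfI (na_abs_neq0 (oner_neq0 F))).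
by rewrite -na_absM !mulr1.
Qed.

Lemma na_absX x n : na_abs (x ^+ n) = na_abs x ^+ n.
Proof. by elim: n => [|n IH]; rewrite ?expr0 ?na_abs1// !exprS na_absM IH. Qed.

Lemma na_absB x y : na_abs (x - y) <= Num.max (na_abs x) (na_abs y).
Proof.
suff <- : na_abs (- y) = na_abs y by exact: na_abs_ultra.
apply/eqP; rewrite -(@eqrXn2 _ 2) ?na_abs_ge0//.
by rewrite -!na_absX sqrrN.
Qed.

Lemma na_ultranorm : ultranorm (@na_abs R F).
Proof. by split; [exact: na_abs_ge0|exact: na_abs_eq0|exact: na_absB]. Qed.

Lemma na_absV x : na_abs x^-1 = (na_abs x)^-1.
Proof.
have [->|x0] := eqVneq x 0; first by rewrite invr0 na_abs0 invr0.
apply: (mulfI (na_abs_neq0 x0)).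
by rewrite -na_absM !mulfV ?na_abs1 ?na_abs_neq0.
Qed.

Definition na_absN := um_opp na_ultranorm.
Definition na_absBC := um_distC na_ultranorm.
Definition na_abs_le_max := um_add_le na_ultranorm.
Definition na_abs_lt_max := um_add_lt na_ultranorm.
Definition na_abs_dist_le := um_dist_le na_ultranorm.
Definition na_abs_dist_lt := um_dist_lt na_ultranorm.
Definition na_abs_domin := um_domin na_ultranorm.
Definition na_abs_near := um_near na_ultranorm.
Definition na_abs_sum_le := um_sum_le na_ultranorm.
Definition na_abs_sum_lt := um_sum_lt na_ultranorm.
Definition na_abs_eq0_small := um_eq0_small na_ultranorm.
Definition na_cvg_unique := um_cvg_unique na_ultranorm.
Definition na_cauchy_step := um_cauchy_step na_ultranorm.
Definition na_cvg_le := um_cvg_le na_ultranorm.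

Lemma na_abs_nat_le1 n : na_abs (n%:R : F) <= 1.
Proof.
elim: n => [|n IH]; first by rewrite na_abs0.
by rewrite -natr1 na_abs_le_max ?na_abs1.
Qed.

Lemma na_abs_int_nat (z : int) : na_abs (z%:~R : F) = na_abs (`|z|%N%:R : F).
Proof. by case: z => n; rewrite ?NegzE ?mulrNz ?na_absN -?pmulrn ?absz_nat//. Qed.

End NonarchimedeanField.

Lemma geom_lt (R : realType) (q : R) (e : R) : 1 < q -> 0 < e ->
  exists n0 : nat, forall n, (n0 <= n)%N -> q ^- n < e.
Proof.
move=> q1 e0; have q0 : 0 < q by rewrite (lt_trans ltr01).
pose n0 := Num.bound (e^-1 / (q - 1)).
have hn0 : e^-1 < n0%:R * (q - 1).
  rewrite -ltr_pdivrMr ?subr_gt0//.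
  by apply: archi_boundP; apply: divr_ge0; rewrite ?invr_ge0 ?subr_ge0 ltW.
have bern n : n%:R * (q - 1) <= q ^+ n.
  suff : 1 + n%:R * (q - 1) <= q ^+ n.
    by apply: le_trans; rewrite lerDr ler01.
  elim: n => [|n IH]; first by rewrite mul0r addr0 expr0.
  rewrite exprS (le_trans _ (ler_wpM2l (ltW q0) IH))//.
  rewrite -subr_ge0 -natr1.
  rewrite [leRHS](_ : _ = n%:R * (q - 1) ^+ 2); last by ring.
  by rewrite mulr_ge0// sqr_ge0.
exists n0 => n n0n; rewrite -(invrK e) ltf_pV2 ?posrE ?invr_gt0 ?exprn_gt0//.
apply: (lt_le_trans hn0); apply: (le_trans (bern n0)).
by rewrite ler_weXn2l// ltW.
Qed.

(** * Noetherian modules *)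

Section Noetherian.
Variables (A : pzRingType) (M : lmodType A).
Hypothesis Anoeth : left_noetherian A.

Definition submod (P : set M) : Prop :=
  [/\ P 0, forall x y, P x -> P y -> P (x + y) & forall a x, P x -> P (a *: x)].

Lemma submod_sum (P : set M) (I : Type) (r : seq I) (Q : pred I) (f : I -> M) :
  submod P -> (forall i, Q i -> P (f i)) -> P (\sum_(i <- r | Q i) f i).
Proof. by move=> [P0 PD _] h; elim/big_ind: _. Qed.

(** Induction on the number of generators of the ambient module: the leading
    coefficients with respect to the last generator form a finitely generated left
    ideal, and the elements with leading coefficient 0 lie in a module with one
    generator less. *)
Lemma submod_fg n (g : 'I_n -> M) (P : set M) : submod P ->
  (forall y, P y -> exists a : 'I_n -> A, y = \sum_(k < n) a k *: g k) ->
  exists m (h : 'I_m -> M), (forall k, P (h k)) /\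
    forall y, P y -> exists a : 'I_m -> A, y = \sum_(k < m) a k *: h k.
Proof.
elim: n g P => [|n IH] g P sP Pg.
  exists 0%N, (fun k => 0); split=> [[]//|y /Pg[a ->]].
  by exists (fun=> 0); rewrite !big_ord0.
have [P0 PD PZ] := sP.
pose span b : M := \sum_(k < n) b k *: g (widen_ord (leqnSn n) k).
have spanD b b' : span (fun k => b k + b' k) = span b + span b'.
  by rewrite -big_split; apply: eq_bigr => k _; rewrite scalerDl.
have spanZ c b : span (fun k => c * b k) = c *: span b.
  by rewrite /span scaler_sumr; apply: eq_bigr => k _; rewrite scalerA.
pose I := [set a : A | exists b, P (span b + a *: g ord_max)].
have lI : left_ideal I.
  split.
  - by exists (fun=> 0); rewrite scale0r addr0 /span big1// => k _; rewrite scale0r.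
  - move=> x y [b Pb] [b' Pb']; exists (fun k => b k + b' k).
    by rewrite spanD scalerDl addrACA; apply: PD.
  - move=> a x [b Pb]; exists (fun k => a * b k).
    by rewrite spanZ -scalerA -scalerDr; apply: PZ.
have [m [c Ic]] := Anoeth lI.
have cI k : I (c k).
  rewrite Ic; exists (fun l => (l == k)%:R) => //.
  rewrite (bigD1 k)//= eqxx mul1r big1 ?addr0// => l /negbTE ->.
  by rewrite mul0r.
have [b Pb] := choice cI.
pose y k := span (b k) + c k *: g ord_max.
pose Q := P `&` [set z | exists a, z = span a].
have sQ : submod Q.
  split.
  - split=> //; exists (fun=> 0); rewrite /span big1// => k _; exact: scale0r.
  - move=> z z' [Pz [a za]] [Pz' [a' za']]; split; first exact: PD.
    by exists (fun k => a k + a' k); rewrite spanD za za'.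
  - move=> a z [Pz [a' za']]; split; first exact: PZ.
    by exists (fun k => a * a' k); rewrite spanZ za'.
have [m' [h' [Qh' gh']]] := IH (fun k => g (widen_ord (leqnSn n) k)) Q sQ
  (fun z => @proj2 _ _).
exists (m + m')%N, (fun k => match fintype.split k with inl i => y i | inr i => h' i end).
split=> [k|z Pz]; first by case: fintype.split => i; [exact: Pb|case: (Qh' i)].
have [a za] := Pg z Pz.
have : I (a ord_max).
  exists (fun k => a (widen_ord (leqnSn n) k)).
  by move: Pz; rewrite za big_ord_recr.
rewrite Ic => -[d _ da].
have /gh'[d' zd'] : Q (z - \sum_(k < m) d k *: y k).
  split.
    apply: PD => //; rewrite -scaleN1r; apply: (PZ); apply: submod_sum => // k _.
    exact/PZ/Pb.
  exists (fun k => a (widen_ord (leqnSn n) k) + - 1 * \sum_(i < m) d i * b i k).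
  have -> : \sum_(k < m) d k *: y k =
      span (fun k => \sum_(i < m) d i * b i k) + a ord_max *: g ord_max.
    rewrite -da scaler_suml; under eq_bigr do rewrite scalerDr scalerA.
    rewrite big_split/=; congr (_ + _).
    rewrite /span; under eq_bigr do rewrite scaler_sumr.
    rewrite exchange_big; apply: eq_bigr => k _; rewrite scaler_suml.
    by apply: eq_bigr => i _; rewrite scalerA.
  by rewrite spanD spanZ scaleN1r za big_ord_recr/= opprD addrACA subrr addr0.
exists (fun k => match fintype.split k with inl i => d i | inr i => d' i end).
rewrite big_split_ord/= -[LHS](subrK (\sum_(k < m) d k *: y k)) zd' [RHS]addrC.
congr (_ + _); apply: eq_bigr => k _.
- by rewrite -[rshift _ k]/(unsplit (inr k)) unsplitK.
- by rewrite -[lshift _ k]/(unsplit (inl k)) unsplitK.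
Qed.

Lemma sum_widen (x : nat -> M) (a : nat -> A) m n : (m <= n)%N ->
  \sum_(k < m) a k *: x k = \sum_(k < n) (if (k < m)%N then a k else 0) *: x k.
Proof.
move=> mn; rewrite (big_ord_widen n (fun k => a k *: x k))// big_mkcond.
by apply: eq_bigr => k _; case: ifP => // _; rewrite scale0r.
Qed.

(** The submodule generated by the whole sequence is finitely generated, so an
    initial segment generates it. *)
Lemma noetherian_seq (x : nat -> M) : finitely_generated M ->
  exists n (a : nat -> A), x n = \sum_(k < n) a k *: x k.
Proof.
move=> [n [g Mg]].
pose P := [set y | exists N (a : nat -> A), y = \sum_(k < N) a k *: x k].
have sP : submod P.
  split.
  - by exists 0%N, (fun=> 0); rewrite big_ord0.
  - move=> _ _ [N [a ->]] [N' [a' ->]].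
    exists (maxn N N').
    rewrite (sum_widen _ _ (leq_maxl N N')) (sum_widen _ _ (leq_maxr N N')).
    rewrite -big_split/=.
    exists (fun k => (if (k < N)%N then a k else 0) + (if (k < N')%N then a' k else 0)).
    by apply: eq_bigr => k _; rewrite scalerDl.
  - move=> c _ [N [a ->]]; exists N, (fun k => c * a k).
    by rewrite scaler_sumr; apply: eq_bigr => k _; rewrite scalerA.
have [m [h [Ph gh]]] := submod_fg sP (fun y _ => Mg y).
have [N /choice[a ha]] := choice Ph.
pose n1 := \max_(s < m) N s; exists n1.
have : P (x n1).
  exists n1.+1, (fun k => (k == n1)%:R).
  rewrite big_ord_recr/= eqxx scale1r big1 ?add0r// => k _.
  by rewrite (ltn_eqF (ltn_ord k)) scale0r.
move=> /gh[d ->].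
exists (fun k => \sum_(s < m) d s * (if (k < N s)%N then a s k else 0)).
under [RHS]eq_bigr do rewrite scaler_suml.
rewrite exchange_big; apply: eq_bigr => s _ /=.
rewrite ha (sum_widen _ _ (leq_bigmax s)) scaler_sumr.
by apply: eq_bigr => k _; rewrite scalerA.
Qed.

End Noetherian.

(** * Left ideals of noetherian Banach rings are closed *)

(** Rescaling is by an integer p which is topologically nilpotent, invertible and
    multiplicative for the norm; in a Banach algebra over K it comes from the
    scalars. *)
Record banach_ring (R : realType) (A : pzRingType) (nrm : A -> R) (p : nat) (q : R) :
    Prop := BanachRing {
  br_ultra : ultranorm nrm;
  br_mul : forall x y, nrm (x * y) <= nrm x * nrm y;
  br_complete : na_complete nrm;
  br_q : 0 < q < 1;
  br_scale : forall x, nrm (x *+ p) = q * nrm x;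
  br_inv : exists c : A, c *+ p = 1 }.

Section ClosedIdeals.
Variables (R : realType) (A : pzRingType) (nrm : A -> R) (p : nat) (q : R).
Hypothesis bA : banach_ring nrm p q.

Definition adherent (I : set A) (x : A) : Prop :=
  forall e : R, 0 < e -> exists2 y, I y & nrm (x - y) < e.

Let uN := br_ultra bA.

Lemma br_mul_lt a x (e : R) : 0 < e -> nrm x < e / (nrm a + 1) -> nrm (a * x) < e.
Proof.
have a0 := N_ge0 uN a; have x0 := N_ge0 uN x.
rewrite ltr_pdivlMr; last by rewrite ltr_wpDl.
by move=> e0 h; apply: (le_lt_trans (br_mul bA a x)); nra.
Qed.

Lemma br_mul_lt' a x (e : R) : 0 < e -> nrm x < e / (nrm a + 1) -> nrm (x * a) < e.
Proof.
have a0 := N_ge0 uN a; have x0 := N_ge0 uN x.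
rewrite ltr_pdivlMr; last by rewrite ltr_wpDl.
by move=> e0 h; apply: (le_lt_trans (br_mul bA x a)); nra.
Qed.

Lemma br_eps_gt0 a (e : R) : 0 < e -> 0 < e / (nrm a + 1).
Proof. by move=> e0; rewrite divr_gt0// ltr_wpDl ?(N_ge0 uN). Qed.

Lemma adherent_self (I : set A) x : I x -> adherent I x.
Proof. by move=> Ix e e0; exists x; rewrite // subrr um0. Qed.

Lemma adherent_idem (I : set A) x : adherent (adherent I) x -> adherent I x.
Proof.
move=> h e e0; have [y Iy xy] := h e e0; have [z Iz yz] := Iy e e0.
by exists z; rewrite // (um_dist_lt uN xy yz).
Qed.

Lemma adherent_add (I : set A) x y : (forall x y, I x -> I y -> I (x + y)) ->
  adherent I x -> adherent I y -> adherent I (x + y).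
Proof.
move=> ID Ix Iy e e0; have [x' Ix' xx'] := Ix e e0; have [y' Iy' yy'] := Iy e e0.
exists (x' + y'); first exact: ID.
by rewrite opprD addrACA (um_add_lt uN).
Qed.

Lemma adherent_left_ideal (I : set A) : left_ideal I -> left_ideal (adherent I).
Proof.
move=> [I0 ID IM]; split; first exact: adherent_self.
- by move=> x y; apply: adherent_add.
- move=> a x Ix e e0; have [y Iy xy] := Ix _ (br_eps_gt0 a e0).
  exists (a * y); first exact: IM.
  by rewrite -mulrBr br_mul_lt.
Qed.

Lemma br_scaleX x n : nrm (x *+ p ^ n) = q ^+ n * nrm x.
Proof.
elim: n => [|n IH]; first by rewrite expn0 mulr1n expr0 mul1r.
by rewrite expnS mulnC mulrnA (br_scale bA) IH exprS mulrA.
Qed.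

Lemma br_qX_lt (e : R) : 0 < e -> exists n0, forall n, (n0 <= n)%N -> q ^+ n < e.
Proof.
have /andP[q0 q1] := br_q bA.
move=> e0; have := @geom_lt R q^-1 e; rewrite invf_gt1// => /(_ q1 e0)[n0 h].
by exists n0 => n /h; rewrite -exprVn invrK.
Qed.

Section Baire.
Variables (J : set A) (T : nat -> set A).
Hypothesis J0 : J 0.
Hypothesis JD : forall x y, J x -> J y -> J (x + y).
Hypothesis JC : forall x, adherent J x -> J x.
Hypothesis TB : forall m x y, T m x -> T m y -> T m (x - y).
Hypothesis JT : forall x, J x -> exists m, T m x.

(** Baire's theorem for a complete group exhausted by countably many
    subgroups: if no T m were dense in a ball of J, one could escape each T m in
    turn by smaller and smaller perturbations, and the limit would lie in none
    of them. *)
Lemma baire_subgroups : exists m (r : R), 0 < r /\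
  forall x, J x -> nrm x < r -> adherent (T m) x.
Proof.
apply: contrapT => nT.
have esc m r : 0 < r -> exists x, [/\ J x, nrm x < r & exists2 e, 0 < e &
    forall t, T m t -> e <= nrm (x - t)].
  move=> r0; apply: contrapT => h; apply: nT; exists m, r; split=> // x Jx xr e e0.
  apply: contrapT => h'; apply: h; exists x; split=> //; exists e => // t Tt.
  by rewrite leNgt; apply/negP => xt; apply: h'; exists t.
pose good (s : A * R) := J s.1 /\ 0 < s.2.
pose refines m (s s' : A * R) := [/\ good s', nrm (s'.1 - s.1) < s.2, s'.2 <= s.2 / 2
  & forall t, T m t -> s'.2 <= nrm (s'.1 - t)].
have step (ms : nat * (A * R)) : exists s', good ms.2 -> refines ms.1 ms.2 s'.
  case: ms => m [s d]; have [[Js /= d0]|ng] := pselect (good (s, d)); last by exists (s, d).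
  have [[e e0 se]|ns] := pselect (exists2 e, 0 < e & forall t, T m t -> e <= nrm (s - t)).
    exists (s, Num.min e (d / 2)) => _; split=> //=.
    - by split=> //=; rewrite lt_min e0 divr_gt0.
    - by rewrite subrr um0.
    - by rewrite ge_min lexx orbT.
    - by move=> t /se; apply: le_trans; rewrite ge_min lexx.
  have [x [Jx xd [e e0 xe]]] := esc m d d0.
  exists (s + x, Num.min e (d / 2)) => _; split=> //=.
  - by split; [exact: JD|rewrite /= lt_min e0 divr_gt0].
  - by rewrite addrC addKr.
  - by rewrite ge_min lexx orbT.
  - move=> t Tt; rewrite ge_min; apply/orP; left.
    rewrite leNgt; apply/negP => sxt; apply: ns; exists e => // t' Tt'.
    rewrite leNgt; apply/negP => st'.
    have := xe _ (TB Tt Tt'); rewrite leNgt => /negP; apply.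
    have -> : x - (t - t') = (s + x - t) - (s - t').
      rewrite !opprB [s + x]addrC -!addrA; congr (x + _).
      by rewrite addrC -!addrA addNr addr0 addrC.
    by apply: (um_add_lt uN) => //; rewrite (um_opp uN).
have [f fP] := choice step.
pose s := fix s n := if n is n'.+1 then f (n', s n') else (0, 1).
have sg n : good (s n).
  by elim: n => [|n IH]; [split; rewrite //= ltr01|have [] := fP (n, s n) IH].
have sP n : refines n (s n) (s n.+1) by exact: (fP (n, s n) (sg n)).
have d_le n : (s n).2 <= 2 ^- n.
  elim: n => [|n IH]; first by rewrite expr0 invr1.
  have [_ _ h _] := sP n; apply: (le_trans h).
  by rewrite exprSr invfM ler_wpM2r// invr_ge0.
have d_mono m n : (m <= n)%N -> (s n).2 <= (s m).2.
  elim: n => [|n IH]; first by rewrite leqn0 => /eqP ->.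
  rewrite leq_eqVlt => /orP[/eqP <- //|]; rewrite ltnS => /IH; apply: le_trans.
  have [_ _ h _] := sP n; have [_ h0] := sg n; apply: (le_trans h).
  by rewrite ler_pdivrMr// ler_peMr ?ler1n// ltW.
have close m n : (m <= n)%N -> nrm ((s n).1 - (s m).1) < (s m).2.
  apply: (@um_tail_lt _ _ _ uN (fun n => (s n).1)) => [|k mk]; first by case: (sg m).
  have [_ h _ _] := sP k; apply: (lt_le_trans h); exact: d_mono.
have /(br_complete bA)[x sx] : na_cauchy nrm (fun n => (s n).1).
  apply: (um_cauchy_step uN) => e e0.
  have [n0 hn] := geom_lt (ltr1n R 2) e0; exists n0 => n n0n.
  have [_ h _ _] := sP n; apply: (lt_le_trans h).
  exact/(le_trans (d_le n))/ltW/hn.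
have xs n : nrm (x - (s n).1) < (s n).2.
  have [_ d0] := sg n; have [m hm] := sx _ d0.
  apply: (um_dist_lt uN (_ : nrm (x - (s (maxn m n)).1) < _)).
    by rewrite (um_distC uN) hm// leq_maxl.
  by apply: close; rewrite leq_maxr.
have Jx : J x.
  apply: JC => e e0; have [n hn] := sx e e0; exists (s n).1; first by case: (sg n).
  by rewrite (um_distC uN) hn.
have [m Tx] := JT Jx; have [_ _ _ h] := sP m.
by have := h x Tx; rewrite (um_distC uN) leNgt xs.
Qed.

End Baire.

Hypothesis Anoeth : left_noetherian A.

(** The closure of I is finitely generated, and by Baire's theorem elements of
    the closure have coefficients of controlled size; so the generators may be
    moved into I at the cost of a small error, which successive approximation
    absorbs. *)
Theorem noetherian_ideal_closed (I : set A) x : left_ideal I -> adherent I x -> I x.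
Proof.
move=> lI; have [I0 ID IM] := lI.
have [J0 JD JM] := adherent_left_ideal lI.
have JN y : adherent I y -> adherent I (- y) by rewrite -mulN1r; exact: JM.
have [n [g Jg]] := Anoeth (adherent_left_ideal lI).
have [c cp] := br_inv bA; have /andP[q0 q1] := br_q bA.
have gJ k : adherent I (g k).
  rewrite Jg; exists (fun l => (l == k)%:R) => //.
  rewrite (bigD1 k)//= eqxx mul1r big1 ?addr0// => l /negbTE ->.
  by rewrite mul0r.
pose T (m : nat) : set A := [set y | exists a : 'I_n -> A,
  (forall k, nrm (a k) <= m%:R) /\ y = \sum_(k < n) a k * g k].
have [|||m [r [r0 hr]]] := @baire_subgroups (adherent I) T J0 JD.
- exact: adherent_idem.
- move=> m _ _ [a [am ->]] [a' [am' ->]]; exists (fun k => a k - a' k).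
  split=> [k|]; first by rewrite (um_add_le uN)// (um_opp uN).
  by rewrite -sumrB; apply: eq_bigr => k _; rewrite mulrBl.
- move=> y; rewrite Jg => -[a _ <-]; pose m := \max_(k < n) Num.truncn (nrm (a k)).
  exists m.+1, a; split=> // k.
  apply/ltW/(lt_le_trans (truncnS_gt _)).
  by rewrite ler_nat ltnS (leq_bigmax (F := fun k => Num.truncn (nrm (a k)))).
have rq0 : 0 < r * q by rewrite mulr_gt0.
have /choice[j hj] : forall k, exists y, I y /\ nrm (g k - y) < r * q / m.+1%:R.
  move=> k; have [|y Iy gy] := gJ k (r * q / m.+1%:R); last by exists y.
  by rewrite divr_gt0.
have approx y : exists a : 'I_n -> A, adherent I y -> nrm y < r ->
    (forall k, nrm (a k) <= m%:R) /\ nrm (y - \sum_(k < n) a k * j k) < r * q.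
  have [[Jy yr]|ny] := pselect (adherent I y /\ nrm y < r); last first.
    by exists (fun=> 0) => ? ?; case: ny.
  have [_ [a [am ->]] yt] := hr y Jy yr _ rq0; exists a => _ _; split=> //.
  apply: (um_dist_lt uN yt); rewrite -sumrB; apply: (um_sum_lt uN) => // k _.
  have [_ gj] := hj k; rewrite -mulrBr; apply: (le_lt_trans (br_mul bA _ _)).
  rewrite ltr_pdivlMr// in gj; apply: le_lt_trans gj.
  rewrite mulrC ler_wpM2l ?(N_ge0 uN)// (le_trans (am k))// ler_nat//.
have [a aP] := choice approx.
have cK y : (c * y) *+ p = y by rewrite -mulrnAl cp mul1r.
have small y : adherent I y -> nrm y < r -> I y.
  move=> Jy yr.
  (* the error terms, rescaled to remain in the ball of radius r *)
  pose next z := c * (z - \sum_(k < n) a z k * j k).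
  pose u i := iter i next y.
  have ju k : adherent I (j k) by apply: adherent_self; case: (hj k).
  have ug i : adherent I (u i) /\ nrm (u i) < r.
    elim: i => [|i [Ju ur]] //=; split.
      apply/JM/JD => //; apply/JN.
      by elim/big_ind: _ => // k _; apply/JM.
    have [_ h] := aP _ Ju ur.
    by rewrite -(ltr_pM2l q0) -(br_scale bA) cK mulrC.
  pose b k N := \sum_(i < N) a (u i) k *+ p ^ i.
  have bP k : exists l, na_cvg nrm (b k) l.
    apply: (br_complete bA); apply: (um_cauchy_step uN) => e e0.
    have [n0 hn] := br_qX_lt (divr_gt0 e0 (ltr0Sn R m)).
    exists n0 => N /hn; rewrite /b big_ord_recr/= [X in nrm X]addrC addKr br_scaleX.
    rewrite ltr_pdivlMr//; apply: le_lt_trans; apply: ler_wpM2l; first by rewrite exprn_ge0// ltW.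
    have [Ju ur] := ug N; have [h _] := aP _ Ju ur.
    by rewrite (le_trans (h k))// ler_nat.
  have [l lP] := choice bP.
  have yE N : y = \sum_(k < n) b k N * j k + u N *+ p ^ N.
    elim: N => [|N IH].
      rewrite big1 ?add0r ?expn0 ?mulr1n// => k _.
      by rewrite /b big_ord0 mul0r.
    have -> : \sum_(k < n) b k N.+1 * j k =
        \sum_(k < n) b k N * j k + (\sum_(k < n) a (u N) k * j k) *+ p ^ N.
      rewrite -sumrMnl -big_split; apply: eq_bigr => k _.
      by rewrite /b big_ord_recr mulrDl mulrnAl.
    by rewrite -addrA expnS mulrnA [u N.+1]iterS -/(u N) /next cK -mulrnDl [X in X *+ _]addrC subrK.
  have -> : y = \sum_(k < n) l k * j k.
    apply/subr0_eq/(um_eq0_small uN) => e e0.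
    have [n0 hn] := br_qX_lt (divr_gt0 e0 r0).
    have /choice[Nk hN] : forall k, exists N, forall i, (N <= i)%N ->
        nrm (b k i - l k) < e / (nrm (j k) + 1).
      by move=> k; apply: lP; exact: br_eps_gt0.
    pose N := maxn n0 (\max_(k < n) Nk k).
    rewrite (yE N) addrAC -sumrB; apply: (um_add_lt uN).
      apply: (um_sum_lt uN) => // k _; rewrite -mulrBl br_mul_lt'// hN//.
      by rewrite leq_max leq_bigmax orbT.
    rewrite br_scaleX; have [_ ur] := ug N.
    have := hn N (leq_maxl _ _); rewrite ltr_pdivlMr//.
    by apply: le_lt_trans; rewrite ler_wpM2l ?exprn_ge0 ?ltW.
  by elim/big_ind: _ => // k _; apply: IM; case: (hj k).
move=> Jx; have [N hN] := br_qX_lt (br_eps_gt0 x r0).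
have cNK i z : (c ^+ i * z) *+ p ^ i = z.
  elim: i z => [|i IH] z; first by rewrite expr0 mul1r.
  by rewrite exprSr -mulrA expnSr mulrnA IH cK.
rewrite -(cNK N x) -mulrnAr; apply: IM; apply: small.
  by rewrite -mulr_natl; exact: JM.
rewrite br_scaleX; have := hN N (leqnn _); rewrite ltr_pdivlMr ?ltr_wpDl ?(N_ge0 uN)//.
apply: le_lt_trans; apply: ler_wpM2l; first by rewrite exprn_ge0// ltW.
by rewrite lerDl.
Qed.

End ClosedIdeals.

(** * Isotypic parts of coadmissible modules *)

Section SubLmodule.
Variables (A : pzRingType) (M : lmodType A) (P : set M).

Definition submod_pred of submod P : {pred M} := [pred x | `[< P x >]].

Variable sP : submod P.

Lemma submod_predP x : reflect (P x) (x \in submod_pred sP).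
Proof. exact: asboolP. Qed.

Fact submod_pred_closed : submod_closed (submod_pred sP).
Proof.
case: (sP) => P0 PD PZ; split; first exact/submod_predP.
move=> a x y /submod_predP Px /submod_predP Py.
by apply/submod_predP/PD => //; apply: PZ.
Qed.

HB.instance Definition _ :=
  GRing.isSubmodClosed.Build A M (submod_pred sP) submod_pred_closed.

Record submod_type := SubmodType {
  submod_val : M; _ : submod_val \in submod_pred sP }.

HB.instance Definition _ := [isSub for submod_val].
HB.instance Definition _ := [Choice of submod_type by <:].
HB.instance Definition _ := [SubChoice_isSubLmodule of submod_type by <:].

End SubLmodule.

(** In this section D acts on the submodule Z of the coadmissible module X through
    the finitely many functionals lam, of which e is a dual family.  They generate
    the dual of the image of D in the endomorphisms of Z: an element of D is killed
    by all lam_i if (lam_kill) and only if (lam_faithful) it acts as 0 on Z.  Products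
    of elements of D are taken in the completions A_n. *)
Section IsotypicPart.
Variables (R : realType) (K : naField R) (E : lmodType K) (D : lcalg E).
Variables (M : zmodType) (X : set M) (act : E -> M -> M) (p : nat).
Hypothesis p_small : 0 < na_abs (p%:R : K) < 1.
Hypothesis D_seminorm : forall s, lcs_csn D s -> is_seminorm D s.
Hypothesis D_lin : forall (c : K) l l', D l -> D l' -> D (c *: l + l').
Hypothesis D_one : D (lcalg_one D).
Variables (Z : set M).
Hypothesis ZX : Z `<=` X.
Hypothesis Z0 : Z 0.
Hypothesis ZB : forall z z', Z z -> Z z' -> Z (z - z').
Hypothesis Zact : forall l z, D l -> Z z -> Z (act l z).
Variables (m : nat) (lam : 'I_m -> E -> K) (e : 'I_m -> E).
Hypothesis lam_lin : forall i (c : K) l l', lam i (c *: l + l') = c * lam i l + lam i l'.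
Hypothesis lam_csn : forall i, lcs_csn D (fun l => na_abs (lam i l)).
Hypothesis De : forall i, D (e i).
Hypothesis lam_e : forall i k, lam i (e k) = (i == k)%:R.
Hypothesis lam_kill : forall l z, D l -> (forall i, lam i l = 0) -> Z z -> act l z = 0.
Hypothesis lam_faithful : forall l, D l -> (forall z, Z z -> act l z = 0) ->
  forall i, lam i l = 0.

Let lam0 i : lam i 0 = 0.
Proof.
have := lam_lin i 1 0 0; rewrite scaler0 addr0 mul1r => /eqP.
by rewrite addrC -subr_eq subrr => /eqP <-.
Qed.

Let lamZ i c l : lam i (c *: l) = c * lam i l.
Proof. by rewrite -[c *: l]addr0 lam_lin lam0 addr0. Qed.

Let lamD i l l' : lam i (l + l') = lam i l + lam i l'.
Proof. by rewrite -[l]scale1r lam_lin mul1r scale1r. Qed.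

Let lamB i l l' : lam i (l - l') = lam i l - lam i l'.
Proof. by rewrite -scaleN1r lamD lamZ mulN1r. Qed.

Let D0 : D 0.
Proof. by have := D_lin (-1) D_one D_one; rewrite scaleN1r addNr. Qed.

Let DZ (c : K) l : D l -> D (c *: l).
Proof. by move=> Dl; rewrite -[_ *: _]addr0; exact: D_lin. Qed.

Let DD l l' : D l -> D l' -> D (l + l').
Proof. by move=> Dl Dl'; rewrite -[l]scale1r; exact: D_lin. Qed.

Let DB l l' : D l -> D l' -> D (l - l').
Proof. by move=> Dl Dl'; rewrite -scaleN1r addrC; exact: D_lin. Qed.

Definition comb (w : 'I_m -> K) : E := \sum_(i < m) w i *: e i.

Let Dcomb w : D (comb w).
Proof. by apply: big_ind => // i _; exact: DZ. Qed.

Let lam_comb i w : lam i (comb w) = w i.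
Proof.
have -> : lam i (comb w) = \sum_(k < m) lam i (w k *: e k).
  by apply: (big_morph (lam i)).
rewrite (bigD1 i)//= lamZ lam_e eqxx mulr1 big1 ?addr0// => k ki.
by rewrite lamZ lam_e eq_sym (negbTE ki) mulr0.
Qed.

Variables (S : frechet_stein D) (F : coherent_sheaf S).
Variable phi : M -> forall n, cs_M F n.
Hypothesis phiD : forall x y n, X x -> X y -> phi (x + y) n = phi x n + phi y n.
Hypothesis phi_act : forall l x n, D l -> X x ->
  phi (act l x) n = fs_i S n l *: phi x n.
Hypothesis phi_th : forall x n, X x -> cs_th (phi x n.+1) = phi x n.
Hypothesis phi_inj : forall x y, X x -> X y -> (forall n, phi x n = phi y n) -> x = y.

Local Notation ii := (fs_i S).
Local Notation nrm := (@fs_nrm _ _ _ _ S).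
Local Notation t := (fs_t S).

Let nrm_um n : ultranorm (@nrm n).
Proof.
have c := fs_compl S n.
by split; [exact: (compl_ge0 c)|exact: (compl_eq0 c)|exact: (compl_ultra c)].
Qed.

Let iD n l l' : D l -> D l' -> ii n (l + l') = ii n l + ii n l'.
Proof. exact: (compl_iD (fs_compl S n)). Qed.

Let i0 n : ii n 0 = 0.
Proof. by apply: (addrI (ii n 0)); rewrite -iD// !addr0. Qed.

Let iB n l l' : D l -> D l' -> ii n (l - l') = ii n l - ii n l'.
Proof.
move=> Dl Dl'; apply: (addIr (ii n l')).
by rewrite -iD ?subrK//; exact: DB.
Qed.

Let iMn n l k : D l -> ii n (l *+ k) = ii n l *+ k.
Proof.
move=> Dl; elim: k => [|k IH]; first by rewrite !mulr0n i0.
by rewrite !mulrS iD ?IH// -scaler_nat; exact: DZ.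
Qed.

Let q_sn n : is_seminorm D (fs_q S n). Proof. exact/D_seminorm/fs_csn. Qed.

Let nrm_i n l : D l -> nrm (ii n l) = fs_q S n l.
Proof. exact: (compl_nrm (fs_compl S n)). Qed.

(** Multiplication by p scales the norm exactly: on the image of D this holds by
    homogeneity of the seminorm, and it passes to the completion because the norm
    is locally constant away from 0. *)
Let A_banach n : banach_ring (@nrm n) p (na_abs (p%:R : K)).
Proof.
have c := fs_compl S n; have /andP[q0 q1] := p_small.
have nMn x k : nrm (x *+ k) <= @nrm n x.
  elim: k => [|k IH]; first by rewrite mulr0n (um0 (nrm_um n)) (N_ge0 (nrm_um n)).
  by rewrite mulrS (um_add_le (nrm_um n)).
have ip l : D l -> nrm (ii n l *+ p) = na_abs (p%:R : K) * nrm (ii n l).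
  move=> Dl; rewrite -iMn// !nrm_i// -?scaler_nat; last exact: DZ.
  by have [_ qZ _] := q_sn n; exact: qZ.
split; [exact: nrm_um|exact: (compl_mul c)|exact: (compl_complete c)|exact: p_small| |].
- move=> x; have [->|x0] := eqVneq x 0.
    by rewrite mul0rn (um0 (nrm_um n)) mulr0.
  have nx0 : 0 < nrm x.
    by rewrite lt_def (N_ge0 (nrm_um n)) andbT; apply: contra_neq x0 => /(compl_eq0 c).
  have [l Dl xl] := compl_dense c x (mulr_gt0 q0 nx0).
  have xl' : nrm (ii n l - x) < nrm x.
    by rewrite (um_distC (nrm_um n)) (lt_trans xl)// gtr_pMl.
  have lx := um_near (nrm_um n) xl'.
  rewrite -lx -ip// -[in LHS](subrK (ii n l) x) mulrnDl addrC.
  rewrite (um_domin (nrm_um n))// ip// lx.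
  exact: le_lt_trans (nMn _ _) xl.
- exists (ii n (p%:R^-1 *: lcalg_one D)); rewrite -iMn; last exact: DZ.
  rewrite -scaler_nat scalerA mulfV ?scale1r ?(compl_i1 c)//.
  by apply: contraTneq q0 => ->; rewrite na_abs0 ltxx.
Qed.

(** The increasing sequence of seminorms defines the topology of D, so that from
    some level on it bounds the finitely many continuous functionals lam. *)
Let lam_bound : exists n0 (C : R), 0 < C /\
  forall n i l, (n0 <= n)%N -> D l -> na_abs (lam i l) <= C * fs_q S n l.
Proof.
have /choice[nC hC] : forall i, exists nC : nat * R,
    forall l, D l -> na_abs (lam i l) <= nC.2 * fs_q S nC.1 l.
  by move=> i; have [n [C h]] := fs_top S (lam_csn i); exists (n, C).
exists (\max_(i < m) (nC i).1), (1 + \sum_(i < m) `|(nC i).2|).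
split=> [|n i l hn Dl]; first by rewrite ltr_pwDl// sumr_ge0.
have mono n1 : forall n2, (n1 <= n2)%N -> fs_q S n1 l <= fs_q S n2 l.
  elim=> [|n2 IH]; first by rewrite leqn0 => /eqP ->.
  rewrite leq_eqVlt => /orP[/eqP <- //|]; rewrite ltnS => /IH/le_trans; apply.
  exact: fs_incr.
have q0 n1 : 0 <= fs_q S n1 l by have [h _ _] := q_sn n1; exact: h.
have ni : ((nC i).1 <= n)%N.
  by apply: leq_trans hn; rewrite (leq_bigmax (F := fun i => (nC i).1)).
apply: (le_trans (hC i l Dl)).
apply: (@le_trans _ _ (`|(nC i).2| * fs_q S (nC i).1 l)).
  by rewrite ler_wpM2r// ler_norm.
apply: ler_pM => //; last exact: mono.
rewrite (bigD1 i)//= addrCA lerDl addr_ge0// sumr_ge0//.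
Qed.

(* the kernel of lam, completed at level n *)
Let J : set E := [set l | D l /\ forall i, lam i l = 0].
Let Kn n : set (fs_A S n) := adherent (@nrm n) [set ii n l | l in J].

Let Ji n l : J l -> Kn (ii n l).
Proof. by move=> Jl; apply: (adherent_self (A_banach n)); exists l. Qed.

Let KD n a b : @Kn n a -> Kn b -> Kn (a + b).
Proof.
apply: (adherent_add (A_banach n)) => _ _ [l [Dl Jl] <-] [l' [Dl' Jl'] <-].
exists (l + l'); last by rewrite iD.
by split=> [|i]; [exact: DD|rewrite lamD Jl Jl' addr0].
Qed.

Let KN n a : @Kn n a -> Kn (- a).
Proof.
move=> Ka eps eps0; have [_ [l [Dl Jl] <-] al] := Ka _ eps0.
exists (ii n (0 - l)).
  by exists (0 - l) => //; split=> [|i]; [exact: DB|rewrite lamB lam0 Jl subrr].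
by rewrite iB// i0 sub0r -opprD (um_opp (nrm_um n)).
Qed.

Let KB n a b : @Kn n a -> Kn b -> Kn (a - b).
Proof. by move=> Ka /KN; exact: KD. Qed.

Let K_th n a : @Kn n.+1 a -> Kn (t n a).
Proof.
move=> Ka eps eps0; have [_ [l Jl <-] al] := Ka _ eps0; exists (ii n l); first by exists l.
rewrite -fs_ti; last by case: Jl.
by rewrite -rmorphB; apply: le_lt_trans al; exact: fs_tcont.
Qed.

(** The annihilator of the image of Z is a left ideal of A_n, hence closed, and it
    contains the kernel of lam. *)
Let K_kill n a z : @Kn n a -> Z z -> a *: phi z n = 0.
Proof.
move=> Ka Zz; pose I := [set a : fs_A S n | a *: phi z n = 0].
have lI : left_ideal I.
  split; rewrite /I /=; first exact: scale0r.
  - by move=> x y xz yz; rewrite scalerDl xz yz addr0.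
  - by move=> b x xz; rewrite -scalerA xz scaler0.
apply: (noetherian_ideal_closed (A_banach n) (@fs_noetherian _ _ _ _ S n) lI).
move=> eps /Ka[_ [l [Dl Jl] <-] al]; exists (ii n l) => //.
rewrite /I /= -phi_act//; last exact: ZX.
rewrite lam_kill//; apply: (addrI (phi 0 n)); rewrite -phiD ?addr0//; exact: ZX.
Qed.

Section Level.
Variables (n0 : nat) (C : R).
Hypothesis C0 : 0 < C.
Hypothesis lamC : forall n i l, (n0 <= n)%N -> D l -> na_abs (lam i l) <= C * fs_q S n l.

Let K_lam n l : (n0 <= n)%N -> D l -> Kn (ii n l) -> forall i, lam i l = 0.
Proof.
move=> nn Dl Kl i; apply: na_abs_eq0_small => eps eps0.
have [_ [l' Jl' <-]] := Kl _ (divr_gt0 eps0 C0); have [Dl' hl'] := Jl'.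
rewrite ltr_pdivlMr// -iB// nrm_i; last exact: DB.
apply: le_lt_trans; rewrite mulrC -[lam i l]subr0 -(hl' i) -lamB lamC//.
exact: DB.
Qed.

(** The finitely many functionals lam extend to the completion, since K is
    complete. *)
Let K_dec n a : (n0 <= n)%N -> exists w, @Kn n (a - ii n (comb w)).
Proof.
move=> nn; have uA := nrm_um n.
have /choice[l lP] : forall k, exists l, D l /\ nrm (a - ii n l) < 2 ^- k.
  by move=> k; have [|l Dl al] := compl_dense (fs_compl S n) a (_ : 0 < 2 ^- k);
    [rewrite invr_gt0 exprn_gt0|exists l].
have near_l eps : 0 < eps -> exists k0, forall k, (k0 <= k)%N -> nrm (a - ii n (l k)) < eps.
  move=> /(geom_lt (ltr1n R 2))[k0 h]; exists k0 => k /h; apply: lt_trans.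
  by case: (lP k).
have cau i : exists x, na_cvg na_abs (fun k => lam i (l k)) x.
  apply: na_abs_complete => eps eps0.
  have [k0 h] := near_l _ (divr_gt0 eps0 C0); exists k0 => k k' /h ha /h hb.
  have [Dk _] := lP k; have [Dk' _] := lP k'.
  rewrite -lamB; apply: (le_lt_trans (lamC _ nn (DB Dk Dk'))).
  rewrite mulrC -ltr_pdivlMr// -nrm_i ?iB//; last exact: DB.
  by apply: (um_dist_lt uA _ hb); rewrite (um_distC uA).
have [w hw] := choice cau; exists w => eps eps0.
have [k0 hk0] := near_l _ eps0.
have q0 l' : D l' -> 0 <= fs_q S n l' by have [h _ _] := q_sn n; exact: h.
have /choice[ki hki] : forall i, exists k, forall k', (k <= k')%N ->
    na_abs (lam i (l k') - w i) < eps / (fs_q S n (e i) + 1).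
  by move=> i; apply: hw; rewrite divr_gt0// ltr_wpDl// q0.
pose k := maxn k0 (\max_(i < m) ki i).
have [Dl _] := lP k.
exists (ii n (l k - comb (fun i => lam i (l k)))).
  exists (l k - comb (fun i => lam i (l k))) => //; split; first exact: DB.
  by move=> i; rewrite lamB lam_comb subrr.
rewrite iB// opprB [ii n _ - ii n (l k)]addrC addrACA [- ii n _ + _]addrC.
apply: (um_add_lt uA); first by rewrite hk0// leq_maxl.
rewrite -iB// nrm_i; last exact: DB.
rewrite /comb -sumrB.
have [_ qZ qD] := q_sn n.
suff : D (\sum_(i < m) (lam i (l k) *: e i - w i *: e i)) /\
  fs_q S n (\sum_(i < m) (lam i (l k) *: e i - w i *: e i)) < eps by case.
elim/big_ind: _ => [|x y [Dx hx] [Dy hy]|i _].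
- by split=> //; rewrite -nrm_i// i0 (um0 uA).
- split; first exact: DD.
  by apply: (le_lt_trans (qD _ _ Dx Dy)); rewrite gt_max hx.
- rewrite -scalerBl; split; first exact: DZ.
  rewrite qZ//; have := hki i k; rewrite ltr_pdivlMr ?ltr_wpDl ?q0// => h.
  apply: le_lt_trans (h _); last by rewrite leq_max leq_bigmax orbT.
  by rewrite ler_wpM2l ?na_abs_ge0// lerDl.
Qed.

Let phi_tail x y : X x -> X y -> (forall n, (n0 <= n)%N -> phi x n = phi y n) -> x = y.
Proof.
move=> Xx Xy h; apply: phi_inj => // n.
have [/h//|nn] := leqP n0 n.
have {nn} : phi x (n + (n0 - n))%N = phi y (n + (n0 - n))%N by apply: h; lia.
elim: (n0 - n)%N => [|k IH]; first by rewrite addn0.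
by rewrite addnS => /(congr1 (@cs_th _ _ _ _ _ F _)); rewrite !phi_th.
Qed.

(** The product of l and l' is congruent at each level to a combination of the e_i;
    this is the same combination at all levels since the transition maps respect
    the kernels and the coefficients are unique.  It acts on Z as the composite of
    l and l', since the sections in Z are determined by their components. *)
Let prod_comb l l' : D l -> D l' -> exists w,
  (forall n, (n0 <= n)%N -> Kn (ii n l * ii n l' - ii n (comb w))) /\
  forall z, Z z -> act (comb w) z = act l (act l' z).
Proof.
move=> Dl Dl'.
have /choice[w hw] : forall k, exists w, Kn (ii (n0 + k) l * ii (n0 + k) l' - ii (n0 + k) (comb w)).
  by move=> k; apply: K_dec; rewrite leq_addr.
have wS k : w k.+1 = w k.
  have := hw k.+1; rewrite addnS => /K_th.
  rewrite rmorphB rmorphM !fs_ti// => /(KB (hw k)).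
  rewrite opprB addrCA [_ * _ - _]addrC addrK -iB// => /K_lam h.
  apply/funext => i; apply/eqP; rewrite -subr_eq0 -!lam_comb -lamB; apply/eqP.
  by apply: h; [rewrite leq_addr|exact: DB].
have w0 k : w k = w 0%N by elim: k => [//|k IH]; rewrite wS.
have Kw n : (n0 <= n)%N -> Kn (ii n l * ii n l' - ii n (comb (w 0%N))).
  by move=> /subnKC <-; rewrite -(w0 (n - n0)%N).
exists (w 0%N); split=> // z Zz; apply: phi_tail.
- exact/ZX/Zact.
- exact/ZX/Zact/Zact.
move=> n nn; rewrite !phi_act; [|by []|exact: ZX|by []|exact/ZX/Zact|by []|exact: ZX].
apply/esym/subr0_eq; rewrite scalerA -scalerBl.
exact: K_kill (Kw n nn) Zz.
Qed.

(** If l or l' acts as 0 on Z, so does the combination representing their product,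
    which is therefore 0 by faithfulness. *)
Let K_prodJ n l l' : (n0 <= n)%N -> D l -> D l' -> J l \/ J l' -> Kn (ii n l * ii n l').
Proof.
move=> nn Dl Dl' JJ; have [w [Kw Aw]] := prod_comb Dl Dl'.
have ww : forall i, lam i (comb w) = 0.
  apply: lam_faithful => // z Zz; rewrite Aw//.
  case: JJ => -[_ h]; first by rewrite lam_kill//; exact: Zact.
  rewrite [act l' z]lam_kill//.
  apply: (addrI (act l 0)); rewrite addr0.
  have -> : act l 0 = 0; last by rewrite addr0.
  apply: phi_tail; [exact/ZX/Zact|exact: ZX|].
  move=> k kk; rewrite phi_act//; last exact: ZX.
  have -> : phi 0 k = 0; last by rewrite scaler0.
  by apply: (addrI (phi 0 k)); rewrite -phiD ?addr0//; exact: ZX.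
rewrite -(subrK (ii n (comb w)) (ii n l * ii n l')).
by apply: KD; [exact: Kw|apply: Ji; split].
Qed.

Let K_mul n a b : (n0 <= n)%N -> @Kn n a \/ Kn b -> Kn (a * b).
Proof.
move=> nn ab; have bA := A_banach n.
apply: (adherent_idem bA) => eps eps0.
have [l [Dl al Jl]] : exists l, [/\ D l, nrm (a - ii n l) < eps / (nrm b + 1)
    & @Kn n a -> J l].
  have d0 := br_eps_gt0 bA b eps0.
  have [Ka|nKa] := pselect (Kn a); last first.
    by have [l Dl al] := compl_dense (fs_compl S n) a d0; exists l.
  by have [_ [l Jl <-] al] := Ka _ d0; exists l; split=> //; case: Jl.
have [l' [Dl' bl' Jl']] : exists l', [/\ D l', nrm (b - ii n l') < eps / (nrm (ii n l) + 1)
    & @Kn n b -> J l'].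
  have d0 := br_eps_gt0 bA (ii n l) eps0.
  have [Kb|nKb] := pselect (Kn b); last first.
    by have [l' Dl' bl'] := compl_dense (fs_compl S n) b d0; exists l'.
  by have [_ [l' Jl' <-] bl'] := Kb _ d0; exists l'; split=> //; case: Jl'.
exists (ii n l * ii n l').
  by apply: K_prodJ => //; case: ab => [/Jl|/Jl']; [left|right].
rewrite -(subrK (ii n l * b) (a * b)) -mulrBl -addrA -mulrBr.
by apply: (um_add_lt (nrm_um n)); [exact: (br_mul_lt' bA)|exact: (br_mul_lt bA)].
Qed.

(** Flatness makes the transition maps injective on Z: the submodule N of the
    classes of Z at level n+1 is acted upon through the finite-dimensional
    quotient by the kernel of lam, and this quotient is the same at level n; so
    A_n tensor N retracts onto N. *)
Let th_inj n z : (n0 <= n)%N -> Z z -> phi z n = 0 -> phi z n.+1 = 0.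
Proof.
move=> nn Zz zn; have nn1 : (n0 <= n.+1)%N by rewrite leqW.
have [_ _ _ iso] := cs_iso F n.
pose P := [set phi z n.+1 | z in Z].
have actP k a z' w : Kn (a - ii k (comb w)) -> Z z' ->
    a *: phi z' k = phi (act (comb w) z') k.
  move=> Kw Zz'; rewrite phi_act//; last exact: ZX.
  by apply: subr0_eq; rewrite -scalerBl; exact: K_kill.
have phi0 : phi 0 n.+1 = 0.
  by apply: (addrI (phi 0 n.+1)); rewrite -phiD ?addr0//; exact: ZX.
have sP : submod P.
  split; first by exists 0.
  - move=> _ _ [z1 Zz1 <-] [z2 Zz2 <-]; exists (z1 - (0 - z2)).
      by apply: (ZB) => //; exact: ZB.
    rewrite sub0r opprK phiD//; exact: ZX.
  - move=> a _ [z1 Zz1 <-]; have [w Kw] := K_dec a nn1.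
    by exists (act (comb w) z1); [exact: Zact|rewrite (actP _ _ _ _ Kw)].
have [w hw] := choice (fun a : fs_A S n => K_dec a nn).
have w_uniq a w' : Kn (a - ii n (comb w')) -> w a = w'.
  move=> Kw'; have := KB Kw' (hw a); rewrite opprB addrC.
  have -> : ii n (comb (w a)) - a + (a - ii n (comb w')) = ii n (comb (w a) - comb w').
    by rewrite iB// addrA subrK.
  move=> /K_lam h; apply/funext => i; apply/eqP.
  rewrite -subr_eq0 -!lam_comb -lamB; apply/eqP.
  by apply: h => //; exact: DB.
pose beta (a : fs_A S n) (u : submod_type sP) := ii n.+1 (comb (w a)) *: submod_val u.
have comb_D w1 w2 : comb (fun i => w1 i + w2 i) = comb w1 + comb w2.
  by rewrite /comb -big_split; apply: eq_bigr => i _; rewrite scalerDl.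
have bal : balanced (t n) beta.
  split.
  - move=> a a' u; rewrite /beta -scalerDl -iD// -comb_D; congr (ii _ (comb _) *: _).
    apply: w_uniq; rewrite comb_D iD// opprD addrACA; exact: KD.
  - by move=> a u u'; rewrite /beta scalerDr.
  - move=> a b u; rewrite /beta /=.
    have /submod_predP[z' Zz' <-] : submod_val u \in submod_pred sP by case: (u).
    have [v Kv] := K_dec b nn1; rewrite (actP _ _ _ _ Kv)//.
    have [w' [Kw' Aw']] := prod_comb (Dcomb (w a)) (Dcomb v).
    have -> : w (a * t n b) = w'.
      apply: w_uniq.
      rewrite -(subrK (ii n (comb (w a)) * ii n (comb v)) (a * t n b)) -addrA.
      apply: KD; last exact: Kw'.
      rewrite -(subrK (ii n (comb (w a)) * t n b) (a * t n b)) -addrA.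
      rewrite -mulrBl -mulrBr; apply: KD; apply: K_mul => //; [left|right]; first exact: hw.
      by rewrite -fs_ti// -rmorphB; exact: K_th.
    rewrite -phi_act//; last exact: ZX.
    rewrite Aw'// phi_act//; exact/ZX/Zact.
have Pz : phi z n.+1 \in submod_pred sP by apply/submod_predP; exists z.
have inj_val : injective (@submod_val _ _ _ sP) by exact: val_inj.
have := @fs_flat _ _ _ _ S n (submod_type sP) (cs_M F n.+1)
  (\val : {linear submod_type sP -> cs_M F n.+1}) inj_val [:: (1, SubmodType Pz)].
move=> /(_ _ _ beta bal); rewrite big_cons big_nil addr0 /beta /=.
have -> : w 1 = (fun i => lam i (lcalg_one D)).
  apply: w_uniq; rewrite -(compl_i1 (fs_compl S n)) -iB//; apply: Ji.
  by split=> [|i]; [exact: DB|rewrite lamB lam_comb subrr].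
have -> : ii n.+1 (comb (fun i => lam i (lcalg_one D))) *: phi z n.+1 = phi z n.+1.
  apply/esym; rewrite -[LHS]scale1r; apply: subr0_eq; rewrite -scalerBl.
  apply: K_kill => //; rewrite -(compl_i1 (fs_compl S n.+1)) -iB//; apply: Ji.
  by split=> [|i]; [exact: DB|rewrite lamB lam_comb subrr].
apply; apply: iso; rewrite big_cons big_nil addr0 /= scale1r phi_th//; exact: ZX.
Qed.

Lemma isotypic_noetherian_level (x : nat -> M) : (forall k, Z (x k)) ->
  exists n (b : nat -> E), (forall k, D (b k)) /\
    x n = \sum_(k < n) act (b k) (x k).
Proof.
move=> Zx; have phi0 n : phi 0 n = 0.
  by apply: (addrI (phi 0 n)); rewrite -phiD ?addr0//; exact: ZX.
have inj z : Z z -> phi z n0 = 0 -> z = 0.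
  move=> Zz zn; apply: phi_tail; [exact: ZX|exact: ZX|].
  move=> n /subnKC <-; rewrite phi0; elim: (n - n0)%N => [|k IH]; first by rewrite addn0.
  by rewrite addnS th_inj// leq_addr.
have [n [a xa]] := noetherian_seq (@fs_noetherian _ _ _ _ S n0) (fun k => phi (x k) n0) (cs_fg F n0).
have [w Kw] := choice (fun k => K_dec (a k) (leqnn n0)).
exists n, (fun k => comb (w k)); split=> //.
have Zs : Z (\sum_(k < n) act (comb (w k)) (x k)).
  elim/big_ind: _ => // [z z' Zz Zz'|k _]; last exact: Zact.
  have -> : z + z' = z - (0 - z') by rewrite sub0r opprK.
  by apply: (ZB) => //; exact: ZB.
apply: subr0_eq; apply: inj; first exact: ZB.
have phiB z z' : Z z -> Z z' -> phi (z - z') n0 = phi z n0 - phi z' n0.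
  move=> Zz Zz'; apply: (addIr (phi z' n0)); rewrite subrK -phiD ?subrK//; apply: ZX => //.
  exact: ZB.
rewrite phiB//; apply/eqP; rewrite subr_eq0; apply/eqP; rewrite xa.
have -> : phi (\sum_(k < n) act (comb (w k)) (x k)) n0 =
    \sum_(k < n) phi (act (comb (w k)) (x k)) n0.
  apply: (proj2 (A := Z (\sum_(k < n) act (comb (w k)) (x k)))).
  elim/big_rec2: _ => [|k u y _ [Zy <-]]; first by rewrite phi0.
  rewrite phiD; [|exact/ZX/Zact|exact: ZX]; split=> //.
  have -> : act (comb (w k)) (x k) + y = act (comb (w k)) (x k) - (0 - y).
    by rewrite sub0r opprK.
  by apply: (ZB); [exact: Zact|exact: ZB].
apply: eq_bigr => k _; rewrite phi_act//; last exact: ZX.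
by apply: subr0_eq; rewrite -scalerBl; exact: K_kill.
Qed.

End Level.

Lemma isotypic_noetherian (x : nat -> M) : (forall k, Z (x k)) ->
  exists n (b : nat -> E), (forall k, D (b k)) /\
    x n = \sum_(k < n) act (b k) (x k).
Proof.
have [n0 [C [C0 lamC]]] := lam_bound.
exact: (@isotypic_noetherian_level n0 C C0 lamC).
Qed.

End IsotypicPart.

(** * Arithmetic of Q_p *)

Section PadicNumbers.
Variables (R : realType) (p : nat) (Qp : naField R).
Hypothesis p_prime : prime p.
Hypothesis p_odd : (2 < p)%N.
Hypothesis hQp : is_Qp p Qp.
Implicit Types (x y a : Qp).

Local Notation eps k := ((p%:R : R) ^- k).

Let p_gt1 : 1 < p%:R :> R.
Proof. by rewrite ltr1n prime_gt1. Qed.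

Lemma eps_gt0 k : 0 < eps k.
Proof. by rewrite invr_gt0 exprn_gt0// (lt_trans _ p_gt1). Qed.

Lemma eps_le k l : (k <= l)%N -> eps l <= eps k.
Proof.
move=> kl; rewrite lef_pV2 ?posrE ?exprn_gt0 ?(lt_trans ltr01 p_gt1)//.
by rewrite ler_weXn2l// ltW.
Qed.

Lemma eps_lt k l : (k < l)%N -> eps l < eps k.
Proof.
move=> kl; rewrite ltf_pV2 ?posrE ?exprn_gt0 ?(lt_trans ltr01 p_gt1)//.
by rewrite ltr_eXn2l.
Qed.

Lemma eps_le1 k : eps k <= 1.
Proof. by have := eps_le (leq0n k); rewrite expr0 invr1. Qed.

Lemma eps_small (e : R) : 0 < e -> exists k, eps k < e.
Proof. by move=> /(geom_lt p_gt1)[k h]; exists k; apply: h. Qed.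

Lemma epsD k l : eps (k + l) = eps k * eps l.
Proof. by rewrite exprD invfM. Qed.

Lemma abs_natE n : (0 < n)%N -> na_abs (n%:R : Qp) = eps (logn p n).
Proof. by case: hQp => h _; exact: h. Qed.

Lemma natQp_neq0 n : (0 < n)%N -> n%:R != 0 :> Qp.
Proof.
move=> n0; apply/eqP => h; have := abs_natE n0.
by rewrite h na_abs0 => /eqP; rewrite lt_eqF// eps_gt0.
Qed.

Lemma abs_p : na_abs (p%:R : Qp) = (p%:R)^-1.
Proof. by rewrite abs_natE ?prime_gt0// logn_prime// eqxx. Qed.

Lemma abs_pX k : na_abs (p%:R ^+ k : Qp) = eps k.
Proof. by rewrite na_absX abs_p exprVn. Qed.

Lemma padicpZE k x : padicpZ Qp p k x <-> na_abs x <= eps k.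
Proof.
split=> [[z /= zp <-]|xk].
  by rewrite na_absM abs_pX ler_piMr// ltW ?eps_gt0.
have pk0 : p%:R ^+ k != 0 :> Qp by rewrite expf_neq0 ?natQp_neq0 ?prime_gt0.
exists (x / p%:R ^+ k); last by rewrite mulrC divfK.
rewrite /padicZ /= na_absM na_absV abs_pX invrK mulrC.
by rewrite -[leRHS](mulfV (lt0r_neq0 (eps_gt0 k))) invrK mulrC ler_wpM2r// exprn_ge0.
Qed.

Lemma abs_nat_dvd n i : (na_abs (n%:R : Qp) <= eps i) = (p ^ i %| n)%N.
Proof.
case: n => [|n]; first by rewrite na_abs0 dvdn0 ltW// eps_gt0.
rewrite abs_natE// pfactor_dvdn//; apply/idP/idP; last exact: eps_le.
by apply: contraTT; rewrite -ltnNge -ltNge; exact: eps_lt.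
Qed.

Lemma abs_subn m n : (n <= m)%N ->
  na_abs (m%:R - n%:R : Qp) = na_abs ((m - n)%N%:R : Qp).
Proof. by move=> nm; rewrite natrB. Qed.

Lemma abs_eqmod m n i : m = n %[mod p ^ i] -> na_abs (m%:R - n%:R : Qp) <= eps i.
Proof.
wlog nm : m n / (n <= m)%N => [hw mn|].
  have [/hw|/ltnW/hw] := leqP n m; first exact.
  by rewrite na_absBC; apply.
move/eqP; rewrite eqn_mod_dvd// -abs_nat_dvd.
by rewrite abs_subn.
Qed.

(** The natural numbers are dense in Z_p: a rational number of absolute value at
    most 1 has denominator prime to p, which is invertible modulo powers of p. *)
Lemma nat_dense x i : na_abs x <= 1 ->
  exists2 m, (m < p ^ i)%N & na_abs (x - m%:R) <= eps i.
Proof.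
move=> x1; have [r xr] := (proj2 hQp) x _ (eps_gt0 i).
have r1 : na_abs (ratr r : Qp) <= 1.
  rewrite -[ratr r](subKr x) na_abs_le_max// na_absN.
  exact: le_trans (ltW xr) (eps_le1 i).
pose a := numq r; pose b := `|denq r|%N.
have cab : coprime `|a| b by exact: coprime_num_den.
have b0 : (0 < b)%N by rewrite absz_gt0 denq_neq0.
have re : ratr r = a%:~R / b%:R :> Qp.
  by rewrite /ratr /b -{1}(gez0_abs (denq_ge0 r)).
have pb : coprime b (p ^ i).
  rewrite coprime_sym coprimeXl// prime_coprime//; apply/negP => pb.
  have pa : na_abs (a%:~R : Qp) = 1.
    rewrite na_abs_int_nat; apply: le_anti; rewrite na_abs_nat_le1/= leNgt.
    apply/negP => a1; have : (p ^ 1 %| `|a|)%N.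
      rewrite -abs_nat_dvd; move: a1; case: `|a|%N => [|k]; first by rewrite na_abs0 ltW ?eps_gt0.
      rewrite abs_natE//; case: (logn p k.+1) => [|l _]; first by rewrite invr1 ltxx.
      exact: eps_le.
    rewrite expn1 => pa; have : (p %| gcdn `|a| b)%N by rewrite dvdn_gcd pa pb.
    by move: cab => /eqP ->; rewrite dvdn1 => /eqP p1; move: p_prime; rewrite p1.
  have b1 : na_abs (b%:R : Qp) < 1.
    have : na_abs (b%:R : Qp) <= eps 1 by rewrite abs_nat_dvd expn1.
    by move=> /le_lt_trans; apply; rewrite -[ltRHS]invr1 -(expr0 p%:R) eps_lt.
  move: r1; rewrite re na_absM na_absV pa mul1r leNgt invf_gt1 ?b1//.
  by rewrite na_abs_gt0// natQp_neq0.
have b1 : na_abs (b%:R : Qp) = 1 \/ i = 0%N.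
  case: i pb {xr} => [|i]; [by right|left].
  move: pb; rewrite coprime_pexpr// coprime_sym prime_coprime// => pb.
  by rewrite abs_natE// lognE (negbTE pb) !andbF expr0 invr1.
case: b1 => [b1|->]; last first.
  by exists 0%N => //; rewrite expr0 invr1 subr0.
have [a' aa'] : exists a' : nat, na_abs (a%:~R - a'%:R : Qp) <= eps i.
  case: (a) => n; first by exists n; rewrite subrr na_abs0 ltW// eps_gt0.
  exists (n.+1 * (p ^ i - 1))%N.
  rewrite NegzE mulrNz -opprD na_absN -pmulrn -natrD abs_nat_dvd.
  by rewrite -{1}(muln1 n.+1) -mulnDr subnKC ?expn_gt0 ?prime_gt0// dvdn_mull.
have [u ub] := coprimeP _ b0 pb; pose m0 := (a' * u.1)%N.
have ub' : (m0 * b = a' + a' * u.2 * p ^ i)%N.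
  rewrite /m0 -!mulnA -mulnS -[(u.2 * _).+1]add1n -ub subnK//.
  by rewrite ltnW// -subn_gt0 ub.
have m0b : na_abs (a'%:R - m0%:R * b%:R : Qp) <= eps i.
  by rewrite -natrM na_absBC ub' natrD [X in na_abs X]addrC addKr abs_nat_dvd dvdn_mull.
exists (m0 %% p ^ i)%N; first by rewrite ltn_mod expn_gt0 prime_gt0.
apply: (na_abs_dist_le (ltW xr)).
apply: (@na_abs_dist_le _ _ m0%:R); last by apply: abs_eqmod; rewrite modn_mod.
have -> : ratr r - m0%:R = (a%:~R - m0%:R * b%:R) / b%:R :> Qp.
  by rewrite mulrBl mulfK ?re// natQp_neq0.
by rewrite na_absM na_absV b1 invr1 mulr1 (na_abs_dist_le aa').
Qed.

(** Lifting the exponent: in the binomial expansion of theta^n - 1 the linear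
    term dominates, because p is odd. *)
Lemma abs_pow_sub1 x n : na_abs (x - 1) <= eps 1 ->
  na_abs (x ^+ n - 1) = na_abs (n%:R : Qp) * na_abs (x - 1).
Proof.
case: n => [_|n]; first by rewrite expr0 subrr na_abs0 mul0r.
rewrite -{2}(subrK 1 x); move: (x - 1) => t t1.
have [->|t0] := eqVneq t 0; first by rewrite add0r expr1n subrr na_abs0 mulr0.
rewrite exprD1n 2!big_ord_recl/= expr0 bin0 mulr1n expr1 bin1 addrC addKr -mulr_natl.
rewrite -na_absM; apply: na_abs_domin.
have tn0 : 0 < na_abs (n.+1%:R * t) by rewrite na_abs_gt0// mulf_neq0// natQp_neq0.
apply: na_abs_sum_lt => // i _; rewrite /bump/= !add1n.
set k := nat_of_ord i; have k2 : 0 < na_abs (k.+2%:R : Qp).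
  by rewrite na_abs_gt0// natQp_neq0.
have bin_k : k.+2%:R * (t ^+ k.+2 *+ 'C(n.+1, k.+2)) =
    n.+1%:R * t * ('C(n, k.+1)%:R * t ^+ k.+1).
  have := congr1 (fun i => i%:R : Qp) (mul_bin_diag n.+1 k.+1); rewrite !natrM /= => E.
  by rewrite -[_ *+ 'C(_, _)]mulr_natl mulrA -E (exprS _ k.+1) mulrACA.
have small : na_abs (t ^+ k.+1) < na_abs (k.+2%:R : Qp).
  rewrite na_absX abs_natE//.
  apply: (@le_lt_trans _ _ (eps k.+1)).
    by rewrite -exprVn lerXn2r ?nnegrE ?na_abs_ge0 ?invr_ge0// (le_trans t1)// expr1.
  apply: eps_lt; rewrite -(ltn_exp2l _ _ (prime_gt1 p_prime)).
  apply: (@leq_ltn_trans k.+2); first by rewrite dvdn_leq// pfactor_dvdnn.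
  elim: (k) => [//|k' IH]; rewrite expnS.
  by apply: leq_ltn_trans (ltn_Pmull _ _); [exact: IH|exact: prime_gt1|rewrite expn_gt0 prime_gt0].
rewrite -(ltr_pM2l k2) -na_absM bin_k na_absM mulrC ltr_pM2r// na_absM.
by apply: le_lt_trans small; rewrite ler_piMl ?na_abs_ge0 ?na_abs_nat_le1.
Qed.


(** Legendre's formula, with the quotients by powers of p summed recursively; the
    bound uses p >= 3. *)
Lemma logn_fact_lt n : (0 < n)%N -> (2 * logn p n`! < n)%N.
Proof.
rewrite logn_fact//; move: n.+1 => N n0.
suff : (2 * \sum_(1 <= k < N) n %/ p ^ k <= n.-1)%N by case: n n0.
elim: N n n0 => [|[|N] IH] n n0; [by rewrite big_geq|by rewrite big_geq|].
rewrite big_nat_recl// expn1.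
have -> : (\sum_(1 <= k < N.+1) n %/ p ^ k.+1 = \sum_(1 <= k < N.+1) (n %/ p) %/ p ^ k)%N.
  by apply: eq_bigr => k _; rewrite expnS divnMA.
have qn : (n %/ p * p <= n)%N by exact: leq_divM.
case: (n %/ p)%N qn (IH (n %/ p)%N) => [_ _|q qn /(_ isT)].
  by rewrite add0n big1 ?muln0// => k _; rewrite div0n.
by move: (\sum_(1 <= k < N.+1) _)%N p_odd qn => s; nia.
Qed.

Lemma abs_exp_term n : (2 <= n)%N ->
  na_abs (p%:R ^+ n / n`!%:R : Qp) <= eps n.+1./2 /\
  na_abs (p%:R ^+ n / n`!%:R : Qp) <= eps 2.
Proof.
move=> n2; have /logn_fact_lt := ltnW n2; set v := logn p n`! => vn.
have -> : na_abs (p%:R ^+ n / n`!%:R : Qp) = eps (n - v).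
  rewrite na_absM na_absV abs_pX abs_natE ?fact_gt0// -/v invrK.
  rewrite -{1}(@subnK v n); last by lia.
  by rewrite epsD mulfVK// expf_neq0// pnatr_eq0 -lt0n prime_gt0.
by split; apply: eps_le; lia.
Qed.

(** The terms of the exponential series at p from the quadratic one on have
    absolute value at most p^-2, again because p is odd. *)
Lemma abs_exp_p_sub1 : na_abs (padic_exp (p%:R : Qp) - 1) = eps 1.
Proof.
rewrite /padic_exp; set P := [set l | _].
have [l Pl] : exists l, P l.
  apply: na_abs_complete; apply: na_cauchy_step => e /eps_small[k ke].
  exists (2 + k.*2)%N => n kn; rewrite big_ord_recr/= [X in na_abs X]addrC addKr.
  have [|h _] := @abs_exp_term n; first by lia.
  apply: (le_lt_trans h); apply: le_lt_trans ke; apply: eps_le; lia.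
have : P (xget 0 P) by apply: xgetPex; exists l.
move: (xget 0 P) => g Pg.
have h : na_abs (g - (1 + p%:R)) <= eps 2.
  apply: (@na_cvg_le _ _ _ _ _ _ 2%N Pg (eps_gt0 2)) => -[|[|N]]// _.
  rewrite 2!big_ord_recl/= !fact0 factS fact0 expr0 expr1 !divr1 addrA.
  rewrite [X in na_abs X]addrC addrA addNr add0r.
  apply: na_abs_sum_le => [|i _]; first by rewrite ltW// eps_gt0.
  by have [|_] := @abs_exp_term (bump 0 (bump 0 i)).
have -> : g - 1 = p%:R + (g - (1 + p%:R)) by rewrite opprD [RHS]addrC addrA subrK.
rewrite na_abs_domin abs_p ?expr1//.
by apply: (le_lt_trans h); have := @eps_lt 1 2 isT; rewrite expr1.
Qed.

End PadicNumbers.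

(** * p-adic powers of a generator of 1 + p^j Z_p *)

Section PadicPowers.
Variables (R : realType) (p : nat) (Qp : naField R).
Hypothesis p_prime : prime p.
Hypothesis p_odd : (2 < p)%N.
Hypothesis hQp : is_Qp p Qp.
Local Notation eps k := ((p%:R : R) ^- k).
Implicit Types (x y a b : Qp).

Lemma abs_unit1 j a : (1 <= j)%N -> na_abs (a - 1) <= eps j -> na_abs a = 1.
Proof.
move=> j1 aj; rewrite -(na_abs1 Qp); apply: na_abs_near.
rewrite na_abs1; apply: (le_lt_trans aj); rewrite -[ltRHS]invr1 -(expr0 p%:R).
by apply: eps_lt.
Qed.

Variables (j : nat) (th : Qp).
Hypothesis j1 : (1 <= j)%N.
Hypothesis abs_th : na_abs (th - 1) = eps j.

Lemma abs_th1 : na_abs th = 1.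
Proof. by apply: abs_unit1 j1 _; rewrite abs_th. Qed.

Lemma abs_pow_dist m n : na_abs (th ^+ m - th ^+ n) = na_abs (m%:R - n%:R : Qp) * eps j.
Proof.
wlog nm : m n / (n <= m)%N => [hw|].
  have [/hw//|/ltnW/hw h] := leqP n m.
  by rewrite na_absBC h na_absBC.
rewrite -{1}(subnK nm) exprD -{2}[th ^+ n]mul1r -mulrBl na_absM na_absX abs_th1.
rewrite expr1n mulr1 (abs_pow_sub1 p_prime p_odd hQp) ?abs_th ?abs_subn//.
exact: eps_le.
Qed.

(** a is the value at x of the extension by continuity of n |-> th^n to Z_p.  As
    this map is Lipschitz (abs_pow_dist), the limit can be stated without epsilons. *)
Definition is_pow x a : Prop := forall n : nat, na_abs (th ^+ n - a) <= na_abs (n%:R - x).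

Lemma is_powM x x' a a' : na_abs x <= 1 -> na_abs x' <= 1 -> na_abs a = 1 ->
  is_pow x a -> is_pow x' a' -> is_pow (x + x') (a * a').
Proof.
move=> x1 x1' a1 xa xa' n; rewrite leNgt; apply/negP => h.
have [k hk] := @eps_small _ _ p_prime _ (le_lt_trans (na_abs_ge0 _) h).
have [m _ mx] := nat_dense p_prime hQp k x1; have [m' _ mx'] := nat_dense p_prime hQp k x1'.
move: h; rewrite ltNge => /negP; apply.
set d := Num.max (na_abs (n%:R - (x + x'))) (eps k).
suff : na_abs (th ^+ n - a * a') <= d.
  by rewrite le_max => /orP[//|]; rewrite leNgt hk.
have dk y : na_abs y <= eps k -> na_abs y <= d by move=> h; rewrite le_max h orbT.
apply: (@na_abs_dist_le _ _ (th ^+ (m + m')%N)).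
  rewrite abs_pow_dist (le_trans (ler_piMr (na_abs_ge0 _) (eps_le1 R p_prime j)))//.
  rewrite natrD; apply: (@na_abs_dist_le _ _ (x + x')).
    by rewrite le_max lexx.
  by rewrite opprD addrACA na_abs_le_max// dk.
rewrite exprD; apply: (@na_abs_dist_le _ _ (a * th ^+ m')).
  rewrite -mulrBl na_absM na_absX abs_th1 expr1n mulr1 dk//.
  by rewrite (le_trans (xa m))// na_absBC.
by rewrite -mulrBr na_absM a1 mul1r dk// (le_trans (xa' m'))// na_absBC.
Qed.

Lemma is_pow_uniq x x' a : na_abs x <= 1 -> na_abs x' <= 1 ->
  is_pow x a -> is_pow x' a -> x = x'.
Proof.
move=> x1 x1' xa xa'; apply/subr0_eq/na_abs_eq0_small => e /(eps_small p_prime)[k ke].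
apply: le_lt_trans ke.
have [m _ mx] := nat_dense p_prime hQp (k + j) x1.
have [m' _ mx'] := nat_dense p_prime hQp (k + j) x1'.
have kj : eps (k + j) <= eps k by apply: eps_le => //; rewrite leq_addr.
apply: (na_abs_dist_le (le_trans mx kj)).
apply: (@na_abs_dist_le _ _ m'%:R); last by rewrite na_absBC (le_trans mx').
rewrite -(ler_pM2r (eps_gt0 R p_prime j)) -abs_pow_dist -epsD.
apply: (@na_abs_dist_le _ _ a); first by rewrite (le_trans (xa m))// na_absBC.
by rewrite na_absBC (le_trans (xa' m'))// na_absBC.
Qed.

Lemma is_pow_near1 x a : na_abs x <= 1 -> is_pow x a -> na_abs (a - 1) <= eps j.
Proof.
move=> x1 xa; have [m _ mx] := nat_dense p_prime hQp j x1.
apply: (@na_abs_dist_le _ _ (th ^+ m)); first by rewrite na_absBC (le_trans (xa m))// na_absBC.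
rewrite -(expr0 th) abs_pow_dist ler_piMl ?subr0 ?na_abs_nat_le1// ltW//.
exact: eps_gt0.
Qed.

(** The p^i powers th^n with n < p^i are pairwise incongruent modulo p^(j+i), so
    that they meet all the p^i residue classes of 1 + p^j Z_p. *)
Lemma pow_dense a i : na_abs (a - 1) <= eps j ->
  exists n, na_abs (th ^+ n - a) <= eps (j + i).
Proof.
move=> aj; have pj0 : p%:R ^+ j != 0 :> Qp by rewrite expf_neq0 ?(natQp_neq0 p_prime hQp) ?prime_gt0.
have dig b : na_abs (b - 1) <= eps j ->
    exists m : 'I_(p ^ i), na_abs ((b - 1) / p%:R ^+ j - m%:R) <= eps i.
  move=> bj; have [|m mi h] := @nat_dense _ _ _ p_prime hQp ((b - 1) / p%:R ^+ j) i.
    rewrite na_absM na_absV (abs_pX p_prime hQp) invrK.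
    by rewrite -ler_pdivlMr ?exprn_gt0 ?ltr0n ?prime_gt0// div1r.
  by exists (Ordinal mi).
have near b c m : na_abs ((b - 1) / p%:R ^+ j - m%:R) <= eps i ->
    na_abs ((c - 1) / p%:R ^+ j - m%:R) <= eps i -> na_abs (b - c) <= eps (j + i).
  move=> bm cm; have : na_abs ((b - 1) / p%:R ^+ j - (c - 1) / p%:R ^+ j) <= eps i.
    by apply: (na_abs_dist_le bm); rewrite na_absBC.
  rewrite -mulrBl na_absM na_absV (abs_pX p_prime hQp) opprB addrA subrK invrK.
  by rewrite -ler_pdivlMr ?exprn_gt0 ?ltr0n ?prime_gt0// addnC epsD.
have thj n : na_abs (th ^+ n - 1) <= eps j.
  rewrite -(expr0 th) abs_pow_dist ler_piMl ?subr0 ?na_abs_nat_le1// ltW//.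
  exact: eps_gt0.
have /choice[f fP] : forall n : 'I_(p ^ i), exists m : 'I_(p ^ i),
    na_abs ((th ^+ n - 1) / p%:R ^+ j - m%:R) <= eps i by move=> n; exact: dig.
have f_inj : injective f.
  move=> n n' ff; have := near _ _ _ (fP n); rewrite ff => /(_ _ (fP n')).
  wlog nn : n n' ff / (n' <= n)%N => [hw|].
    have [le|/ltnW le] := leqP n' n; first exact: hw.
    by rewrite na_absBC => h; apply/esym/hw.
  rewrite abs_pow_dist abs_subn// addnC epsD ler_pM2r ?eps_gt0//.
  rewrite (abs_nat_dvd p_prime hQp) => d; apply/val_inj/eqP.
  rewrite eqn_leq nn andbT -subn_eq0; apply: contraTT d; rewrite -lt0n => d0.
  apply/negP => /(dvdn_leq d0); have := ltn_ord n; rewrite /=; lia.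
have [m hm] := dig a aj; have [g fg gf] := injF_bij f_inj.
exists (g m); apply: near hm; rewrite -{2}(gf m); exact: fP.
Qed.

Lemma is_pow_ex a : na_abs (a - 1) <= eps j -> exists2 x, na_abs x <= 1 & is_pow x a.
Proof.
move=> aj; have [u hu] := choice (fun i => @pow_dense a i aj).
have du i k : (i <= k)%N -> na_abs ((u k)%:R - (u i)%:R : Qp) <= eps i.
  move=> ik; rewrite -(ler_pM2r (eps_gt0 R p_prime j)) -abs_pow_dist -epsD addnC.
  apply: (@na_abs_dist_le _ _ a); last by rewrite na_absBC.
  by rewrite (le_trans (hu k))// eps_le// leq_add2l.
have [x ux] : exists x, na_cvg na_abs (fun i => (u i)%:R : Qp) x.
  apply: na_abs_complete; apply: na_cauchy_step => e /(eps_small p_prime)[k ke].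
  exists k => n kn; rewrite (le_lt_trans (du _ _ (leqnSn n)))//.
  by apply: le_lt_trans ke; exact: eps_le.
exists x.
  rewrite -[x]subr0; apply: (@na_cvg_le _ _ _ _ _ _ 0 ux ltr01) => n _.
  by rewrite subr0 na_abs_nat_le1.
move=> n; rewrite leNgt; apply/negP => h.
have h0 := le_lt_trans (na_abs_ge0 _) h.
have [i hi] := ux _ h0; have [k ke] := eps_small p_prime h0.
pose m := maxn i k; move: (h); rewrite ltNge => /negP; apply.
have : na_abs (th ^+ n - a) <= Num.max (na_abs (n%:R - x)) (Num.max (na_abs ((u m)%:R - x)) (eps k)).
  apply: (@na_abs_dist_le _ _ (th ^+ u m)).
    rewrite abs_pow_dist (le_trans (ler_piMr (na_abs_ge0 _) (eps_le1 R p_prime j)))//.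
    apply: (@na_abs_dist_le _ _ x); first by rewrite le_max lexx.
    by rewrite na_absBC !le_max lexx orbT.
  rewrite (le_trans (hu m))// !le_max; apply/orP; right; apply/orP; right.
  by rewrite eps_le// (leq_trans (leq_maxr i k))// leq_addl.
rewrite !le_max => /orP[//|/orP[]]; rewrite leNgt; first by rewrite hi ?leq_maxl.
by rewrite ke.
Qed.

End PadicPowers.

(** * Upper triangular matrices and the inducing character *)

Section UpperTriangular.
Variables (R : realType) (Qp : naField R).
Implicit Types (a b : Qp) (g h : 'M[Qp]_2).

Lemma ord2P (i : 'I_2) : i = 0 \/ i = 1.
Proof. by case: i => [[|[|]]]// ?; [left|right]; apply/val_inj. Qed.

Lemma mx2P g h : g 0 0 = h 0 0 -> g 0 1 = h 0 1 -> g 1 0 = h 1 0 -> g 1 1 = h 1 1 ->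
  g = h.
Proof.
by move=> ? ? ? ?; apply/matrixP => i k; case: (ord2P i) => ->; case: (ord2P k) => ->.
Qed.

Lemma upper00 a b : upper_mx a b 0 0 = a. Proof. by rewrite mxE. Qed.
Lemma upper01 a b : upper_mx a b 0 1 = b. Proof. by rewrite mxE. Qed.
Lemma upper10 a b : upper_mx a b 1 0 = 0. Proof. by rewrite mxE. Qed.
Lemma upper11 a b : upper_mx a b 1 1 = a^-1. Proof. by rewrite mxE. Qed.
Definition upperE := (upper00, upper01, upper10, upper11).

Lemma upper_inj a b a' b' : upper_mx a b = upper_mx a' b' -> a = a' /\ b = b'.
Proof.
by move=> h; split; [rewrite -(upper00 a b) h upperE|rewrite -(upper01 a b) h upperE].
Qed.

Lemma upperM a b a' b' :
  upper_mx a b * upper_mx a' b' = upper_mx (a * a') (a * b' + b / a').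
Proof.
have l1 : lift ord0 ord0 = 1 :> 'I_2 by exact/val_inj.
by apply: mx2P; rewrite [LHS]mxE big_ord_recl big_ord1 l1 !upperE;
  rewrite ?mulr0 ?mul0r ?addr0 ?add0r// invfM.
Qed.

Lemma upper1 : upper_mx 1 0 = 1 :> 'M[Qp]_2.
Proof. by apply: mx2P; rewrite !upperE !mxE ?invr1. Qed.

Lemma upperVr a b : a != 0 -> upper_mx a b * upper_mx a^-1 (- b) = 1.
Proof. by move=> a0; rewrite upperM mulfV// invrK mulrN [b * a]mulrC addNr upper1. Qed.

Lemma upper_unit a b : a != 0 -> upper_mx a b \is a GRing.unit.
Proof.
move=> a0; apply/unitrP; exists (upper_mx a^-1 (- b)); split; last exact: upperVr.
have := @upperVr a^-1 (- b); rewrite invrK opprK; apply.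
by rewrite invr_eq0.
Qed.

Lemma upperV a b : a != 0 -> (upper_mx a b)^-1 = upper_mx a^-1 (- b).
Proof.
by move=> a0; rewrite -[LHS]mulr1 -(upperVr b a0) mulrA mulVr ?mul1r// upper_unit.
Qed.

Lemma upperN a b : - upper_mx a b = upper_mx (- a) (- b).
Proof. by apply: mx2P; rewrite [LHS]mxE !upperE ?oppr0 ?invrN. Qed.

Lemma upperX a n : upper_mx a 0 ^+ n = upper_mx (a ^+ n) 0.
Proof.
elim: n => [|n IH]; first by rewrite !expr0 upper1.
by rewrite !exprS IH upperM mulr0 mul0r addr0.
Qed.

Lemma upperXn b n : upper_mx 1 b ^+ n = upper_mx 1 (b *+ n).
Proof.
elim: n => [|n IH]; first by rewrite expr0 mulr0n upper1.
by rewrite exprS IH upperM !mul1r invr1 mulr1 mulrS addrC.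
Qed.

Lemma borel_unit g : borel Qp g -> g \is a GRing.unit.
Proof. by move=> [a [b [a0 ->]]]; exact: upper_unit. Qed.

Lemma borel_subgroup : is_subgroup (borel Qp).
Proof.
split; first by move=> g; exact: borel_unit.
- by exists 1, 0; rewrite oner_neq0 upper1.
- move=> _ _ [a [b [a0 ->]]] [a' [b' [a0' ->]]].
  by exists (a * a'), (a * b' + b / a'); rewrite upperM mulf_neq0.
- move=> _ [a [b [a0 ->]]]; exists a^-1, (- b).
  by rewrite upperV// invr_eq0.
Qed.

Lemma mx_closed_lim (D : set 'M[Qp]_2) (k : 'M[Qp]_2) : mx_closed D ->
  (forall e : R, 0 < e -> exists2 g, D g & forall i l, na_abs (g i l - k i l) < e) -> D k.
Proof.
move=> cD kD; apply: contrapT => /cD[e e0 ke].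
by have [g Dg /ke] := kD e e0.
Qed.

End UpperTriangular.

Section InducingCharacter.
Variables (R : realType) (p : nat) (Qp K : naField R) (j : nat) (chi sigma : Qp -> K).
Hypothesis p_prime : prime p.
Hypothesis p_odd : (2 < p)%N.
Hypothesis hQp : is_Qp p Qp.
Hypothesis j1 : (1 <= j)%N.
Hypothesis sigma_char : character (padicpZ Qp p 1) sigma.
Hypothesis sigma_ker : [set x | padicpZ Qp p 1 x /\ sigma x = 1] = padicpZ Qp p j.+1.
Hypothesis chi_char : character (padicZ Qp) chi.
Local Notation eps k := ((p%:R : R) ^- k).
Implicit Types (x y a b : Qp).

Let padE := padicpZE p_prime hQp.

(** H_0 is principal 1, and H_(j-1) turns out to be principal j. *)
Definition principal (k : nat) : set 'M[Qp]_2 :=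
  [set g | exists a b, [/\ na_abs (a - 1) <= eps k, na_abs b <= eps 1 & g = upper_mx a b]].

Lemma unit1_neq0 k a : (1 <= k)%N -> na_abs (a - 1) <= eps k -> a != 0.
Proof.
move=> k1 /(abs_unit1 p_prime k1) h; apply/eqP => a0.
by move: h; rewrite a0 na_abs0 => /eqP; rewrite eq_sym oner_eq0.
Qed.

Lemma H0E : H0 p = principal 1.
Proof.
by apply/seteqP; split=> _ [a [b [ha hb ->]]]; exists a, b; split=> //; apply/padE.
Qed.

Lemma near1M k a a' : (1 <= k)%N -> na_abs (a - 1) <= eps k -> na_abs (a' - 1) <= eps k ->
  na_abs (a * a' - 1) <= eps k.
Proof.
move=> k1 ha ha'; apply: (@na_abs_dist_le _ _ a) => //.
by rewrite -{2}[a]mulr1 -mulrBr na_absM (abs_unit1 p_prime k1 ha) mul1r.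
Qed.

Lemma near1V k a : (1 <= k)%N -> na_abs (a - 1) <= eps k -> na_abs (a^-1 - 1) <= eps k.
Proof.
move=> k1 ha; have a0 := unit1_neq0 k1 ha.
have -> : a^-1 - 1 = a^-1 * (1 - a) by rewrite mulrBr mulVf// mulr1.
by rewrite na_absM na_absV (abs_unit1 p_prime k1 ha) invr1 mul1r na_absBC.
Qed.

Lemma principal_subgroup k : (1 <= k)%N -> is_subgroup (principal k).
Proof.
move=> k1; split.
- by move=> _ [a [b [ha hb ->]]]; apply/upper_unit/unit1_neq0/ha.
- exists 1, 0; rewrite subrr !na_abs0 upper1; split=> //; by rewrite ltW// eps_gt0.
- move=> _ _ [a [b [ha hb ->]]] [a' [b' [ha' hb' ->]]].
  exists (a * a'), (a * b' + b / a'); rewrite upperM; split=> //; first exact: near1M.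
  apply: na_abs_le_max; first by rewrite na_absM (abs_unit1 p_prime k1 ha) mul1r.
  by rewrite na_absM na_absV (abs_unit1 p_prime k1 ha') invr1 mulr1.
- move=> _ [a [b [ha hb ->]]]; exists a^-1, (- b).
  rewrite upperV; last exact: unit1_neq0 ha.
  by rewrite na_absN; split=> //; exact: near1V.
Qed.

Lemma principal_borel k : (1 <= k)%N -> principal k `<=` borel Qp.
Proof.
by move=> k1 _ [a [b [ha _ ->]]]; exists a, b; split=> //; exact: unit1_neq0 ha.
Qed.

Lemma principal_le k l : (k <= l)%N -> principal l `<=` principal k.
Proof.
move=> kl _ [a [b [ha hb ->]]]; exists a, b; split=> //.
by rewrite (le_trans ha)// eps_le.
Qed.

Let th : Qp := padic_exp p%:R ^+ (p ^ j.-1)%N.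

Let abs_th : na_abs (th - 1) = eps j.
Proof.
have e1 := abs_exp_p_sub1 p_prime p_odd hQp.
rewrite (abs_pow_sub1 p_prime p_odd hQp) e1// natrX (abs_pX p_prime hQp) -epsD.
by rewrite addn1 prednK.
Qed.

Lemma h1XE : h1 Qp p ^+ (p ^ j.-1)%N = upper_mx th 0.
Proof. exact: upperX. Qed.

Local Notation ispow := (is_pow th).

Let th_abs1 : na_abs th = 1.
Proof. exact: abs_th1 p_prime _ _ j1 abs_th. Qed.

Let th0 n : th ^+ n != 0.
Proof.
apply/eqP => h; have := na_absX th n; rewrite h na_abs0 th_abs1 expr1n => /eqP.
by rewrite eq_sym oner_eq0.
Qed.

Let unit_abs x a : na_abs x <= 1 -> ispow x a -> na_abs a = 1.
Proof.
by move=> x1 /(is_pow_near1 p_prime p_odd hQp j1 abs_th x1)/(abs_unit1 p_prime j1).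
Qed.

Let powV n a : na_abs a = 1 -> na_abs ((th ^+ n)^-1 - a^-1) = na_abs (th ^+ n - a).
Proof.
move=> a1; have a0 : a != 0.
  by apply/eqP => h; move: a1; rewrite h na_abs0 => /eqP; rewrite eq_sym oner_eq0.
have -> : (th ^+ n)^-1 - a^-1 = (a - th ^+ n) / (th ^+ n * a).
  by rewrite mulrBl invfM mulrCA divff// mulr1 mulrA divff// mul1r.
by rewrite na_absM na_absV na_absM na_absX th_abs1 a1 expr1n mulr1 invr1 mulr1 na_absBC.
Qed.

Lemma padic_power_h1 x (k : 'M[Qp]_2) : na_abs x <= 1 ->
  mx_padic_power (h1 Qp p ^+ (p ^ j.-1)%N) x k <-> exists2 a, ispow x a & k = upper_mx a 0.
Proof.
rewrite h1XE => x1; split=> [h|[a xa ->] e e0]; last first.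
  exists e => // n nx i l; have a1 := unit_abs x1 xa.
  rewrite upperX; have {nx} : na_abs (th ^+ n - a) < e := le_lt_trans (xa n) nx.
  case: (ord2P i) => ->; case: (ord2P l) => ->; rewrite !upperE ?subrr ?na_abs0//.
  by rewrite powV.
have lim e : 0 < e -> exists n, na_abs (n%:R - x) < e /\
    forall i l, na_abs (upper_mx (th ^+ n) 0 i l - k i l) < e.
  move=> e0; have [d d0 hd] := h e e0.
  have [|m me] := @eps_small R p p_prime (Num.min d e); first by rewrite lt_min d0.
  have [|n _ nx] := @nat_dense _ _ _ p_prime hQp x m => //.
  have := le_lt_trans nx me; rewrite lt_min na_absBC => /andP[nd ne].
  by exists n; split=> // i l; rewrite -upperX hd.
have xk : ispow x (k 0 0).
  move=> n; rewrite leNgt; apply/negP => lt.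
  have [m [mx mk]] := lim _ (le_lt_trans (na_abs_ge0 _) lt).
  suff : na_abs (th ^+ n - k 0 0) < na_abs (th ^+ n - k 0 0) by rewrite ltxx.
  apply: (@na_abs_dist_lt _ _ (th ^+ m)); last by have := mk 0 0; rewrite upperE.
  rewrite (abs_pow_dist p_prime p_odd hQp j1 abs_th).
  apply: (le_lt_trans (ler_piMr (na_abs_ge0 _) (eps_le1 R p_prime j))).
  by apply: (@na_abs_dist_lt _ _ x) => //; rewrite na_absBC.
have k1 := unit_abs x1 xk.
exists (k 0 0) => //; apply: mx2P; rewrite !upperE//; apply/esym/subr0_eq/na_abs_eq0_small => e e0.
- by have [n [_ /(_ 0 1)]] := lim e e0; rewrite upperE.
- by have [n [_ /(_ 1 0)]] := lim e e0; rewrite upperE.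
- have [n [_ nk]] := lim e e0; apply: (@na_abs_dist_lt _ _ (th ^+ n)^-1).
    by rewrite na_absBC powV//; have := nk 0 0; rewrite upperE.
  by have := nk 1 1; rewrite upperE.
Qed.

Lemma padic_power_h2 y (k : 'M[Qp]_2) : na_abs y <= 1 ->
  mx_padic_power (h2 Qp p) y k <-> k = upper_mx 1 (p%:R * y).
Proof.
have le1 x : na_abs (p%:R * x) <= na_abs x.
  by rewrite na_absM ler_piMl ?na_abs_ge0 ?na_abs_nat_le1.
move=> y1; split=> [h|-> e e0]; last first.
  exists e => // n ny i l; rewrite upperXn.
  case: (ord2P i) => ->; case: (ord2P l) => ->; rewrite !upperE ?subrr ?na_abs0//.
  by rewrite -(mulr_natr p%:R n) -mulrBr (le_lt_trans (le1 _)).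
have lim e : 0 < e -> exists n, na_abs (n%:R - y) < e /\
    forall i l, na_abs (upper_mx 1 (p%:R *+ n) i l - k i l) < e.
  move=> e0; have [d d0 hd] := h e e0.
  have [|m me] := @eps_small R p p_prime (Num.min d e); first by rewrite lt_min d0.
  have [|n _ ny] := @nat_dense _ _ _ p_prime hQp y m => //.
  have := le_lt_trans ny me; rewrite lt_min na_absBC => /andP[nd ne].
  by exists n; split=> // i l; rewrite -upperXn hd.
apply: mx2P; rewrite !upperE ?invr1; apply/esym/subr0_eq/na_abs_eq0_small => e e0;
  have [n [ny nk]] := lim e e0.
- by have := nk 0 0; rewrite upperE.
- have := nk 0 1; rewrite upperE -(mulr_natr p%:R n); apply: na_abs_dist_lt.
  by rewrite -mulrBr (le_lt_trans (le1 _))// na_absBC.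
- by have := nk 1 0; rewrite upperE.
- by have := nk 1 1; rewrite upperE invr1.
Qed.

(** A closed subgroup containing the two generators contains their p-adic powers,
    and every element of the right-hand side is a product of two such powers, by
    the surjectivity of x |-> th^x onto 1 + p^j Z_p. *)
Lemma HsubE : Hsub p j = principal j.
Proof.
apply/seteqP; split=> [g|_ [a [b [ha hb ->]]] C sC CG [D cD CD] SC].
  move=> /(_ (principal j)); apply.
  - exact: principal_subgroup.
  - exact: principal_borel.
  - exists [set g | na_abs (g 0 0 - 1) <= eps j /\ na_abs (g 0 1) <= eps 1].
      move=> {}g ng; have [ga|ga] := leP (na_abs (g 0 0 - 1)) (eps j).
        exists (eps 1); first exact: eps_gt0.
        move=> h gh [_ hb]; apply: ng; split=> //.
        rewrite -[g 0 1]subr0; apply: (@na_abs_dist_le _ _ (h 0 1)); last by rewrite subr0.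
        by rewrite na_absBC ltW.
      exists (eps j); first exact: eps_gt0.
      move=> h gh [ha _]; move: ga; rewrite ltNge => /negP; apply.
      by apply: (@na_abs_dist_le _ _ (h 0 0)) => //; rewrite na_absBC ltW.
    apply/seteqP; split=> [_ [a [b [ha hb ->]]]|_ [[a [b [_ ->]]] [/=]]].
      by split; [apply: (principal_borel j1); exists a, b|rewrite /= !upperE].
    by rewrite !upperE => ha hb; exists a, b.
  - move=> _ [->|->].
      rewrite h1XE; exists th, 0; rewrite abs_th na_abs0; split=> //.
      by rewrite ltW// eps_gt0.
    exists 1, p%:R; rewrite subrr na_abs0 (abs_p p_prime hQp) expr1; split=> //.
    by rewrite ltW// eps_gt0.
have [_ C1 CM _] := sC.
have CX g n : C g -> C (g ^+ n).
  by move=> Cg; elim: n => [|n IH]; rewrite ?expr0// exprS; apply: CM.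
have a0 := unit1_neq0 j1 ha; have a1 := abs_unit1 p_prime j1 ha.
have limC k x h : na_abs x <= 1 -> borel Qp k -> C h -> mx_padic_power h x k -> C k.
  move=> x1 kG Ch hk; rewrite CD; split=> //; apply: (mx_closed_lim cD) => e e0.
  have [d d0 hd] := hk e e0; have [m me] := eps_small p_prime d0.
  have [n _ nx] := nat_dense p_prime hQp m x1.
  exists (h ^+ n); last by apply: hd; rewrite na_absBC (le_lt_trans nx).
  by have := CX h n Ch; rewrite CD => -[].
have -> : upper_mx a b = upper_mx a 0 * upper_mx 1 (b / a).
  by rewrite upperM mulr1 mul0r addr0 mulrC divfK.
apply: CM.
  have [x x1 xa] := is_pow_ex p_prime p_odd hQp j1 abs_th ha.
  apply: (limC _ x (h1 Qp p ^+ (p ^ j.-1)%N)) => //.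
  - by exists a, 0.
  - by apply: SC; left.
  - by apply/padic_power_h1 => //; exists a.
have p0 : p%:R != 0 :> Qp by rewrite (natQp_neq0 p_prime hQp) ?prime_gt0.
have y1 : na_abs (b / a / p%:R) <= 1.
  rewrite !na_absM !na_absV a1 invr1 mulr1 (abs_p p_prime hQp) invrK.
  by rewrite -ler_pdivlMr ?ltr0n ?prime_gt0// div1r; move: hb; rewrite expr1.
apply: (limC _ (b / a / p%:R) (h2 Qp p)) => //.
- by exists 1, (b / a); rewrite oner_neq0.
- by apply: SC; right.
- by apply/padic_power_h2 => //; rewrite [p%:R * _]mulrC divfK.
Qed.

Local Notation W := (W_scalar p j chi sigma).

(** Both exponents are determined by the matrix, so that the description of the
    scalar leaves no choice. *)
Lemma W_scalarE x a b : na_abs x <= 1 -> ispow x a -> na_abs b <= eps 1 ->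
  W (upper_mx a b) = chi x * sigma (b / a).
Proof.
move=> x1 xa hb; have a1 := unit_abs x1 xa.
have a0 : a != 0.
  by apply/eqP => h; move: a1; rewrite h na_abs0 => /eqP; rewrite eq_sym oner_eq0.
have p0 : p%:R != 0 :> Qp by rewrite (natQp_neq0 p_prime hQp) ?prime_gt0.
rewrite /W_scalar; set P := [set c | _].
suff -> : P = [set chi x * sigma (b / a)] by apply: xget_subset1 => // ? ? -> ->.
apply/seteqP; split=> [c|_ ->].
  move=> [x' [y [k1 [k2 [[x1' y1] hk1 hk2 h ->]]]]].
  move/(padic_power_h1 _ x1') : hk1 => [a' xa' k1E].
  move/(padic_power_h2 _ y1) : hk2 => k2E.
  move: h; rewrite k1E k2E upperM mulr1 mul0r addr0 => /upper_inj[aE bE].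
  rewrite -aE in xa'.
  by rewrite (is_pow_uniq p_prime p_odd hQp j1 abs_th x1' x1 xa' xa) bE -aE mulrAC divff ?mul1r.
exists x, (b / a / p%:R), (upper_mx a 0), (upper_mx 1 (b / a)).
have y1 : na_abs (b / a / p%:R) <= 1.
  rewrite !na_absM !na_absV a1 invr1 mulr1 (abs_p p_prime hQp) invrK.
  by rewrite -ler_pdivlMr ?ltr0n ?prime_gt0// div1r; move: hb; rewrite expr1.
split=> //.
- by apply/padic_power_h1 => //; exists a.
- by apply/padic_power_h2 => //; rewrite [p%:R * _]mulrC divfK.
- by rewrite upperM mulr1 mul0r addr0 mulrC divfK.
- by rewrite [p%:R * _]mulrC divfK.
Qed.

Lemma W_scalar_neq0 g : principal j g -> W g != 0.
Proof.
move=> [a [b [ha hb ->]]]; have [x x1 xa] := is_pow_ex p_prime p_odd hQp j1 abs_th ha.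
rewrite (W_scalarE x1 xa hb) mulf_neq0//; first exact: (proj1 chi_char).
apply: (proj1 sigma_char); apply/padE.
by rewrite na_absM na_absV (unit_abs x1 xa) invr1 mulr1.
Qed.

(** Conjugating the unipotent part by a in 1 + p^j Z_p changes the argument of
    sigma by an element of p^(j+1) Z_p, the kernel of sigma. *)
Lemma W_scalarM g h : principal j g -> principal j h -> W (g * h) = W g * W h.
Proof.
move=> [a [b [ha hb ->]]] [a' [b' [ha' hb' ->]]].
have [x x1 xa] := is_pow_ex p_prime p_odd hQp j1 abs_th ha.
have [x' x1' xa'] := is_pow_ex p_prime p_odd hQp j1 abs_th ha'.
have a1 := unit_abs x1 xa; have a1' := unit_abs x1' xa'.
have a0 := unit1_neq0 j1 ha; have a0' := unit1_neq0 j1 ha'.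
rewrite upperM (W_scalarE x1 xa hb) (W_scalarE x1' xa' hb').
have hxx : na_abs (x + x') <= 1 by exact: na_abs_le_max.
rewrite (W_scalarE hxx).
- rewrite (proj2 chi_char)// -!mulrA; congr (_ * _); rewrite mulrCA; congr (_ * _).
  pose c := b / a * (a'^-1 ^+ 2 - 1).
  have -> : (a * b' + b / a') / (a * a') = c + b / a + b' / a'.
    rewrite /c mulrBr mulr1 subrK mulrDl addrC; congr (_ + _).
      by rewrite expr2 invfM -!mulrA; congr (_ * _); rewrite mulrCA.
    by rewrite invfM mulrACA divff// mul1r.
  have hc : na_abs c <= eps j.+1.
    rewrite /c !na_absM na_absV a1 invr1 mulr1 -[j.+1]add1n epsD.
    apply: ler_pM; rewrite ?na_abs_ge0//.
    by rewrite expr2; apply: near1M => //; exact: near1V.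
  have hab : na_abs (b / a) <= eps 1 by rewrite na_absM na_absV a1 invr1 mulr1.
  have hab' : na_abs (b' / a') <= eps 1 by rewrite na_absM na_absV a1' invr1 mulr1.
  have hc1 : na_abs c <= eps 1 by rewrite (le_trans hc)// eps_le.
  rewrite (proj2 sigma_char); [|by apply/padE; exact: na_abs_le_max|exact/padE].
  congr (_ * _); rewrite (proj2 sigma_char); [|exact/padE|exact/padE].
  have : padicpZ Qp p j.+1 c by exact/padE.
  by rewrite -sigma_ker => -[_ ->]; rewrite mul1r.
- exact: (is_powM p_prime p_odd hQp j1 abs_th).
- apply: na_abs_le_max; first by rewrite na_absM a1 mul1r.
  by rewrite na_absM na_absV a1' invr1 mulr1.
Qed.

Lemma W_scalar1 : W 1 = 1.
Proof.
have p1 : principal j 1 by case: (principal_subgroup j1).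
apply: (mulfI (W_scalar_neq0 p1)); by rewrite -W_scalarM// !mulr1.
Qed.

Lemma W_scalar_unip a b : na_abs (a - 1) <= eps j -> na_abs b <= eps j.+1 ->
  W (upper_mx a b) = W (upper_mx a 0).
Proof.
move=> ha hb; have [x x1 xa] := is_pow_ex p_prime p_odd hQp j1 abs_th ha.
have hb1 : na_abs b <= eps 1 by rewrite (le_trans hb)// eps_le.
rewrite (W_scalarE x1 xa hb1) (W_scalarE x1 xa) ?na_abs0 ?ltW ?eps_gt0//.
congr (_ * _); transitivity (1 : K).
  have : padicpZ Qp p j.+1 (b / a).
    by apply/padE; rewrite na_absM na_absV (unit_abs x1 xa) invr1 mulr1.
  by rewrite -sigma_ker => -[].
have : padicpZ Qp p j.+1 (0 / a).
  by apply/padE; rewrite mul0r na_abs0 ltW// eps_gt0.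
by rewrite -sigma_ker => -[].
Qed.

End InducingCharacter.

(** * Induction and the finest locally convex topology *)

Section Representations.
Variables (R : realType) (Qp K : naField R).
Local Notation Gam := 'M[Qp]_2.

Record is_rep (E : lmodType K) (H : set Gam) (V : rep Qp E) : Prop := IsRep {
  rep0 : lcs_carrier V 0;
  rep_comb : forall (c : K) v w, lcs_carrier V v -> lcs_carrier V w ->
    lcs_carrier V (c *: v + w);
  rep_stable : forall h v, H h -> lcs_carrier V v -> lcs_carrier V (rep_act V h v);
  rep_lin : forall h (c : K) v w, H h ->
    rep_act V h (c *: v + w) = c *: rep_act V h v + rep_act V h w;
  rep_mul : forall h h' v, H h -> H h' -> lcs_carrier V v ->
    rep_act V (h * h') v = rep_act V h (rep_act V h' v);
  rep_one : forall v, lcs_carrier V v -> rep_act V 1 v = v }.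

Lemma is_rep_act0 (E : lmodType K) (H : set Gam) (V : rep Qp E) h :
  is_rep H V -> H h -> rep_act V h 0 = 0.
Proof.
move=> rV Hh; have := rep_lin rV (-1) 0 0 Hh.
by rewrite scaler0 addr0 scaleN1r addNr.
Qed.

(** On such a space every linear functional is continuous, so that the continuity
    conditions in the dual of X disappear (dual_finest). *)
Definition finest_topology (E : lmodType K) (V : lcs E) : Prop :=
  forall s, is_seminorm V s -> lcs_csn V s.

Lemma line_finest : finest_topology (lcs_line K).
Proof.
move=> s sn; split=> //; exists (s 1) => c; have [_ sZ _] := sn.
by rewrite -[c in s c]mulr1 -[c * 1]/(c *: (1 : K^o)) sZ// mulrC.
Qed.

Section Induced.
Variables (E : lmodType K) (G H : set Gam) (V : rep Qp E).
Hypothesis sG : is_subgroup G.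
Hypothesis sH : is_subgroup H.
Hypothesis HG : H `<=` G.
Hypothesis rV : is_rep H V.

Let uG g : G g -> g \is a GRing.unit. Proof. by case: sG => h _ _ _; exact: h. Qed.

Let uH h : H h -> h \is a GRing.unit. Proof. by move=> /HG; exact: uG. Qed.

Lemma cInd_rep : is_rep G (cInd G H V).
Proof.
have [_ G1 GM GV] := sG; have [_ H1 HM HV] := sH.
split=> /=.
- split=> //; first by move=> g _; exact: rep0 rV.
    by move=> g h _ Hh; rewrite (is_rep_act0 rV)//; exact: HV.
  by exists [::] => g; rewrite eqxx.
- move=> c f f' [f0 fV fH [s fs]] [f0' fV' fH' [s' fs']]; split.
  + by move=> g ng; rewrite -[LHS]/(c *: f g + f' g) f0// f0'// scaler0 addr0.
  + by move=> g Gg; apply: (rep_comb rV); [exact: fV|exact: fV'].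
  + by move=> g h Gg Hh; rewrite -[LHS]/(c *: f (g * h) + f' (g * h)) fH// fH'// -(rep_lin rV)//; exact: HV.
  + exists (s ++ s') => g; have [f00|/fs[x [h [xs Hh gE]] _]] := eqVneq (f g) 0; last first.
      by exists x, h; rewrite mem_cat xs.
    rewrite -[(_ + f') g]/(c *: f g + f' g) f00 scaler0 add0r => /fs'[x [h [xs Hh gE]]].
    by exists x, h; rewrite mem_cat xs orbT.
- move=> g f Gg [f0 fV fH [s fs]]; have ug := uG Gg; split.
  + move=> x nx; apply: f0 => gx; apply: nx.
    by rewrite -[x](mulVKr ug); exact: GM.
  + by move=> x Gx; apply/fV/GM => //; exact: GV.
  + by move=> x h Gx Hh; rewrite mulrA fH//; apply: GM => //; exact: GV.
  + exists [seq g * x | x <- s] => x /fs[y [h [ys Hh gE]]].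
    exists (g * y), h; split=> //; first exact: map_f.
    by rewrite -mulrA -gE mulVKr.
- by [].
- move=> h h' f Gh Gh' _; apply/funext => x.
  by rewrite invrM ?mulrA//; exact: uG.
- by move=> f _; apply/funext => x; rewrite invr1 mul1r.
Qed.

Lemma cInd_bump_in g v : G g -> lcs_carrier V v -> cInd_set G H V (cInd_bump H V g v).
Proof.
have [_ G1 GM GV] := sG; have [_ H1 HM HV] := sH.
move=> Gg Vv; have ug := uG Gg.
have bE x : H (g^-1 * x) -> cInd_bump H V g v x = rep_act V (x^-1 * g) v.
  by move=> Hx; rewrite /cInd_bump patchT// inE.
have b0 x : ~ H (g^-1 * x) -> cInd_bump H V g v x = 0.
  by move=> Hx; rewrite /cInd_bump patchN// notin_setE.
have inv x : H (g^-1 * x) -> H (x^-1 * g).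
  move=> Hx; have ux : x \is a GRing.unit by rewrite -[x](mulVKr ug) unitrMl// uH.
  by have := HV _ Hx; rewrite invrM ?unitrV// invrK.
split.
- move=> x nx; apply: b0 => Hx; apply: nx.
  by rewrite -[x](mulVKr ug); apply: GM => //; exact: HG.
- move=> x Gx; have [Hx|Hx] := pselect (H (g^-1 * x)).
    by rewrite bE//; apply: (rep_stable rV) => //; exact: inv.
  by rewrite b0//; exact: rep0 rV.
- move=> x h Gx Hh; have uh := uH Hh.
  have [Hx|Hx] := pselect (H (g^-1 * x)).
    rewrite !bE//; last by rewrite mulrA; exact: HM.
    rewrite invrM ?(uG Gx)// -mulrA (rep_mul rV)//; [exact: HV|exact: inv].
  rewrite !b0//; first by rewrite (is_rep_act0 rV)//; exact: HV.
  rewrite mulrA => /HM/(_ (HV _ Hh)); rewrite mulrK//.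
- exists [:: g] => x; have [Hx _|Hx] := pselect (H (g^-1 * x)); last by rewrite b0// eqxx.
  by exists g, (g^-1 * x); rewrite inE eqxx mulVKr.
Qed.

Lemma cInd_bump_lin g (c : K) v w : G g ->
  cInd_bump H V g (c *: v + w) = c *: cInd_bump H V g v + cInd_bump H V g w.
Proof.
have [_ _ _ HV] := sH.
move=> Gg; have ug := uG Gg; apply/funext => x.
rewrite -[RHS]/(c *: cInd_bump H V g v x + cInd_bump H V g w x) /cInd_bump.
have [Hx|Hx] := pselect (H (g^-1 * x)); last by rewrite !patchN ?notin_setE// scaler0 addr0.
rewrite !patchT ?inE//; apply: (rep_lin rV).
have ux : x \is a GRing.unit by rewrite -[x](mulVKr ug) unitrMl// uH.
by have := HV _ Hx; rewrite invrM ?unitrV// invrK.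
Qed.

(** The topology is that of a direct sum of copies of V, embedded by linear maps:
    a seminorm restricts to a seminorm of each summand. *)
Lemma cInd_finest : finest_topology V -> finest_topology (cInd G H V).
Proof.
move=> fV s sn; split=> // g Gg; apply: fV; have [s0 sZ sD] := sn.
have bump0 : cInd_bump H V g 0 = 0.
  by have := cInd_bump_lin (-1) 0 0 Gg; rewrite scaler0 addr0 scaleN1r addNr.
split=> [v Vv|c v Vv|v w Vv Vw]; first exact/s0/cInd_bump_in.
- have := cInd_bump_lin c v 0 Gg; rewrite addr0 bump0 addr0 => ->.
  by rewrite sZ//; exact: cInd_bump_in.
- have := cInd_bump_lin 1 v w Gg; rewrite !scale1r => ->.
  by apply: sD; exact: cInd_bump_in.
Qed.

End Induced.

Lemma dual_finest (E : lmodType K) (V : lcs E) (l : E -> K^o) :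
  finest_topology V -> V 0 ->
  (forall (c : K) v w, V v -> V w -> l (c *: v + w) = c *: l v + l w) ->
  (forall v, ~ V v -> l v = 0) -> dual_set V l.
Proof.
move=> fV V0 lin l0; split=> //; apply: fV.
have l00 : l 0 = 0.
  by have := lin (-1) 0 0 V0 V0; rewrite scaler0 addr0 scaleN1r addNr.
split=> [v _|c v Vv|v w Vv Vw]; first exact: na_abs_ge0.
- by have := lin c v 0 Vv V0; rewrite addr0 l00 addr0 => ->; rewrite -na_absM.
- by have := lin 1 v w Vv Vw; rewrite !scale1r => ->; exact: na_abs_ultra.
Qed.

End Representations.

(** * The representation X on the diagonal torus *)

Section ExtendCenter.
Variables (R : realType) (p : nat) (Qp K : naField R).
Hypothesis p_prime : prime p.
Hypothesis p_odd : (2 < p)%N.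
Hypothesis hQp : is_Qp p Qp.
Local Notation eps k := ((p%:R : R) ^- k).
Local Notation Gam := 'M[Qp]_2.
Implicit Types (g h : Gam).

Lemma not_pm1 k (a : Qp) : (1 <= k)%N -> na_abs (a - 1) <= eps k -> na_abs (- a - 1) <= eps k ->
  False.
Proof.
move=> k1 h h'; have : na_abs (2%:R : Qp) <= eps 1.
  rewrite -na_absN (_ : - 2%:R = (a - 1) + (- a - 1)); last by ring.
  by apply: (le_trans (na_abs_le_max h h')); exact: eps_le.
by rewrite (abs_nat_dvd p_prime hQp) expn1 => /(@dvdn_leq p 2 isT); rewrite leqNgt p_odd.
Qed.

Lemma principalN k g : (1 <= k)%N -> principal p k g -> ~ principal p k (- g).
Proof.
move=> k1 [a [b [ha hb ->]]]; rewrite upperN => -[a' [b' [ha' hb' /upper_inj[aE _]]]].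
by apply: not_pm1 k1 ha _; rewrite aE.
Qed.

Lemma H0ZE g : H0Z p g <-> principal p 1 g \/ principal p 1 (- g).
Proof.
rewrite -(H0E p_prime hQp); split.
- move=> [h [z [Hh [->|->] ->]]]; first by left; rewrite mulr1.
  by right; rewrite mulrN1 opprK.
- case=> Hg; first by exists g, 1; split=> //; [left|rewrite mulr1].
  by exists (- g), (- 1); split=> //; [right|rewrite mulrN1 opprK].
Qed.

Lemma H0Z_subgroup : is_subgroup (H0Z (Qp := Qp) p).
Proof.
have [u P1 PM PV] := principal_subgroup Qp p_prime (leqnn 1).
split.
- by move=> g /H0ZE[/u//|/u]; rewrite /= unitrN.
- by apply/H0ZE; left.
- move=> g h /H0ZE hg /H0ZE hh; apply/H0ZE.
  case: hg hh => hg [hh|hh].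
  + by left; exact: PM.
  + by right; rewrite -mulrN; exact: PM.
  + by right; rewrite -mulNr; exact: PM.
  + by left; rewrite -mulrNN; exact: PM.
- move=> g /H0ZE[hg|hg]; apply/H0ZE; [left|right]; first exact: PV.
  by rewrite -invrN; exact: PV.
Qed.

Lemma H0Z_borel : H0Z p `<=` borel Qp.
Proof.
have PB := principal_borel p_prime (leqnn 1).
move=> g /H0ZE[/PB//|/PB[a [b [a0 gE]]]].
by exists (- a), (- b); rewrite oppr_eq0 a0 -upperN -gE opprK.
Qed.

Variables (E : lmodType K) (V : rep Qp E).

Lemma extend_actE g v : principal p 1 g -> rep_act (extend_center p V) g v = rep_act V g v.
Proof. by rewrite -(H0E p_prime hQp) /= => Hg; rewrite mem_set. Qed.

Lemma extend_actN g v : principal p 1 g ->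
  rep_act (extend_center p V) (- g) v = rep_act V g v.
Proof.
move=> Hg; rewrite /= memNset ?opprK// (H0E p_prime hQp).
exact: principalN.
Qed.

Lemma extend_rep : is_rep (H0 p) V -> is_rep (H0Z p) (extend_center p V).
Proof.
rewrite (H0E p_prime hQp) => rV.
have [_ P1 PM PV] := principal_subgroup Qp p_prime (leqnn 1).
have sgn g : H0Z p g -> exists2 h, principal p 1 h & g = h \/ g = - h.
  move=> /H0ZE[?|?]; [by exists g => //; left|].
  by exists (- g) => //; right; rewrite opprK.
split; [exact: rep0 rV|exact: rep_comb rV| | | |].
- move=> g v /sgn[h Ph [->|->]] Vv; rewrite ?extend_actN ?extend_actE//;
  exact: (rep_stable rV).
- move=> g c v w /sgn[h Ph [->|->]]; rewrite ?extend_actN ?extend_actE//;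
  exact: (rep_lin rV).
- move=> g g' v /sgn[h Ph hE] /sgn[h' Ph' hE'] Vv; have PP := PM _ _ Ph Ph'.
  case: hE => ->; case: hE' => ->; rewrite ?mulrNN ?mulNr ?mulrN ?extend_actN ?extend_actE//;
  exact: (rep_mul rV).
- by move=> v Vv; rewrite extend_actE//; exact: (rep_one rV).
Qed.

End ExtendCenter.

Section InducedCharacter.
Variables (R : realType) (p : nat) (Qp K : naField R) (j : nat) (chi sigma : Qp -> K).
Hypothesis p_prime : prime p.
Hypothesis p_odd : (2 < p)%N.
Hypothesis hQp : is_Qp p Qp.
Hypothesis j1 : (1 <= j)%N.
Hypothesis sigma_char : character (padicpZ Qp p 1) sigma.
Hypothesis sigma_ker : [set x | padicpZ Qp p 1 x /\ sigma x = 1] = padicpZ Qp p j.+1.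
Hypothesis chi_char : character (padicZ Qp) chi.
Local Notation eps k := ((p%:R : R) ^- k).
Local Notation Gam := 'M[Qp]_2.
Local Notation W := (W_scalar p j chi sigma).
Local Notation Pj := (principal (Qp := Qp) p j).
Local Notation X := (X_rep p j chi sigma).
Local Notation G := (borel Qp).
Implicit Types (a b : Qp) (g h : Gam).

Let WM := W_scalarM p_prime p_odd hQp j1 sigma_char sigma_ker chi_char.
Let W1 := W_scalar1 p_prime p_odd hQp j1 sigma_char sigma_ker chi_char.
Let W_neq0 := W_scalar_neq0 p_prime p_odd hQp j1 sigma_char chi_char.
Let W_unip := W_scalar_unip chi p_prime p_odd hQp j1 sigma_ker.
Let HsE := HsubE p_prime p_odd hQp j1.
Let sPj := principal_subgroup Qp p_prime j1.
Let sP1 := principal_subgroup Qp p_prime (leqnn 1).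

Lemma W_rep_rep : is_rep (Hsub p j) (W_rep p j chi sigma).
Proof.
rewrite HsE; split=> //.
- by move=> h c v w _ /=; rewrite scalerDr !scalerA mulrC.
- by move=> h h' v Hh Hh' _ /=; rewrite WM// scalerA.
- by move=> v _ /=; rewrite W1 scale1r.
Qed.

Lemma V_rep_rep : is_rep (H0Z p) (V_rep p j chi sigma).
Proof.
apply: extend_rep => //; apply: cInd_rep.
- by rewrite (H0E p_prime hQp).
- by rewrite HsE.
- exact: W_rep_rep.
Qed.

Lemma V_rep_finest : finest_topology (V_rep p j chi sigma).
Proof.
apply: (@cInd_finest _ _ _ _ (H0 p) (Hsub p j) (W_rep p j chi sigma)).
- by rewrite (H0E p_prime hQp).
- by rewrite HsE.
- by rewrite (H0E p_prime hQp) HsE; exact: principal_le.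
- exact: W_rep_rep.
- exact: line_finest.
Qed.

Lemma X_rep_rep : is_rep G X.
Proof.
apply: cInd_rep; [exact: borel_subgroup|exact: H0Z_subgroup|exact: V_rep_rep].
Qed.

Lemma X_rep_finest : finest_topology X.
Proof.
apply: cInd_finest; [exact: borel_subgroup|exact: H0Z_subgroup|exact: H0Z_borel| |].
- exact: V_rep_rep.
- exact: V_rep_finest.
Qed.

Lemma X_rep_equivariant f g h : lcs_carrier X f -> G g -> Pj h ->
  f (g * h) 1 = W h^-1 * f g 1 /\ f (g * - h) 1 = W h^-1 * f g 1.
Proof.
move=> [_ fV fH _] Gg Ph; have [_ _ _ PV] := sPj; have [uP P1 _ P1V] := sP1.
have Ph1 : principal p 1 h by exact: (principal_le p_prime j1 Ph).
have uh : h \is a GRing.unit := uP _ Ph1.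
have [_ _ fgV _] := fV g Gg.
have fg1 : f g h = W h^-1 * f g 1.
  rewrite -{1}[h]mul1r fgV ?(H0E p_prime hQp) ?HsE//.
split; (rewrite fH//; last by apply/(H0ZE p_prime hQp); rewrite ?opprK; auto).
- by rewrite extend_actE//=; [rewrite invrK mulr1|exact: P1V].
- by rewrite invrN extend_actN//=; [rewrite invrK mulr1|exact: P1V].
Qed.

(** The function on G underlying the generator of X: the inverse of the inducing
    character on H_(j-1), extended evenly to -H_(j-1) and by zero. *)
Definition gen_fun h : K :=
  if `[< Pj h >] then W h^-1 else if `[< Pj (- h) >] then W (- h)^-1 else 0.

Lemma gen_funN h : gen_fun (- h) = gen_fun h.
Proof.
rewrite /gen_fun opprK; case: asboolP => [Ph|//].
case: asboolP => // Ph'; exact: False_ind (principalN p_prime p_odd hQp j1 Ph' Ph).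
Qed.

Lemma gen_funM g h : Pj h -> gen_fun (g * h) = W h^-1 * gen_fun g.
Proof.
move=> Ph; have [uP _ PM PV] := sPj; have uh : h \is a GRing.unit := uP _ Ph.
have PMr x : Pj (x * h) <-> Pj x.
  split=> [Px|Px]; last exact: PM.
  by rewrite -(mulrK uh x); apply: PM => //; exact: PV.
have inv x : Pj x -> W (x * h)^-1 = W h^-1 * W x^-1.
  by move=> Px; rewrite invrM//; [rewrite WM//; exact: PV|exact: uP].
rewrite /gen_fun -mulNr (asbool_equiv_eq (PMr g)) (asbool_equiv_eq (PMr (- g))).
case: asboolP => [/inv//|_]; case: asboolP => [/inv//|_].
by rewrite mulr0.
Qed.

Lemma gen_fun_neq0 h : gen_fun h != 0 -> Pj h \/ Pj (- h).
Proof.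
rewrite /gen_fun; case: asboolP => [|_]; first by left.
by case: asboolP => [|_]; [right|rewrite eqxx].
Qed.

(** An element f of X is the same as the function g |-> f g 1 on G, as f g x is
    f (g x) 1 for x in H_0; gen_vec g0 corresponds to the left translate by g0 of
    gen_fun. *)
Definition gen_vec g0 : Gam -> Gam -> K^o := fun g x =>
  if `[< G g >] && `[< H0 p x >] then gen_fun (g0^-1 * g * x) else 0.

Lemma gen_vecE g0 g : G g -> gen_vec g0 g 1 = gen_fun (g0^-1 * g).
Proof.
move=> Gg; rewrite /gen_vec asboolT// asboolT ?mulr1//.
by rewrite (H0E p_prime hQp); case: sP1.
Qed.

Lemma gen_vec_in g0 : G g0 -> lcs_carrier X (gen_vec g0).
Proof.
move=> Gg0; have [_ G1 GM GV] := borel_subgroup Qp.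
have [uP P1 P1M P1V] := sP1; have [_ _ PM PV] := sPj.
have ug0 := borel_unit Gg0; have H0P := H0E p_prime hQp.
have sub : Pj `<=` principal p 1 by exact: principal_le.
split.
- move=> g ng; apply/funext => x; rewrite /gen_vec asboolF//.
- move=> g Gg; have ug := borel_unit Gg; split.
  + move=> x nx; rewrite /gen_vec [X in _ && X]asboolF ?andbF//.
  + by [].
  + move=> x h; rewrite H0P HsE => Hx Ph; have Ph1 := sub _ Ph.
    rewrite /gen_vec !asboolT ?H0P//; last exact: P1M.
    by rewrite mulrA gen_funM.
  + exists [:: g^-1 * g0; - (g^-1 * g0)] => x.
    rewrite /gen_vec; case: ifP => [_|]; last by rewrite eqxx.
    have xE : x = g^-1 * g0 * (g0^-1 * g * x).
      by rewrite -!mulrA mulVKr// mulKr.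
    case/gen_fun_neq0 => Px.
      by exists (g^-1 * g0), (g0^-1 * g * x); rewrite inE eqxx HsE.
    exists (- (g^-1 * g0)), (- (g0^-1 * g * x)); rewrite !inE eqxx orbT HsE.
    by rewrite mulrNN.
- move=> g h Gg /(H0ZE p_prime hQp) Hh; apply/funext => x.
  have Gh : G h by apply: (H0Z_borel p_prime hQp); exact/(H0ZE p_prime hQp).
  have uh := borel_unit Gh.
  rewrite {1}/gen_vec (asboolT (GM _ _ Gg Gh)).
  have mem y : principal p 1 y -> principal p 1 (y * x) <-> principal p 1 x.
    move=> Py; have uy : y \is a GRing.unit := uP _ Py.
    split=> [Px|]; last exact: P1M.
    by rewrite -(mulKr uy x); apply: P1M => //; exact: P1V.
  case: Hh => Ph.
    rewrite extend_actE//=; last exact: P1V.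
    rewrite invrK /gen_vec (asboolT Gg) H0P (asbool_equiv_eq (mem _ Ph)) !mulrA//.
  have -> : h^-1 = - (- h)^-1 by rewrite invrN opprK.
  rewrite extend_actN//=; last exact: P1V.
  rewrite invrK /gen_vec (asboolT Gg) H0P (asbool_equiv_eq (mem _ Ph)).
  by rewrite mulNr mulrN gen_funN !mulrA.
- exists [:: g0] => g gv; exists g0, (g0^-1 * g); split.
  + by rewrite inE eqxx.
  + have [x] : exists x, gen_vec g0 g x != 0.
      apply: contrapT => nx; move: gv => /negP; apply; apply/eqP/funext => x.
      by apply/eqP; apply: contrapT => /negP h; apply: nx; exists x.
    rewrite /gen_vec; case: ifP => [/andP[_ /asboolP]|]; last by rewrite eqxx.
    rewrite H0P => Px /gen_fun_neq0 h; apply/(H0ZE p_prime hQp).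
    have ux : x \is a GRing.unit := uP _ Px.
    rewrite -(mulrK ux (g0^-1 * g)) -mulNr.
    by case: h => /sub h; [left|right]; apply: P1M (P1V _ Px) => //; rewrite mulNr.
  + by rewrite mulVKr.
Qed.

Definition pm1 a : Prop := na_abs (a - 1) <= eps j \/ na_abs (- a - 1) <= eps j.

(** The character by which right translation by the diagonal matrices with entry in
    +-(1 + p^j Z_p) acts on the functions g |-> f g 1 with f in X, extended by 0;
    unipotents close to 1 do not contribute (gen_fun_psi). *)
Definition psi a : K := gen_fun (upper_mx a 0).

Lemma pm1_abs a : pm1 a -> na_abs a = 1.
Proof.
by case=> /(abs_unit1 p_prime j1)//; rewrite na_absN.
Qed.

Lemma pm1_neq0 a : pm1 a -> a != 0.
Proof.
move=> /pm1_abs h; apply/eqP => a0; move: h; rewrite a0 na_abs0 => /eqP.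
by rewrite eq_sym oner_eq0.
Qed.

Lemma gen_fun_psi a b : na_abs b <= eps j.+1 -> gen_fun (upper_mx a b) = psi a.
Proof.
move=> hb; have hb1 : na_abs b <= eps 1 by rewrite (le_trans hb)// eps_le.
have e0 k : 0 <= eps k by rewrite ltW// eps_gt0.
have mem a' b' : na_abs b' <= eps 1 -> Pj (upper_mx a' b') <-> na_abs (a' - 1) <= eps j.
  move=> hb'; split=> [[c [d [hc hd /upper_inj[-> _]]]]//|ha'].
  by exists a', b'.
rewrite /psi /gen_fun !upperN oppr0.
rewrite (asbool_equiv_eq (mem a b hb1)) (asbool_equiv_eq (mem a 0 _)) ?na_abs0//.
rewrite (asbool_equiv_eq (mem (- a) (- b) _)) ?na_absN//.
rewrite (asbool_equiv_eq (mem (- a) 0 _)) ?na_abs0//.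
have inv c d : na_abs (c - 1) <= eps j -> na_abs d <= eps j.+1 ->
    W (upper_mx c d)^-1 = W (upper_mx c 0)^-1.
  move=> hc hd; rewrite !upperV; [|exact: unit1_neq0 hc..].
  by rewrite oppr0 W_unip// ?na_absN//; exact: near1V.
case: asboolP => [/inv -> //|_].
by case: asboolP => [/inv -> //|//]; rewrite na_absN.
Qed.

Lemma psi_neq0 a : pm1 a -> psi a != 0.
Proof.
have e0 k : 0 <= eps k by rewrite ltW// eps_gt0.
have [_ _ _ PV] := sPj.
move=> ha; rewrite /psi /gen_fun upperN oppr0.
case: asboolP => [/PV/W_neq0//|n1]; case: asboolP => [/PV/W_neq0//|n2].
by case: ha => ha; [case: n1; exists a, 0|case: n2; exists (- a), 0]; rewrite na_abs0.
Qed.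

Lemma psi_eq0 a : ~ pm1 a -> psi a = 0.
Proof.
move=> na; apply/eqP; apply: contrapT => /negP/gen_fun_neq0 h; apply: na.
by case: h => -[c [d [hc hd]]]; rewrite ?upperN => /upper_inj[aE _]; [left|right]; rewrite aE.
Qed.

Lemma X_rep_psi f g a b : lcs_carrier X f -> G g -> pm1 a -> na_abs b <= eps j.+1 ->
  f (g * upper_mx a b) 1 = psi a * f g 1.
Proof.
move=> Xf Gg ha hb; have hb1 : na_abs b <= eps 1 by rewrite (le_trans hb)// eps_le.
rewrite -(gen_fun_psi a hb).
have Pj1 : Pj 1 by case: sPj.
have gen1 h : Pj h -> gen_fun h = W h^-1 by move=> Ph; rewrite /gen_fun asboolT.
case: ha => ha.
  have Ph : Pj (upper_mx a b) by exists a, b.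
  by rewrite gen1//; case: (X_rep_equivariant Xf Gg Ph).
have Ph : Pj (- upper_mx a b) by rewrite upperN; exists (- a), (- b); rewrite na_absN.
rewrite -gen_funN gen1//.
by have [_ <-] := X_rep_equivariant Xf Gg Ph; rewrite opprK.
Qed.

Lemma pm1M a a' : pm1 a -> pm1 a' -> pm1 (a * a').
Proof.
case=> ha [] ha'; [left|right|right|left].
- exact: near1M.
- by rewrite -mulrN; exact: near1M.
- by rewrite -mulNr; exact: near1M.
- by rewrite -mulrNN; exact: near1M.
Qed.

Lemma pm1V a : pm1 a -> pm1 a^-1.
Proof.
by case=> ha; [left|right; rewrite -invrN]; exact: near1V.
Qed.

Lemma pm1_1 : pm1 1.
Proof. by left; rewrite subrr na_abs0 ltW// eps_gt0. Qed.

Lemma psiM a a' : pm1 a -> pm1 a' -> psi (a * a') = psi a * psi a'.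
Proof.
move=> ha ha'; have a0 := pm1_neq0 ha.
have G1 : G 1 by case: (borel_subgroup Qp).
have Gu : G (upper_mx a 0) by exists a, 0.
have := @X_rep_psi _ (upper_mx a 0) a' 0 (gen_vec_in G1) Gu ha'.
rewrite na_abs0 ltW ?eps_gt0// => /(_ isT).
rewrite upperM mulr0 mul0r addr0 !gen_vecE//.
  by rewrite invr1 !mul1r => h; rewrite [RHS]mulrC; exact: h.
by exists (a * a'), 0; rewrite mulf_neq0// pm1_neq0.
Qed.

Lemma psi1 : psi 1 = 1.
Proof.
by apply: (mulfI (psi_neq0 pm1_1)); rewrite -psiM ?mulr1//; exact: pm1_1.
Qed.

End InducedCharacter.

(** * Locally analytic functions and distributions *)

Section AnalyticFunctions.
Variables (R : realType) (p : nat) (Qp K : naField R) (iota : {rmorphism Qp -> K}).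
Hypothesis p_prime : prime p.
Variables (T : Type) (d : nat) (phi : T -> 'rV[Qp]_d) (C : set T).
Local Notation eps k := ((p%:R : R) ^- k).
Local Notation near f x0 n B := (analytic_near p iota phi C f x0 n B).
Local Notation CanC := (Defs.Can p iota phi C).
Implicit Types (f g : T -> K^o).

Lemma analytic_near_le f x0 n n' B : (n <= n')%N -> near f x0 n B -> near f x0 n' B.
Proof.
move=> nn' [c [cB c0 cf]]; exists c.
have le a : na_abs (c a) * eps (n' * \sum_(k < d) a k) <= na_abs (c a) * eps (n * \sum_(k < d) a k).
  by rewrite ler_wpM2l ?na_abs_ge0// eps_le// leq_mul2r nn' orbT.
split=> [a|e e0|x Cx xk].
- exact: le_trans (le a) (cB a).
- by have [N hN] := c0 e e0; exists N => a /hN; exact: le_lt_trans (le a).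
- by apply: cf => // k; rewrite (le_trans (xk k))// eps_le.
Qed.

Lemma na_cvg_comb (k : K) (u v : nat -> K) (x y : K) : na_cvg na_abs u x -> na_cvg na_abs v y ->
  na_cvg na_abs (fun n => k * u n + v n) (k * x + y).
Proof.
move=> ux vy e e0; have k0 : 0 < na_abs k + 1 by rewrite ltr_wpDl ?na_abs_ge0.
have [n hn] := ux _ (divr_gt0 e0 k0); have [m hm] := vy _ e0; exists (maxn n m) => i hi.
have -> : k * u i + v i - (k * x + y) = k * (u i - x) + (v i - y) by ring.
apply: na_abs_lt_max; last by apply: hm; rewrite (leq_trans _ hi)// leq_maxr.
rewrite na_absM; have := hn i (leq_trans (leq_maxl _ _) hi); rewrite ltr_pdivlMr//.
by apply: le_lt_trans; rewrite mulrC ler_wpM2l ?na_abs_ge0// lerDl.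
Qed.

Lemma analytic_near_comb (k : K) f g x0 n B B' : near f x0 n B -> near g x0 n B' ->
  near (k *: f + g) x0 n (Num.max (na_abs k * B) B').
Proof.
move=> [c [cB c0 cf]] [c' [cB' c0' cf']]; exists (fun a => k * c a + c' a).
have le a (e : R) : na_abs k * (na_abs (c a) * eps (n * \sum_(k < d) a k)) <= e ->
    na_abs (c' a) * eps (n * \sum_(k < d) a k) <= e ->
    na_abs (k * c a + c' a) * eps (n * \sum_(k < d) a k) <= e.
  rewrite mulrA -na_absM -!ler_pdivlMr ?eps_gt0//; exact: na_abs_le_max.
split=> [a|e e0|x Cx xk].
- apply: le; rewrite le_max; apply/orP; last by right.
  by left; rewrite ler_wpM2l ?na_abs_ge0.
- have k0 : 0 < na_abs k + 1 by rewrite ltr_wpDl ?na_abs_ge0.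
  have e20 : 0 < e / 2 by rewrite divr_gt0.
  have [N hN] := c0 _ (divr_gt0 e20 k0); have [N' hN'] := c0' _ e20.
  exists (maxn N N') => a ha; apply: (@le_lt_trans _ _ (e / 2)); last first.
    by rewrite ltr_pdivrMr// ltr_pMr// ltr1n.
  apply: le; last by apply/ltW/hN'; rewrite (leq_trans _ ha)// leq_maxr.
  have := hN a (leq_trans (leq_maxl _ _) ha); rewrite ltr_pdivlMr// => /ltW; apply: le_trans.
  rewrite mulrC ler_wpM2l ?lerDl// mulr_ge0 ?na_abs_ge0//.
  by rewrite ltW// eps_gt0.
- have := na_cvg_comb k (cf x Cx xk) (cf' x Cx xk).
  congr na_cvg; apply/funext => N; rewrite mulr_sumr -big_split; apply: eq_bigr => a _ /=.
  by rewrite mulrDl mulrA.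
Qed.

(** Two expansions at x0 are compared on the smaller of their two balls. *)
Lemma Can_comb (k : K) f g : CanC f -> CanC g -> CanC (k *: f + g).
Proof.
move=> [fa f0] [ga g0]; split; last first.
  by move=> x nx; rewrite -[LHS]/(k *: f x + g x) f0// g0// scaler0 addr0.
move=> x0 Cx0; have [n [B h]] := fa x0 Cx0; have [n' [B' h']] := ga x0 Cx0.
exists (maxn n n'), (Num.max (na_abs k * B) B'); apply: analytic_near_comb.
- exact: analytic_near_le (leq_maxl _ _) h.
- exact: analytic_near_le (leq_maxr _ _) h'.
Qed.

Lemma Can0 : CanC 0.
Proof.
split=> // x0 Cx0; exists 0%N, 0, (fun=> 0); split=> [a|e e0|x Cx _].
- by rewrite na_abs0 mul0r.
- by exists 0%N => a _; rewrite na_abs0 mul0r.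
- move=> e e0; exists 0%N => N _.
  by rewrite big1 ?subrr ?na_abs0// => a _; rewrite mul0r.
Qed.

(** The value at the centre of a ball is the constant coefficient. *)
Lemma analytic_near_bound f x0 n B : C x0 -> near f x0 n B -> na_abs (f x0 : K) <= B.
Proof.
move=> Cx0 [c [cB _ cf]]; have := cB [ffun=> 0%N].
rewrite big1 ?muln0 ?expr0 ?invr1 ?mulr1; last by move=> k _; rewrite ffunE.
apply: le_trans.
suff -> : f x0 = c [ffun=> 0%N] by [].
have /(na_cvg_unique (cf x0 Cx0 _)) : na_cvg na_abs
    (fun N => \sum_(a : {ffun 'I_d -> 'I_N})
       c [ffun k => nat_of_ord (a k)] * iota (monomial_at (phi x0 - phi x0) a))
    (c [ffun=> 0%N]).
  move=> e e0; exists 1%N => -[//|N] _.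
  rewrite (bigD1 [ffun=> ord0])//= subrr big1 => [|a a0].
    rewrite addr0 /monomial_at big1 => [|k _]; last by rewrite ffunE expr0.
    rewrite rmorph1 mulr1 (_ : [ffun k => _] = [ffun=> 0%N]) ?subrr ?na_abs0//.
    by apply/ffunP => k; rewrite !ffunE.
  have [k ak] : exists k, a k != ord0.
    apply/existsP; apply: contraNT a0 => /existsPn h; apply/eqP/ffunP => k.
    by have := h k; rewrite negbK ffunE => /eqP.
  rewrite /monomial_at (bigD1 k)//= mxE expr0n.
  by rewrite (_ : (nat_of_ord (a k) == 0%N) = false) ?mul0r ?rmorph0 ?mulr0//; apply: negbTE.
by apply => k; rewrite subrr na_abs0 ltW// eps_gt0.
Qed.

Lemma dual_seminorm (l : (T -> K^o) -> K^o) :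
  (forall (c : K) f g, CanC f -> CanC g -> l (c *: f + g) = c *: l f + l g) ->
  is_seminorm CanC (fun f => na_abs (l f : K)).
Proof.
move=> lin; have l0 : l 0 = 0.
  by have := lin (-1) 0 0 Can0 Can0; rewrite scaler0 addr0 scaleN1r addNr.
split=> [f _|c f Cf|f g Cf Cg]; first exact: na_abs_ge0.
- by have := lin c f 0 Cf Can0; rewrite addr0 l0 addr0 => ->; rewrite -na_absM.
- by have := lin 1 f g Cf Cg; rewrite !scale1r => ->; exact: na_abs_ultra.
Qed.

Lemma dual_comb (c : K) l l' : dual_set CanC l -> dual_set CanC l' ->
  dual_set CanC (c *: l + l').
Proof.
move=> [lin [_ bd] l0] [lin' [_ bd'] l0'].
have lin2 (k : K) f g : CanC f -> CanC g ->
    (c *: l + l') (k *: f + g) = k *: (c *: l + l') f + (c *: l + l') g.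
  move=> Cf Cg; rewrite -![(c *: l + l') _]/(c *: l _ + l' _) lin// lin'//.
  rewrite !scalerDr !scalerA [c * k]mulrC -!addrA; congr (_ + _).
  by rewrite addrCA.
split=> //; last first.
  by move=> f nf; rewrite -[LHS]/(c *: l f + l' f) l0// l0'// scaler0 addr0.
split; first exact: dual_seminorm.
move=> n; have [M hM] := bd n; have [M' hM'] := bd' n.
exists (Num.max (na_abs c * M) M') => f B Cf B0 fB.
apply: na_abs_le_max.
  rewrite na_absM (le_trans (ler_wpM2l (na_abs_ge0 _) (hM f B Cf B0 fB)))//.
  by rewrite mulrA ler_wpM2r// le_max lexx.
by rewrite (le_trans (hM' f B Cf B0 fB))// ler_wpM2r// le_max lexx orbT.
Qed.

Definition dirac (x : T) : (T -> K^o) -> K^o :=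
  patch (fun=> 0) (lcs_carrier CanC) (fun f => f x).

Lemma diracE x f : CanC f -> dirac x f = f x.
Proof. by move=> Cf; rewrite /dirac patchT// inE. Qed.

Lemma dirac_dual x : C x -> dual_set CanC (dirac x).
Proof.
move=> Cx; have lin (k : K) f g : CanC f -> CanC g ->
    dirac x (k *: f + g) = k *: dirac x f + dirac x g.
  by move=> Cf Cg; rewrite !diracE//; exact: Can_comb.
split=> //; last by move=> f nf; rewrite /dirac patchN// notin_setE.
split; first exact: dual_seminorm.
move=> n; exists 1 => f B Cf B0 fB; rewrite mul1r diracE//.
exact: analytic_near_bound (fB x Cx).
Qed.

(** The singleton of f is bounded. *)
Lemma strong_dual_eval f : CanC f -> lcs_csn (strong_dual CanC) (fun l => na_abs (l f : K)).
Proof.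
move=> Cf; split.
  split=> [l _|c l _|l l' _ _]; first exact: na_abs_ge0.
  - by rewrite -na_absM.
  - exact: na_abs_ultra.
exists [set f], 1; split.
  split=> [_ -> //|s _]; exists (s f) => _ -> //.
by move=> l b Dl b0; rewrite mul1r; apply.
Qed.

Lemma dual_sum l (n : nat) (a : 'I_n -> K) (f : 'I_n -> T -> K^o) : dual_set CanC l ->
  (forall i, CanC (f i)) -> CanC (\sum_(i < n) a i *: f i) /\
  l (\sum_(i < n) a i *: f i) = \sum_(i < n) a i * l (f i).
Proof.
move=> [lin _ _] Cf.
have l0 : l 0 = 0.
  by have := lin (-1) 0 0 Can0 Can0; rewrite scaler0 addr0 scaleN1r addNr.
elim/big_rec2: _ => [|i y g _ [Cg lg]]; first by split; [exact: Can0|].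
by split; [exact: Can_comb|rewrite lin// lg].
Qed.

End AnalyticFunctions.

Section Transfer.
Variables (R : realType) (p : nat) (Qp K : naField R) (iota : {rmorphism Qp -> K}).
Hypothesis p_prime : prime p.
Hypothesis iota_abs : forall x : Qp, na_abs (iota x) = na_abs x.
Local Notation eps k := ((p%:R : R) ^- k).
Local Notation Gam := 'M[Qp]_2.
Variables (C : set Gam) (n1 j : nat) (psi : Qp -> K).
Hypothesis sC : is_subgroup C.
Hypothesis CG : C `<=` borel Qp.
Hypothesis C_abs : forall g, C g -> na_abs (g 0 0) = 1.
Hypothesis C_nbhd : forall a b : Qp, na_abs (a - 1) <= eps n1 -> na_abs b <= eps n1 ->
  C (upper_mx a b).

Definition semi_invariant (f : Gam -> K^o) : Prop :=
  (forall g, ~ C g -> f g = 0) /\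
  forall g u, C g -> C u -> na_abs (u 0 0 - 1) <= eps j -> f (g * u) = psi (u 0 0) * f g.

Lemma borelE (g : Gam) : borel Qp g -> g = upper_mx (g 0 0) (g 0 1).
Proof. by move=> [a [b [_ ->]]]; rewrite !upperE. Qed.

Lemma borelVM (g h : Gam) : borel Qp g -> borel Qp h -> (g^-1 * h) 0 0 = h 0 0 / g 0 0.
Proof.
move=> [a [b [a0 ->]]] [a' [b' [a0' ->]]].
by rewrite upperV// upperM !upperE mulrC.
Qed.

Lemma chartE (g : Gam) k : borel_chart g 0 k = g 0 k.
Proof. by rewrite mxE. Qed.

Lemma chartB (g h : Gam) k : (borel_chart g - borel_chart h) 0 k = g 0 k - h 0 k.
Proof. by rewrite mxE [X in _ + X]mxE !chartE. Qed.

(** Semi-invariant functions depend only on the diagonal entry, and only up to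
    a scalar on what they are near a given point: the part of the power series of
    f at c which involves the diagonal coordinate alone, rescaled, expands h at
    any other point. *)
Lemma Can_transfer (f h : Gam -> K^o) c : semi_invariant f -> CanG p iota C f ->
  C c -> f c != 0 -> semi_invariant h -> CanG p iota C h.
Proof.
move=> [_ fpsi] [fan _] Cc fc0 [h0 hpsi]; split=> // x0 Cx0.
have [n [B [cf [cB csmall cfE]]]] := fan c Cc.
have [_ _ CM CV] := sC; have uC g : C g -> g \is a GRing.unit by move=> /CG/borel_unit.
have c1 := C_abs Cc; have x1 := C_abs Cx0.
have ne0 (a : Qp) : na_abs a = 1 -> a != 0.
  by move=> a1; apply/eqP => a0; move: a1; rewrite a0 na_abs0 => /eqP; rewrite eq_sym oner_eq0.
have c0 := ne0 _ c1; have x0_0 := ne0 _ x1.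
have bc0 : 0 < na_abs (c 0 1) + 1 by rewrite ltr_wpDl ?na_abs_ge0.
have [m hm] := eps_small p_prime (divr_gt0 (eps_gt0 R p_prime n1) bc0).
pose n' := maxn (maxn n j) (maxn n1 (maxn m 1)).
have nn' : (n <= n')%N by rewrite !leq_max leqnn.
have jn' : (j <= n')%N by rewrite !leq_max leqnn orbT.
have n1n' : (n1 <= n')%N by rewrite !leq_max leqnn !orbT.
have mn' : (m <= n')%N by rewrite !leq_max leqnn !orbT.
have n'1 : (1 <= n')%N by rewrite !leq_max leqnn !orbT.
have B0 : 0 <= B.
  by apply: le_trans (cB [ffun=> 0%N]); rewrite mulr_ge0 ?na_abs_ge0// ltW// eps_gt0.
pose kap : K := h x0 / f c; pose r := c 0 0 / x0 0 0.
have r1 : na_abs r = 1 by rewrite na_absM na_absV c1 x1 invr1 mulr1.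
pose ch (a : {ffun 'I_2 -> nat}) : K :=
  if a 1 == 0%N then kap * iota r ^+ a 0 * cf a else 0.
have chle a : na_abs (ch a) <= na_abs kap * na_abs (cf a).
  rewrite /ch; case: ifP => _; last by rewrite na_abs0 mulr_ge0 ?na_abs_ge0.
  by rewrite !na_absM na_absX iota_abs r1 expr1n mulr1.
have szle a : na_abs (ch a) * eps (n' * \sum_(k < 2) a k) <=
    na_abs kap * (na_abs (cf a) * eps (n * \sum_(k < 2) a k)).
  rewrite mulrA; apply: ler_pM => //; [exact: na_abs_ge0|by rewrite ltW// eps_gt0|].
  by rewrite eps_le// leq_mul2r nn' orbT.
have k0 : 0 < na_abs kap + 1 by rewrite ltr_wpDl ?na_abs_ge0.
exists n', (na_abs kap * B), ch; split=> [a|e e0|x Cx xk].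
- by rewrite (le_trans (szle a))// ler_wpM2l ?na_abs_ge0.
- have [N hN] := csmall _ (divr_gt0 e0 k0); exists N => a /hN.
  rewrite ltr_pdivlMr//; apply: le_lt_trans; apply: (le_trans (szle a)).
  rewrite mulrC ler_wpM2l ?lerDl// mulr_ge0 ?na_abs_ge0//.
  by rewrite ltW// eps_gt0.
pose u := x0^-1 * x; have Cu : C u by apply: CM => //; exact: CV.
have uE : u 0 0 = x 0 0 / x0 0 0 by apply: borelVM; exact: CG.
have u1 : na_abs (u 0 0 - 1) <= eps n'.
  have -> : u 0 0 - 1 = (x 0 0 - x0 0 0) / x0 0 0 by rewrite uE mulrBl divff.
  by rewrite na_absM na_absV x1 invr1 mulr1; have := xk 0; rewrite !chartE.
have uu : na_abs (u 0 0) = 1 by exact: C_abs.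
(* the point of the fibre of c over the same diagonal increment, with the
   off-diagonal entry of c *)
pose b' := c 0 1 * (1 - (u 0 0)^-1) / c 0 0.
pose w := upper_mx (u 0 0) b'.
have Cw : C w.
  apply: C_nbhd; first by rewrite (le_trans u1)// eps_le.
  rewrite /b' !na_absM na_absV c1 invr1 mulr1 na_absBC.
  have uV : na_abs ((u 0 0)^-1 - 1) <= eps m.
    by apply: (le_trans (near1V p_prime n'1 u1)); exact: eps_le.
  move: hm; rewrite ltr_pdivlMr// => /ltW; apply: le_trans.
  by rewrite mulrC; apply: ler_pM; rewrite ?na_abs_ge0// lerDl.
have cwE : c * w = upper_mx (c 0 0 * u 0 0) (c 0 1).
  rewrite {1}(borelE (CG Cc)) upperM; congr upper_mx.
  by rewrite /b' mulrCA divff// mulr1 mulrBr mulr1 subrK.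
have cw0 : (c * w) 0 0 - c 0 0 = r * (x 0 0 - x0 0 0).
  rewrite cwE upperE uE /r -{2}[c 0 0]mulr1 -mulrBr -mulrA; congr (_ * _).
  by rewrite mulrC mulrBr mulVf// [in RHS]mulrC mulrC.
have cw1 : (c * w) 0 1 - c 0 1 = 0 by rewrite cwE upperE subrr.
have hx : h x = kap * f (c * w).
  have -> : x = x0 * u by rewrite /u mulVKr// uC.
  rewrite hpsi//; last by rewrite (le_trans u1)// eps_le.
  rewrite fpsi//; last by rewrite upperE (le_trans u1)// eps_le.
  by rewrite upperE /kap [RHS]mulrCA divfK.
have := cfE (c * w) (CM _ _ Cc Cw).
have hk k : na_abs (borel_chart (c * w) 0 k - borel_chart c 0 k) <= eps n.
  rewrite !chartE; case: (ord2P k) => ->; last by rewrite cw1 na_abs0 ltW// eps_gt0.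
  rewrite cw0 na_absM r1 mul1r; have := xk 0; rewrite !chartE => /le_trans; apply.
  exact: eps_le.
move=> /(_ hk) cv; rewrite hx.
have := na_cvg_comb kap cv (_ : na_cvg na_abs (fun=> 0) 0).
rewrite addr0 => cv'.
have {cv'} : na_cvg na_abs (fun N => kap * (\sum_(a : {ffun 'I_2 -> 'I_N})
     cf [ffun k => nat_of_ord (a k)] *
     iota (monomial_at (borel_chart (c * w) - borel_chart c) a)) + 0) (kap * f (c * w)).
  by apply: cv' => e e0; exists 0%N => ? _; rewrite subrr na_abs0.
congr na_cvg; apply/funext => N; rewrite addr0 mulr_sumr; apply: eq_bigr => a _.
rewrite /ch /monomial_at !big_ord_recl !big_ord0 !mulr1 !chartB.
have -> : lift ord0 ord0 = 1 :> 'I_2 by exact/val_inj.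
rewrite -[ord0]/(0 : 'I_2) cw0 cw1 !ffunE expr0n.
case: eqP => [->|_] /=; last by rewrite mulr0n mulr0 rmorph0 !mulr0 mul0r.
rewrite expr0 !mulr1 !rmorphXn rmorphM exprMn /=; ring.
Qed.

End Transfer.

(** * Compact open subgroups *)

Lemma finite_representatives (T : eqType) (r : T -> T -> Prop) (s : seq T) :
  (forall x, r x x) -> (forall x y, r x y -> r y x) ->
  exists s', [/\ uniq s', {subset s' <= s},
    forall x, x \in s -> exists2 y, y \in s' & r x y
    & forall x y, x \in s' -> y \in s' -> r x y -> x = y].
Proof.
move=> rr rC; elim: s => [|x s [s' [us' ss' cov sep]]]; first by exists [::].
have [[y ys' xy]|nx] := pselect (exists2 y, y \in s' & r x y).
  exists s'; split=> // [z /ss'|z]; rewrite inE; first by move=> ->; rewrite orbT.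
  by case/orP => [/eqP ->|/cov//]; exists y.
exists (x :: s'); split.
- rewrite /= us' andbT; apply/negP => xs'; apply: nx; exists x => //.
- by move=> z; rewrite !inE => /orP[->//|/ss' ->]; rewrite orbT.
- move=> z; rewrite inE => /orP[/eqP ->|/cov[y ys' zy]].
    by exists x; rewrite ?inE ?eqxx.
  by exists y; rewrite ?inE ?ys' ?orbT.
- move=> z y; rewrite !inE => /orP[/eqP ->|zs'] /orP[/eqP ->|ys'] zy //.
  + by case: nx; exists y.
  + by case: nx; exists z => //; exact: rC.
  + exact: sep.
Qed.

Section CompactOpenSubgroup.
Variables (R : realType) (p : nat) (Qp : naField R).
Hypothesis p_prime : prime p.
Local Notation eps k := ((p%:R : R) ^- k).
Local Notation Gam := 'M[Qp]_2.
Local Notation G := (borel Qp).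
Variable C : set Gam.
Hypothesis sC : is_subgroup C.
Hypothesis CG : C `<=` G.
Hypothesis compC : mx_compact C.

Lemma compact_bounded : exists B : R, forall g, C g -> forall i k, na_abs (g i k) <= B.
Proof.
pose U (n : nat) : set Gam := [set g | forall i k, na_abs (g i k) < n%:R].
have oU n : mx_open (U n).
  move=> g gn; exists n%:R; first by apply: le_lt_trans (gn 0 0); exact: na_abs_ge0.
  by move=> h hg i k; rewrite -(subrK (g i k) (h i k)) na_abs_lt_max.
have [g Cg|s sU] := compC oU.
  pose B := \sum_i \sum_k na_abs (g i k).
  exists (Num.truncn B).+1 => //= i k; apply: le_lt_trans (truncnS_gt _).
  rewrite /B (bigD1 i)//= (bigD1 k)//= -addrA lerDl addr_ge0 ?sumr_ge0// => ? _.
    exact: na_abs_ge0.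
  by rewrite sumr_ge0// => ? _; exact: na_abs_ge0.
exists (\max_(n <- s) n)%:R => g /sU[n /= ns gn] i k.
by apply/ltW/(lt_le_trans (gn i k)); rewrite ler_nat leq_bigmax_seq.
Qed.

(** The diagonal entries form a bounded multiplicative group. *)
Lemma compact_diag_abs g : C g -> na_abs (g 0 0) = 1.
Proof.
have [_ C1 CM CV] := sC; have [B hB] := compact_bounded.
have le1 h : C h -> na_abs (h 0 0) <= 1.
  move=> Ch; rewrite leNgt; apply/negP => h1.
  have CX n : C (h ^+ n) by elim: n => [|n IH]; rewrite ?expr0// exprS; apply: CM.
  have hX n : (h ^+ n) 0 0 = (h 0 0) ^+ n.
    elim: n => [|n IH]; first by rewrite !expr0 -upper1 upperE.
    have [a [b [_ hE]]] := CG Ch; have [a' [b' [_ hnE]]] := CG (CX n).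
    by rewrite exprS [RHS]exprS -IH hnE hE upperM !upperE.
  have B0 : 0 <= B by rewrite (le_trans _ (hB _ C1 0 0))// na_abs_ge0.
  have B1 : 0 < (B + 1)^-1 by rewrite invr_gt0 ltr_wpDl.
  have [n /(_ n (leqnn n))] := geom_lt h1 B1.
  rewrite ltf_pV2 ?posrE ?ltr_wpDl// ?exprn_gt0 ?(lt_trans ltr01)//.
  by rewrite -na_absX -hX ltNge (le_trans (hB _ (CX n) 0 0))// lerDl.
move=> Cg; apply: le_anti; rewrite le1//=.
have := le1 _ (CV _ Cg); have [a [b [a0 gE]]] := CG Cg.
rewrite gE upperV// !upperE na_absV invf_le1//.
exact: na_abs_gt0.
Qed.

Lemma open_nbhd : open_in G C -> exists n1, forall a b : Qp,
  na_abs (a - 1) <= eps n1 -> na_abs b <= eps n1 -> C (upper_mx a b).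
Proof.
have [_ C1 _ _] := sC; case=> U oU CE; have : (G `&` U) 1 by rewrite -CE.
case=> _ /oU[e e0 hU]; have [n hn] := eps_small p_prime e0.
exists n.+1 => a b ha hb.
have le_e (x : Qp) : na_abs x <= eps n.+1 -> na_abs x < e.
  move=> /le_lt_trans; apply; apply: le_lt_trans hn; exact: eps_le.
have a0 : a != 0 by exact: unit1_neq0 ha.
rewrite CE; split; first by exists a, b.
apply: hU => i k; rewrite -upper1.
case: (ord2P i) => ->; case: (ord2P k) => ->; rewrite !upperE ?subr0 ?na_abs0//;
  [exact: le_e|exact: le_e|].
by rewrite invr1; apply: le_e; exact: near1V.
Qed.

Variable j : nat.
Hypothesis j1 : (1 <= j)%N.
Let pm := pm1 p (Qp := Qp) j.

(** The diagonal entries of C modulo +-(1 + p^j Z_p): the cosets are relatively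
    open, so finitely many cover the compact group C. *)
Lemma diag_representatives : exists m (c : 'I_m -> Gam),
  [/\ forall i, C (c i),
      forall g, C g -> exists i, pm (g 0 0 / c i 0 0)
    & forall i k, pm (c i 0 0 / c k 0 0) -> i = k].
Proof.
pose U (c : Gam) : set Gam := [set g | C c /\ na_abs (g 0 0 - c 0 0) < eps j].
have oU c : mx_open (U c).
  move=> g [Cc gc]; exists (eps j); first exact: eps_gt0.
  by move=> h hg; split=> //; exact: na_abs_dist_lt (hg 0 0) gc.
have [g Cg|s sU] := compC oU.
  by exists g => //; split=> //; rewrite subrr na_abs0 eps_gt0.
pose r (x y : Gam) := C x /\ C y /\ pm (x 0 0 / y 0 0) \/ x = y.
have abs0 g : C g -> g 0 0 != 0.
  move=> /compact_diag_abs g1; apply/eqP => h; move: g1; rewrite h na_abs0 => /eqP.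
  by rewrite eq_sym oner_eq0.
have pmV x y : pm (x / y) -> pm (y / x).
  by move=> h; rewrite -[y / x]invrK invfM invrK mulrC; exact: pm1V.
have [|x y [[Cx [Cy xy]]|->]|s' [us' ss' cov sep]] := @finite_representatives _ r (filter (fun c => `[< C c >]) s).
- by move=> x; right.
- by left; split=> //; split=> //; exact: pmV.
- by right.
have Cs' x : x \in s' -> C x by move=> /ss'; rewrite mem_filter => /andP[/asboolP].
exists (size s'), (fun i => nth 0 s' i).
have Ci (i : 'I_(size s')) : C (nth 0 s' i) by apply/Cs'/mem_nth.
split=> [//|g Cg|i k h].
- have [c /= cs [Cc gc]] := sU g Cg.
  have [|y ys' cy] := cov c; first by rewrite mem_filter cs andbT; apply/asboolP.
  have yi : (index y s' < size s')%N by rewrite index_mem.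
  exists (Ordinal yi); rewrite /= nth_index//.
  have gc1 : pm (g 0 0 / c 0 0).
    left; have -> : g 0 0 / c 0 0 - 1 = (g 0 0 - c 0 0) / c 0 0 by rewrite mulrBl divff ?abs0.
    by rewrite na_absM na_absV compact_diag_abs// invr1 mulr1 ltW.
  case: cy => [[_ [_ cy]]|<-//].
  have -> : g 0 0 / y 0 0 = (g 0 0 / c 0 0) * (c 0 0 / y 0 0) by rewrite mulrA divfK ?abs0.
  exact: pm1M.
- apply/val_inj/eqP; rewrite -(nth_uniq 0 (ltn_ord i) (ltn_ord k) us'); apply/eqP.
  by apply: sep; [exact: mem_nth|exact: mem_nth|left].
Qed.

End CompactOpenSubgroup.

(** * Isotypic functionals on X and the conclusion *)

Section NonAdmissibility.
Variables (R : realType) (p : nat) (Qp K : naField R).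
Variables (iota : {rmorphism Qp -> K}) (j : nat) (chi sigma : Qp -> K).
Hypothesis p_prime : prime p.
Hypothesis p_odd : (2 < p)%N.
Hypothesis hQp : is_Qp p Qp.
Hypothesis iota_abs : forall x : Qp, na_abs (iota x) = na_abs x.
Hypothesis j1 : (1 <= j)%N.
Hypothesis sigma_char : character (padicpZ Qp p 1) sigma.
Hypothesis sigma_ker : [set x | padicpZ Qp p 1 x /\ sigma x = 1] = padicpZ Qp p j.+1.
Hypothesis chi_char : character (padicZ Qp) chi.
Local Notation eps k := ((p%:R : R) ^- k).
Local Notation Gam := 'M[Qp]_2.
Local Notation G := (borel Qp).
Local Notation X := (X_rep p j chi sigma).
Local Notation Xs := (lcs_carrier X).
Local Notation E := (Gam -> Gam -> K^o).
Local Notation pm := (pm1 p (Qp := Qp) j).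
Local Notation psi := (psi p j chi sigma).

Variable C : set Gam.
Hypothesis sC : is_subgroup C.
Hypothesis CG : C `<=` G.
Hypothesis openC : open_in G C.
Hypothesis compC : mx_compact C.
Local Notation CanC := (CanG p iota C).
Local Notation D := (distr p iota C).
Local Notation X' := (lcs_carrier (strong_dual X)).
Implicit Types (g h u : Gam) (v : E) (z : E -> K^o) (l : (Gam -> K^o) -> K^o).

Let rX : is_rep G X := X_rep_rep p_prime p_odd hQp j1 sigma_char sigma_ker chi_char.
Let fX : finest_topology X :=
  @X_rep_finest _ _ _ _ _ _ _ p_prime p_odd hQp j1 sigma_char sigma_ker chi_char.
Let CM : forall g h, C g -> C h -> C (g * h). Proof. by case: sC. Qed.
Let CV : forall g, C g -> C g^-1. Proof. by case: sC. Qed.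
Let C1 : C 1. Proof. by case: sC. Qed.
Let uG g : G g -> g \is a GRing.unit. Proof. exact: borel_unit. Qed.
Let GV g : G g -> G g^-1. Proof. by case: (borel_subgroup Qp) => _ _ _; exact. Qed.
Let GM g h : G g -> G h -> G (g * h).
Proof. by case: (borel_subgroup Qp) => _ _ + _; exact. Qed.
Let Cabs g : C g -> na_abs (g 0 0) = 1.
Proof. exact: (compact_diag_abs sC CG compC). Qed.
Let C0 g : C g -> g 0 0 != 0.
Proof. by move=> /CG [a [b [a0 ->]]]; rewrite upperE. Qed.
Let XsG g v : G g -> Xs v -> Xs (rep_act X g v).
Proof. exact: (rep_stable rX). Qed.
Let psi_M := @psiM _ _ _ _ _ _ _ p_prime p_odd hQp j1 sigma_char sigma_ker chi_char.
Let psi_1 := psi1 p_prime p_odd hQp j1 sigma_char sigma_ker chi_char.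

(** The functions on C having the shape of a matrix coefficient of X at a point
    sufficiently deep in the torus. *)
Definition isotypic (f : Gam -> K^o) : Prop :=
  (forall g, ~ C g -> f g = 0) /\
  forall g u, C g -> C u -> pm (u 0 0) -> f (g * u) = psi (u 0 0) * f g.

Definition coef z v : Gam -> K^o := patch (fun=> 0) C (fun g => z (rep_act X g^-1 v)).

Lemma coefE z v g : C g -> coef z v g = z (rep_act X g^-1 v).
Proof. by move=> Cg; rewrite /coef patchT// inE. Qed.

Lemma coef0 z v g : ~ C g -> coef z v g = 0.
Proof. by move=> ng; rewrite /coef patchN// notin_setE. Qed.

Definition isodual : set (E -> K^o) :=
  [set z | X' z /\ forall v, Xs v -> isotypic (coef z v)].

Lemma dual_lin z (c : K) v w : X' z -> Xs v -> Xs w -> z (c *: v + w) = c *: z v + z w.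
Proof. by case=> lin _ _; exact: lin. Qed.

Lemma dual_comb_X z z' (c : K) : X' z -> X' z' -> X' (c *: z + z').
Proof.
move=> [lin _ z0] [lin' _ z0']; apply: dual_finest => //; first exact: rep0 rX.
- move=> k v w Xv Xw; rewrite -![(c *: z + z') _]/(c *: z _ + z' _) lin// lin'//.
  rewrite !scalerDr !scalerA [c * k]mulrC -!addrA; congr (_ + _).
  by rewrite addrCA.
- by move=> v nv; rewrite -[LHS]/(c *: z v + z' v) z0// z0'// scaler0 addr0.
Qed.

Lemma isodual_comb z z' (c : K) : isodual z -> isodual z' -> isodual (c *: z + z').
Proof.
move=> [Xz hz] [Xz' hz']; split; first exact: dual_comb_X.
move=> v Xv; have [z0 zu] := hz v Xv; have [z0' zu'] := hz' v Xv.
split=> [g ng|g u Cg Cu pu]; first by rewrite coef0.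
have E1 h : C h -> coef (c *: z + z') v h = c * coef z v h + coef z' v h.
  by move=> Ch; rewrite !coefE.
rewrite !E1//; last exact: CM.
by rewrite zu// zu'// mulrDr mulrCA.
Qed.

Lemma isodual0 : isodual 0.
Proof.
split.
  apply: dual_finest => //; first exact: rep0 rX.
  by move=> c v w _ _; rewrite scaler0 addr0.
have E1 v h : coef 0 v h = 0.
  by have [Ch|nh] := pselect (C h); [rewrite coefE|rewrite coef0].
by move=> v _; split=> [g _|g u _ _ _]; rewrite !E1 ?mulr0.
Qed.

(* a base point so deep in the torus that C is conjugated into the region where
   sigma is trivial *)
Variables (B : R) (k0 : nat).
Hypothesis C_le : forall g, C g -> na_abs (g 0 1) <= B.
Hypothesis k0_deep : eps k0 * B <= eps j.+1.

Definition deep (k : nat) : Gam := upper_mx (p%:R ^- (k0 + k)) 0.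

Let p0 : p%:R != 0 :> Qp. Proof. by rewrite (natQp_neq0 p_prime hQp) ?prime_gt0. Qed.

Lemma deep_G k : G (deep k).
Proof. by exists (p%:R ^- (k0 + k)), 0; rewrite invr_eq0 expf_neq0. Qed.

Lemma deep_conj (k l : nat) g : G g -> (deep k)^-1 * g * deep l =
  upper_mx (p%:R ^+ (k0 + k) * g 0 0 * p%:R ^- (k0 + l))
           (p%:R ^+ (k0 + k) * g 0 1 * p%:R ^+ (k0 + l)).
Proof.
move=> Gg; rewrite {1}(borelE Gg) /deep upperV ?invr_eq0 ?expf_neq0//.
by rewrite !upperM invrK oppr0 mul0r !mulr0 !add0r !addr0 invrK.
Qed.

Lemma deep_conj_same k g : C g -> exists2 b,
  na_abs b <= eps j.+1 & (deep k)^-1 * g * deep k = upper_mx (g 0 0) b.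
Proof.
move=> Cg; exists (p%:R ^+ (k0 + k) * g 0 1 * p%:R ^+ (k0 + k)).
  rewrite mulrC mulrA -exprD na_absM (abs_pX p_prime hQp).
  apply: le_trans k0_deep; apply: ler_pM; rewrite ?na_abs_ge0 ?C_le//.
    by rewrite ltW// eps_gt0.
  by apply: eps_le => //; rewrite -addnA leq_addr.
rewrite deep_conj; last exact: CG.
by rewrite [_ * g 0 0]mulrC mulfK// expf_neq0.
Qed.

Definition deep_eval (k : nat) : E -> K^o := fun v =>
  if `[< Xs v >] then v (deep k) 1 else 0.

Definition deep_vec (k : nat) : E := gen_vec p j chi sigma (deep k).

Lemma deep_evalE k v : Xs v -> deep_eval k v = v (deep k) 1.
Proof. by move=> Xv; rewrite /deep_eval asboolT. Qed.

Lemma deep_vec_in k : Xs (deep_vec k).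
Proof. apply: gen_vec_in => //; exact: deep_G. Qed.

Lemma deep_eval_isodual k : isodual (deep_eval k).
Proof.
split.
  apply: dual_finest => //; first exact: rep0 rX.
  - move=> c v w Xv Xw; rewrite !deep_evalE//; exact: (rep_comb rX).
  - by move=> v nv; rewrite /deep_eval asboolF.
move=> v Xv; split=> [g ng|g u Cg Cu pu]; first by rewrite coef0.
have Gg := CG Cg; have Gu := CG Cu.
rewrite !coefE//; last exact: CM.
rewrite !deep_evalE; [|by apply: XsG => //; exact: GV|by apply: XsG => //; apply/GV/GM].
rewrite /= !invrK -mulrA.
have -> : u * deep k = deep k * ((deep k)^-1 * u * deep k).
  by rewrite -[_^-1 * u * _]mulrA mulVKr// uG//; exact: deep_G.
have [b hb ->] := deep_conj_same k Cu; rewrite mulrA.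
apply: (X_rep_psi p_prime p_odd hQp j1 sigma_ker Xv) => //.
exact/GM/deep_G.
Qed.

(** Distinct deep translates are separated by the valuation of the torus, which
    C does not move. *)
Lemma deep_pairing (k l : nat) g : C g -> coef (deep_eval k) (deep_vec l) g =
  if k == l then psi (g 0 0) else 0.
Proof.
move=> Cg; have Gg := CG Cg; rewrite coefE// deep_evalE; last first.
  by apply: XsG; [exact: GV|exact: deep_vec_in].
rewrite /= invrK /deep_vec gen_vecE//; last by apply: GM => //; exact: deep_G.
rewrite mulrA; case: eqP => [->|/eqP kl].
  have [b hb ->] := deep_conj_same l Cg.
  exact: (gen_fun_psi chi p_prime p_odd hQp j1 sigma_ker).
apply/eqP; apply: contrapT => /negP/gen_fun_neq0; rewrite deep_conj// upperN.
set a := p%:R ^+ _ * _ * _ => h.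
have : na_abs a = 1.
  have j1' := abs_unit1 p_prime j1.
  case: h => -[a' [b' [ha' _ /upper_inj[aE _]]]]; first by rewrite aE; exact: j1' ha'.
  by rewrite -(na_absN a) aE; exact: j1' ha'.
rewrite /a !na_absM na_absV !(abs_pX p_prime hQp) Cabs// mulr1 invrK => h1.
have : eps (k0 + l) = eps (k0 + k).
  have pk : (p%:R : R) ^+ (k0 + k) != 0 by rewrite expf_neq0 ?pnatr_eq0 -?lt0n ?prime_gt0.
  by apply: (mulIf pk); rewrite h1 mulVf.
move=> h2; move: kl; apply/negP; rewrite negbK.
have [lt|lt|//] := ltngtP k l.
- by have := @eps_lt R p p_prime (k0 + k) (k0 + l); rewrite h2 ltxx ltn_add2l lt => /(_ isT).
- by have := @eps_lt R p p_prime (k0 + l) (k0 + k); rewrite h2 ltxx ltn_add2l lt => /(_ isT).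
Qed.

Variables (m : nat) (c : 'I_m -> Gam).
Hypothesis Cc : forall i, C (c i).
Hypothesis c_cov : forall g, C g -> exists i, pm (g 0 0 / c i 0 0).
Hypothesis c_sep : forall i k, pm (c i 0 0 / c k 0 0) -> i = k.

Definition iso_basis (i : 'I_m) : Gam -> K^o := fun g =>
  if `[< C g >] then psi (g 0 0 / c i 0 0) else 0.

Lemma CM00 g h : C g -> C h -> (g * h) 0 0 = g 0 0 * h 0 0.
Proof.
by move=> /CG[a [b [_ ->]]] /CG[a' [b' [_ ->]]]; rewrite upperM !upperE.
Qed.

Lemma psi_pm (a u : Qp) : pm u -> psi (a * u) = psi u * psi a.
Proof.
move=> pu; have [pa|na] := pselect (pm a); first by rewrite psi_M// mulrC.
rewrite [psi a]psi_eq0// mulr0 psi_eq0// => pau; apply: na.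
have u0 : u != 0 by exact: pm1_neq0 pu.
by rewrite -(mulfK u0 a); apply: pm1M => //; exact: pm1V.
Qed.

Lemma iso_basis_isotypic i : isotypic (iso_basis i).
Proof.
split=> [g ng|g u Cg Cu pu]; first by rewrite /iso_basis asboolF.
rewrite /iso_basis !asboolT//; last exact: CM.
by rewrite CM00// mulrAC (psi_pm _ pu).
Qed.

Lemma iso_basis_rep i k : iso_basis i (c k) = (i == k)%:R.
Proof.
rewrite /iso_basis asboolT//; case: eqP => [->|ik]; first by rewrite divff ?psi_1// C0.
by apply: psi_eq0 => /c_sep ki; apply: ik.
Qed.

(** An isotypic function is determined by its values at the representatives c_i. *)
Lemma isotypic_expand f : isotypic f -> f = \sum_(i < m) f (c i) *: iso_basis i.
Proof.
move=> [f0 fu]; apply/funext => g; rewrite fct_sumE.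
have [Cg|ng] := pselect (C g); last first.
  rewrite f0// big1// => i _; have [h _] := iso_basis_isotypic i.
  by rewrite -[LHS]/(f (c i) *: iso_basis i g) h// scaler0.
have [i pi] := c_cov Cg; rewrite (bigD1 i)//= big1 ?addr0.
  rewrite -[RHS]/(f (c i) * iso_basis i g) /iso_basis asboolT//.
  have Cu : C ((c i)^-1 * g) by apply: CM => //; exact: CV.
  have uE : ((c i)^-1 * g) 0 0 = g 0 0 / c i 0 0 by apply: borelVM; exact: CG.
  by rewrite -{1}(mulVKr (uG (CG (Cc i))) g) fu ?uE// mulrC.
move=> k ki; rewrite -[LHS]/(f (c k) * iso_basis k g) /iso_basis asboolT//.
rewrite psi_eq0 ?mulr0// => pk; move: ki; rewrite eq_sym => /negP; apply; apply/eqP/c_sep.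
have -> : c i 0 0 / c k 0 0 = (g 0 0 / c i 0 0)^-1 * (g 0 0 / c k 0 0).
  by rewrite invfM invrK mulrACA mulVf ?C0// mul1r.
by apply: pm1M => //; exact: pm1V.
Qed.

Lemma isotypic_semi f : isotypic f -> semi_invariant p C j psi f.
Proof. by move=> [f0 fu]; split=> // g u Cg Cu h; apply: fu => //; left. Qed.

Section Distributions.
Hypothesis basis_Can : forall i, CanC (iso_basis i).

Lemma isotypic_Can f : isotypic f -> CanC f.
Proof.
move=> /isotypic_expand ->.
have [] // := @dual_sum _ p _ _ iota p_prime _ _ (@borel_chart R Qp) C (dirac p iota (@borel_chart R Qp) C 1) m
  (fun i => f (c i)) iso_basis (dirac_dual iota p_prime _ C1).
Qed.

Lemma dual_isotypic l f : D l -> isotypic f -> l f = \sum_(i < m) f (c i) * l (iso_basis i).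
Proof.
by move=> Dl fi; rewrite {1}(isotypic_expand fi); have [] := dual_sum p_prime (fun i => f (c i)) Dl basis_Can.
Qed.

Local Notation act := (dual_action X C).

Lemma dual_actE l z v : Xs v -> act l z v = l (coef z v).
Proof. by move=> Xv; rewrite /dual_action patchT// inE. Qed.

Lemma coef_act z v g h : Xs v -> C g -> C h -> coef z (rep_act X g^-1 v) h = coef z v (g * h).
Proof.
move=> Xv Cg Ch; have Gg := CG Cg; have Gh := CG Ch.
rewrite !coefE//; last exact: CM.
by rewrite invrM ?uG// (rep_mul rX)//; exact: GV.
Qed.

(** Expanding the coefficient of z in the isotypic basis shows that l acts on z as a
    combination of the translates of z by the c_i; and the diagonal of C is
    commutative, so that these translates are isotypic again. *)
Lemma act_isodual l z : D l -> isodual z -> isodual (act l z).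
Proof.
move=> Dl [Xz hz]; split.
  apply: dual_finest => //; first exact: rep0 rX.
  - move=> k v w Xv Xw; rewrite !dual_actE//; last exact: (rep_comb rX).
    have -> : coef z (k *: v + w) = k *: coef z v + coef z w.
      apply/funext => g; rewrite -[RHS]/(k *: coef z v g + coef z w g).
      have [Cg|ng] := pselect (C g); last by rewrite !coef0// scaler0 addr0.
      have Gg := GV (CG Cg).
      by rewrite !coefE// (rep_lin rX)// dual_lin//; exact: XsG.
    by case: Dl => lin _ _; apply: lin; apply/isotypic_Can/hz.
  - by move=> v nv; rewrite /dual_action patchN// notin_setE.
move=> v Xv; split=> [g ng|g u Cg Cu pu]; first by rewrite coef0.
have actE h : C h -> coef (act l z) v h = \sum_(i < m) coef z v (h * c i) * l (iso_basis i).
  move=> Ch; have Gh := GV (CG Ch); have Xh := XsG Gh Xv.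
  rewrite coefE// dual_actE// (dual_isotypic Dl (hz _ Xh)).
  by apply: eq_bigr => i _; rewrite coef_act.
rewrite !actE//; last exact: CM.
rewrite mulr_sumr; apply: eq_bigr => i _; rewrite mulrA; congr (_ * _).
have uc := uG (CG (Cc i)).
have -> : g * u * c i = g * c i * ((c i)^-1 * (u * c i)) by rewrite !mulrA mulrK.
have Cu' : C ((c i)^-1 * (u * c i)) by apply: CM; [exact: CV|exact: CM].
have uE : ((c i)^-1 * (u * c i)) 0 0 = u 0 0.
  rewrite borelVM; [|exact/CG/Cc|by apply: GM; exact: CG].
  by rewrite CM00// mulfK// C0.
by have [_ ->] := hz v Xv; rewrite ?uE//; exact: CM.
Qed.

(** Every element of the basis is a matrix coefficient, whence faithfulness. *)
Lemma deep_coef_basis i : coef (deep_eval 0) (rep_act X (c i) (deep_vec 0)) = iso_basis i.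
Proof.
apply/funext => g; rewrite /iso_basis; case: asboolP => [Cg|ng]; last by rewrite coef0.
have Cic := CV (Cc i).
rewrite -[c i in LHS]invrK coef_act//; last exact: deep_vec_in.
rewrite deep_pairing ?eqxx; last exact: CM.
by rewrite borelVM//; exact: CG.
Qed.

Lemma not_coadmissible : ~ coadmissible D X' act.
Proof.
move=> [S [F [phi [phiD phi_act phi_th phi_inj _]]]].
have p_small : 0 < na_abs (p%:R : K) < 1.
  rewrite -(rmorph_nat iota) iota_abs (abs_p p_prime hQp).
  by rewrite invr_gt0 ltr0n prime_gt0//= invf_lt1 ?ltr0n ?prime_gt0// ltr1n prime_gt1.
have Dsn s : lcs_csn D s -> is_seminorm D s by case.
have Dlin (k : K) l l' : D l -> D l' -> D (k *: l + l').
  by move=> Dl Dl'; exact: (dual_comb k Dl Dl').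
have D1 : D (lcalg_one D) by exact: (dirac_dual iota p_prime (@borel_chart R Qp) C1).
have ZX : isodual `<=` X' by move=> z [].
have ZB z z' : isodual z -> isodual z' -> isodual (z - z').
  by move=> Zz Zz'; rewrite -scaleN1r addrC; exact: isodual_comb.
pose lam (i : 'I_m) l : K := l (iso_basis i).
pose e (i : 'I_m) := dirac p iota (@borel_chart R Qp) C (c i).
have lam_lin i (k : K) l l' : lam i (k *: l + l') = k * lam i l + lam i l' by [].
have lam_csn i : lcs_csn D (fun l => na_abs (lam i l)).
  exact: strong_dual_eval (basis_Can i).
have De i : D (e i) by exact: (dirac_dual iota p_prime (@borel_chart R Qp) (Cc i)).
have lam_e i k : lam i (e k) = (i == k)%:R.
  by rewrite /lam /e diracE//; exact: iso_basis_rep.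
have lam_kill l z : D l -> (forall i, lam i l = 0) -> isodual z -> act l z = 0.
  move=> Dl hl [Xz hz]; apply/funext => v.
  have [Xv|nv] := pselect (Xs v); last by rewrite /dual_action patchN// notin_setE.
  rewrite dual_actE// (dual_isotypic Dl (hz v Xv)) big1// => i _.
  by rewrite [l _]hl mulr0.
have lam_faithful l : D l -> (forall z, isodual z -> act l z = 0) -> forall i, lam i l = 0.
  move=> Dl hl i; have := hl _ (deep_eval_isodual 0).
  move=> /(congr1 (fun f => f (rep_act X (c i) (deep_vec 0)))).
  rewrite dual_actE ?deep_coef_basis//; apply: XsG; [exact/CG|exact: deep_vec_in].
have [n [b [Db xn]]] := isotypic_noetherian p_small Dsn Dlin D1 ZX isodual0 ZB act_isodual
  lam_lin lam_csn De lam_e lam_kill lam_faithful phiD phi_act phi_th phi_inj deep_eval_isodual.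
have := congr1 (fun f => f (deep_vec n)) xn.
have coef1 (k l : nat) : coef (deep_eval k) (deep_vec l) 1 = deep_eval k (deep_vec l).
  by rewrite coefE// invr1 (rep_one rX)//; exact: deep_vec_in.
rewrite -coef1 deep_pairing// eqxx -upper1 upperE psi_1 fct_sumE big1.
  by move/eqP; rewrite oner_eq0.
move=> k _; rewrite dual_actE; last exact: deep_vec_in.
have -> : coef (deep_eval k) (deep_vec n) = 0.
  apply/funext => g; have [Cg|ng] := pselect (C g); last by rewrite coef0.
  by rewrite deep_pairing// (ltn_eqF (ltn_ord k)).
case: (Db k) => lin _ _.
have C0' := Can0 p iota (@borel_chart R Qp) C.
by have := lin (-1) 0 0 C0' C0'; rewrite scaler0 addr0 scaleN1r addNr.
Qed.

End Distributions.

(** In a coadmissible dual the Dirac distribution at 1 acts as the identity.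
    It kills the functional deep_eval unless some nonzero isotypic function is
    locally analytic, and then they all are. *)
Lemma coadmissible_basis_Can : coadmissible D X' (dual_action X C) ->
  forall i, CanC (iso_basis i).
Proof.
move=> [S [F [phi [phiD phi_act phi_th phi_inj _]]]] i.
have [n1 hn1] := open_nbhd p_prime sC openC.
have [[f [fi Cf [g Cg fg]]]|nf] := pselect (exists f, [/\ isotypic f, CanC f &
    exists2 g, C g & f g != 0]).
  apply: (Can_transfer p_prime iota_abs sC CG Cabs hn1 (isotypic_semi fi) Cf Cg fg).
  exact/isotypic_semi/iso_basis_isotypic.
exfalso; have D1 : D (lcalg_one D) by exact: (dirac_dual iota p_prime (@borel_chart R Qp) C1).
have [X0 Z0] := deep_eval_isodual 0; have [X00 _] := isodual0.
have act0 : dual_action X C (lcalg_one D) (deep_eval 0) = 0.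
  apply/funext => v; have [Xv|nv] := pselect (Xs v); last first.
    by rewrite /dual_action patchN// notin_setE.
  rewrite dual_actE//= /patch; case: ifP => //; rewrite inE => Cf.
  apply/eqP; apply: contrapT => /negP h; apply: nf.
  by exists (coef (deep_eval 0) v); split; [exact: Z0|by []|exists 1].
have phi0 n : phi 0 n = 0.
  by apply: (addrI (phi 0 n)); rewrite -phiD ?addr0.
have : deep_eval 0 = 0.
  apply: phi_inj => // n; have := phi_act _ _ n D1 X0.
  by rewrite act0 phi0 (compl_i1 (fs_compl S n)) scale1r => <-.
move=> /(congr1 (fun f => f (deep_vec 0))).
have := @deep_pairing 0 0 1 C1; rewrite coefE// invr1 (rep_one rX); last exact: deep_vec_in.
by rewrite eqxx -upper1 upperE psi_1 => -> /eqP; rewrite oner_eq0.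
Qed.

End NonAdmissibility.

Theorem proposition5p4 (R : realType) (p : nat) (Qp K : naField R)
    (iota : {rmorphism Qp -> K}) (j : nat) (chi sigma : Qp -> K) :
  prime p -> (2 < p)%N ->
  is_Qp p Qp ->
  (forall x : Qp, na_abs (iota x) = na_abs x) ->
  (1 <= j)%N ->
  character (padicpZ Qp p 1) sigma ->
  smooth_on (padicpZ Qp p 1) sigma ->
  [set x | padicpZ Qp p 1 x /\ sigma x = 1] = padicpZ Qp p j.+1 ->
  character (padicZ Qp) chi ->
  locally_analytic_on p iota (padicZ Qp) chi ->
  ~ admissible p iota (borel Qp) (X_rep p j chi sigma).
Proof.
move=> p_prime p_odd hQp iota_abs j1 sigma_char _ sigma_ker chi_char _.
move=> [C [sC CG openC compC coadm]].
have [B hB] := compact_bounded compC.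
have B0 : 0 <= B.
  by have [_ C1 _ _] := sC; apply: le_trans (hB _ C1 0 0); exact: na_abs_ge0.
have B1 : 0 < B + 1 by rewrite ltr_wpDl.
have [k0 hk0] := eps_small p_prime (divr_gt0 (eps_gt0 R p_prime j.+1) B1).
have k0_deep : p%:R ^- k0 * B <= p%:R ^- j.+1.
  move: hk0; rewrite ltr_pdivlMr// => /ltW; apply: le_trans.
  by rewrite ler_wpM2l ?lerDl// ltW// eps_gt0.
have [m [c [Cc c_cov c_sep]]] := diag_representatives p_prime sC CG compC j1.
apply: (not_coadmissible p_prime p_odd hQp iota_abs j1 sigma_char sigma_ker chi_char
  sC CG compC (fun g Cg => hB g Cg 0 1) k0_deep Cc c_cov c_sep _ coadm).
exact: (coadmissible_basis_Can p_prime p_odd hQp iota_abs j1 sigma_char sigma_ker chi_char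
  sC CG openC compC (fun g Cg => hB g Cg 0 1) k0_deep c coadm).
Qed.
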